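(* Consider the sequences generated by the Robust Compressed Push-Pull (RCPP) algorithm described in the context, and suppose that the network assumption (N), the function assumption (F) and the compression assumption (Q) of the context hold. Suppose that $\alpha_x,\alpha_y\in(0,\frac1r]$, that $\overline\lambda\ge M\widehat\lambda$ for some $M>0$, where $\overline\lambda=\frac1n u_R^{\intercal}\Lambda u_C$ and $\widehat\lambda=\max_i\lambda_i>0$, and that the consensus step-sizes $\gamma_x,\gamma_y>0$ and the maximum step-size $\widehat\lambda$ satisfy (with the constants defined in the context) $$\widehat\lambda\le\min\Big\{\tfrac{1}{6L},\ \tfrac{1}{6\sqrt C L},\ \tfrac{1}{ML},\ \tfrac{\sqrt{d_{42}}}{2\sqrt{e_1c_{32}c_{43}}}\tfrac{\theta_C}{L},\ m_1\cdot\tfrac{1}{\sqrt{96E}\,\|u_C\|}\tfrac{\gamma_x}{L},\ m_2\cdot\tfrac{\theta_C\gamma_y}{\sqrt{48e_1}\,L}\Big\},$$ where $$m_1=\min\Big\{\tfrac{1}{2\sqrt{c_2}}\tfrac{\theta_R}{1-\theta_R\gamma_x},\ \tfrac{\sqrt{c_{32}}}{\sqrt{c_3}},\ \tfrac{\sqrt{d_{42}}}{\sqrt{c_4}},\ \tfrac{\sqrt{d_{52}}}{\sqrt{c_5}}\Big\},$$ $$m_2=\min\Big\{\tfrac{1}{2\sqrt{c_2c_{32}}}\tfrac{\theta_R}{1-\theta_R\gamma_x},\ \tfrac{1}{\sqrt{c_3}},\ \tfrac{\sqrt{d_{42}}}{\sqrt{c_4c_{32}}},\ \tfrac{\sqrt{d_{52}}}{\sqrt{c_5c_{32}}}\Big\},$$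 $$\gamma_x\le\min\Big\{1,\ \tfrac{\theta_R\alpha_xr\delta}{8\sqrt{Cd_{42}c_{24}}},\ \tfrac{\sqrt{c_{32}}\,\alpha_xr\delta}{4\sqrt{Cd_{42}c_{34}}},\ \tfrac{\alpha_xr\delta}{4\sqrt{Cd_{44}}},\ \tfrac{\sqrt{d_{52}}\,\alpha_xr\delta}{4\sqrt{Cd_{42}d_{54}}},\ \tfrac{\sqrt{M\|u_C\|}}{2\sqrt{\|u_R\|e_1c_{32}}}\theta_C\gamma_y\Big\},$$ $$\gamma_y\le\min\Big\{1,\ \tfrac{\theta_Ce_2d_{52}}{4e_1c_{32}d_{53}},\ \tfrac{\theta_C(\alpha_yr\delta)^2e_1c_{32}}{16Ce_2d_{52}c_{35}},\ \tfrac{\theta_C(\alpha_yr\delta)^2d_{42}}{16Ce_2d_{52}c_{45}},\ \tfrac{\alpha_yr\delta}{4\sqrt{Cd_{55}}}\Big\}.$$ Let $$\tilde\rho=\max\Big\{1-\tfrac12M\widehat\lambda\mu,\ 1-\tfrac{\theta_R\gamma_x}{16},\ 1-\tfrac{\theta_C\gamma_y}{8},\ 1-\tfrac{\alpha_xr\delta}{4},\ 1-\tfrac{\alpha_yr\delta}{16}\Big\},$$ let $c\in(\tilde\rho,1)$ and $c_0>0$, and let the scaling parameters be given by $s_k^2=c_0c^k$, $s_k>0$. Then the optimization error $\Omega_o^k=\mathbb E[f(\overline X^k)-f(x^* )]$ and the consensus error $\Omega_c^k=\mathbb E[\|\Pi_RX^k\|_R^2]$ both converge to $0$ at the linear rate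 $\mathcal O(c^k)$.
   Context: Problem: $n\ge2$ agents minimize $f(x)=\frac1n\sum_{i=1}^nf_i(x)$ over $x\in\mathbb R^p$, with each $f_i:\mathbb R^p\to\mathbb R$ differentiable. $\|\cdot\|$ is the Euclidean norm, $\|\cdot\|_F$ the Frobenius norm, $\mathbf 1$ the all-ones column vector in $\mathbb R^n$, $I$ the identity. For $X\in\mathbb R^{n\times p}$ with rows $x_1^{\intercal},\dots,x_n^{\intercal}$, $\nabla F(X)\in\mathbb R^{n\times p}$ is the matrix with rows $\nabla f_1(x_1)^{\intercal},\dots,\nabla f_n(x_n)^{\intercal}$. Row vectors in $\mathbb R^{1\times p}$ are identified with points of $\mathbb R^p$ when $f,\nabla f$ are applied. Graph notation: for a nonnegative matrix $B\in\mathbb R^{n\times n}$, $\mathcal G_B$ is the digraph on $\mathcal N=\{1,\dots,n\}$ with an edge from $i$ to $j$ iff $B_{ji}>0$; $\mathcal R_B$ is the set of roots of all possible (directed) spanning trees of $\mathcal G_B$. (N) $R,C\in\mathbb R^{n\times n}$ are nonnegative mixing matrices (the mixing matrix $C$ is distinct from the scalar $C$ in (Q); in numerical constants, $C$ outside the expressions $I-C$ and $C_\gamma$ is the scalar). Both are supported by a strongly connected digraph $\mathcal G=(\mathcal N,\mathcal E)$, i.e. $\{(j,i):R_{ij}>0\}\subset\mathcal E$ and $\{(j,i):C_{ij}>0\}\subset\mathcal E$; $R\mathbf 1=\mathbf 1$, $\mathbf 1^{\intercal}C=\mathbf 1^{\intercal}$; and $\mathcal R_R\cap\mathcal R_{C^{\intercal}}\ne\emptyset$.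 Let $u_R$ be the unique nonnegative vector with $u_R^{\intercal}R=u_R^{\intercal}$, $u_R^{\intercal}\mathbf 1=n$, and $u_C$ the unique nonnegative vector with $Cu_C=u_C$, $u_C^{\intercal}\mathbf 1=n$. (F) $f$ has a minimizer $x^*$ and, for some $\mu>0$, satisfies the Polyak-Łojasiewicz inequality $\|\nabla f(x)\|^2\ge2\mu(f(x)-f(x^* ))$ for all $x$; each $\nabla f_i$ is $L_i$-Lipschitz; $L=\max_iL_i$. (Q) $\mathcal C:\mathbb R^p\to\mathbb R^p$ is a (random) compression operator such that for all $x$: $\mathbb E\|\mathcal C(x)-x\|^2\le C\|x\|^2+\sigma^2$ for some constants $C,\sigma^2\ge0$, and $\mathbb E\|\mathcal C(x)/r-x\|^2\le(1-\delta)\|x\|^2+\sigma_r^2$ for some constants $r>0$, $\delta\in(0,1]$, $\sigma_r^2\ge0$. For matrices in $\mathbb R^{n\times p}$, $\mathcal C$ is applied row-wise; each application uses randomness independent of the past, so the bounds hold conditionally on the history. RCPP algorithm: given $\Lambda=\mathrm{diag}(\lambda_1,\dots,\lambda_n)$ with $\lambda_i\ge0$, parameters $\alpha_x,\alpha_y,\gamma_x,\gamma_y>0$, scalars $s_k>0$, a deterministic initial $X^0\in\mathbb R^{n\times p}$, $Y^0=\nabla F(X^0)$, and $H_x^0=H_y^0=H_R^0=H_C^0=0$, iterate for $k=0,1,2,\dots$: $\widetilde X^k=X^k-\Lambda Y^k$; $Q_x^k=s_k\mathcal C((\widetilde X^k-H_x^k)/s_k)$; $\widehat X^k=H_x^k+Q_x^k$;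 $\widehat X_R^k=H_R^k+RQ_x^k$; $H_x^{k+1}=(1-\alpha_x)H_x^k+\alpha_x\widehat X^k$; $H_R^{k+1}=(1-\alpha_x)H_R^k+\alpha_x\widehat X_R^k$; $X^{k+1}=\widetilde X^k-\gamma_x(\widehat X^k-\widehat X_R^k)$; $\widetilde Y^k=Y^k+\nabla F(X^{k+1})-\nabla F(X^k)$; $Q_y^k=s_k\mathcal C((\widetilde Y^k-H_y^k)/s_k)$; $\widehat Y^k=H_y^k+Q_y^k$; $\widehat Y_C^k=H_C^k+CQ_y^k$ (matrix $C$); $H_y^{k+1}=(1-\alpha_y)H_y^k+\alpha_y\widehat Y^k$; $H_C^{k+1}=(1-\alpha_y)H_C^k+\alpha_y\widehat Y_C^k$; $Y^{k+1}=\widetilde Y^k-\gamma_y(\widehat Y^k-\widehat Y_C^k)$. Notation: $\overline X^k=\frac1nu_R^{\intercal}X^k$, $\Pi_R=I-\frac1n\mathbf 1u_R^{\intercal}$, $\Pi_C=I-\frac1nu_C\mathbf 1^{\intercal}$, $R_\gamma=I-\gamma_x(I-R)$, $C_\gamma=I-\gamma_y(I-C)$. Norms: fix invertible matrices $\widetilde R,\widetilde C\in\mathbb R^{n\times n}$ and constants $\theta_R,\theta_C\in(0,1]$ (which exist by a known result) such that, with $\|v\|_R=\|\widetilde Rv\|$, $\|v\|_C=\|\widetilde Cv\|$ for $v\in\mathbb R^n$ and the induced matrix norms on $\mathbb R^{n\times n}$, one has $\|\Pi_RR_\gamma\|_R\le1-\theta_R\gamma_x$ and $\|\Pi_CC_\gamma\|_C\le1-\theta_C\gamma_y$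 for all $\gamma_x,\gamma_y\in(0,1]$, $\|\Pi_R\|_R=\|\Pi_C\|_C=1$, and (normalization) $\|v\|\le\|v\|_R$, $\|v\|\le\|v\|_C$ for all $v$. For $X\in\mathbb R^{n\times p}$ put $\|X\|_R=\|\widetilde RX\|_F$, $\|X\|_C=\|\widetilde CX\|_F$. Let $\delta_{R,2},\delta_{C,2}>0$ be constants with $\|v\|_R\le\delta_{R,2}\|v\|$ and $\|v\|_C\le\delta_{C,2}\|v\|$ for all $v\in\mathbb R^n$. Constants ($\|I-R\|_R$, $\|R_\gamma\|_R$, $\|I-C\|_C$ are induced matrix norms): $c_2=2\delta_{R,2}^2$; $c_{24}=2\delta_{R,2}^2\|I-R\|_R^2$; $c_3=3\|R_\gamma\|_R^2$; $c_{32}=c_{34}=3\|I-R\|_R^2$; $c_{35}=4\delta_{C,2}^2\|I-C\|_C^2$; $d_1=2\delta_{C,2}^2$; $d_2=4\delta_{C,2}^2\|I-C\|_C^2$; $e_1=d_1+d_2C$ (scalar $C$); $c_4=36\|R_\gamma\|_R^2$; $d_{42}=d_{44}=36\|I-R\|_R^2$; $c_{43}=18\|I-C\|_C^2$; $c_{45}=36\|I-C\|_C^2$; $c_5=3\|R_\gamma\|_R^2$; $d_3=d_{53}=d_{55}=12\|I-C\|_C^2$; $d_4=4$; $e_2=d_3(C+1)+d_4$ (scalar $C$); $d_{52}=d_{54}=3\|I-R\|_R^2$; $E=\frac{\|u_R\|\|u_C\|}{n^2M}$. Convention: a bound with zero denominator (e.g. when the scalar $C=0$) is read as $+\infty$.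 *)

(* Defs.v *)
(* MathComp / MathComp-Analysis, over an arbitrary [K : realType].  A point of
   R^p is a row vector ['rV[K]_p], so that the rows of X : 'M[K]_(n, p) are the
   agents' local copies. *)
From HB Require Import structures.
From mathcomp Require Import all_boot all_order all_algebra.
From mathcomp Require Import all_classical all_reals all_analysis.
Set Implicit Arguments.
Unset Strict Implicit.
Unset Printing Implicit Defensive.
Import Order.TTheory GRing.Theory Num.Theory.
Import numFieldNormedType.Exports.
Local Open Scope classical_set_scope.
Local Open Scope ring_scope.

(* Frobenius norm, hence the Euclidean norm on row and column vectors (the
   library norm [`|A|] on matrices is the sup norm). *)
Definition fnorm (K : realType) (m n : nat) (A : 'M[K]_(m, n)) : K :=
  Num.sqrt (\sum_i \sum_j A i j ^+ 2).

(* Matrix norm induced by the vector norm v |-> ||S v||, for S invertible. *)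
Definition opnorm (K : realType) (n : nat) (S A : 'M[K]_n) : K :=
  sup [set a | exists2 v : 'cV[K]_n,
         v != 0 & a = fnorm (S *m (A *m v)) / fnorm (S *m v)].

Definition mxgraph (K : realType) (n : nat) (B : 'M[K]_n) : rel 'I_n :=
  [rel i j | 0 < B j i].

(* T is a spanning tree of e directed away from r: r has no in-edge, every
   other vertex has exactly one, and all the vertices are reachable from r. *)
Definition spanning_tree (V : finType) (e T : rel V) (r : V) : Prop :=
  [/\ subrel T e,
      forall i, #|[pred j | T j i]| = (i != r) :> nat &
      forall i, connect T r i].

Definition tree_root (V : finType) (e : rel V) (r : V) : Prop :=
  exists T : rel V, spanning_tree e T r.

Record network_assumption (K : realType) (n : nat) (R C : 'M[K]_n) : Prop := {
  net_R_ge0 : forall i j, 0 <= R i j;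
  net_C_ge0 : forall i j, 0 <= C i j;
  net_support : exists G : rel 'I_n,
    [/\ forall i j, connect G i j, subrel (mxgraph R) G &
        subrel (mxgraph C) G];
  net_R_row : R *m const_mx 1 = const_mx 1 :> 'cV[K]_n;
  net_C_col : const_mx 1 *m C = const_mx 1 :> 'rV[K]_n;
  net_roots : exists r, tree_root (mxgraph R) r /\ tree_root (mxgraph C^T) r }.

Definition left_eigvec (K : realType) (n : nat) (R : 'M[K]_n) (u : 'cV[K]_n) :=
  [/\ forall i, 0 <= u i 0, u^T *m R = u^T & \sum_i u i 0 = n%:R].
Definition right_eigvec (K : realType) (n : nat) (C : 'M[K]_n) (u : 'cV[K]_n) :=
  [/\ forall i, 0 <= u i 0, C *m u = u & \sum_i u i 0 = n%:R].

Definition relaxed (K : realType) (n : nat) (B : 'M[K]_n) (gam : K) : 'M[K]_n :=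
  1%:M - gam *: (1%:M - B).

Definition Pi_R (K : realType) (n : nat) (uR : 'cV[K]_n) : 'M[K]_n :=
  1%:M - n%:R^-1 *: (const_mx 1 *m uR^T).
Definition Pi_C (K : realType) (n : nat) (uC : 'cV[K]_n) : 'M[K]_n :=
  1%:M - n%:R^-1 *: (uC *m const_mx 1).

(* ||v||_S := ||S v|| is a norm in which Pi (relaxed B gam) is a contraction;
   used with (Pi, B) = (Pi_R, R) and (Pi_C, C).  d2 is an equivalence constant
   with the Euclidean norm. *)
Record adapted_norm (K : realType) (n : nat) (Pi B S : 'M[K]_n) (theta d2 : K)
  : Prop := {
  an_unit : S \in unitmx;
  an_theta_gt0 : 0 < theta;
  an_theta_le1 : theta <= 1;
  an_contract : forall gam, 0 < gam -> gam <= 1 ->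
    opnorm S (Pi *m relaxed B gam) <= 1 - theta * gam;
  an_Pi : opnorm S Pi = 1;
  an_normalized : forall v : 'cV[K]_n, fnorm v <= fnorm (S *m v);
  an_d2_gt0 : 0 < d2;
  an_d2 : forall v : 'cV[K]_n, fnorm (S *m v) <= d2 * fnorm v }.

Definition grad (K : realType) (p : nat) (g : 'rV[K]_p -> K) (x : 'rV[K]_p)
  : 'rV[K]_p := \row_j 'D_(delta_mx 0 j) g x.

Definition favg (K : realType) (n p : nat) (f : 'I_n -> 'rV[K]_p -> K)
  (x : 'rV[K]_p) : K := n%:R^-1 * \sum_i f i x.

Definition gradF (K : realType) (n p : nat) (f : 'I_n -> 'rV[K]_p -> K)
  (X : 'M[K]_(n, p)) : 'M[K]_(n, p) := \matrix_(i, j) grad (f i) (row i X) 0 j.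

Record function_assumption (K : realType) (n p : nat)
  (f : 'I_n -> 'rV[K]_p -> K) (xs : 'rV[K]_p) (mu : K) (Ls : 'I_n -> K)
  : Prop := {
  fun_diff : forall i x, differentiable (f i) x;
  fun_min : forall x, favg f xs <= favg f x;
  fun_mu_gt0 : 0 < mu;
  fun_PL : forall x,
    2 * mu * (favg f x - favg f xs) <= fnorm (grad (favg f) x) ^+ 2;
  fun_lip : forall i x y,
    fnorm (grad (f i) x - grad (f i) y) <= Ls i * fnorm (x - y) }.

(* The random operator is x |-> comp z x, where the seed z has law nu.  It is
   jointly measurable in (z, x); R^p carries the product Borel sigma-algebra of
   [p.-tuple K]. *)
Record compression_assumption (K : realType) (p : nat) (d : measure_display)
  (Z : measurableType d) (nu : probability Z K)
  (comp : Z -> 'rV[K]_p -> 'rV[K]_p) (Cs sigma2 r delta sigmar2 : K)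
  : Prop := {
  cmp_measurable : forall j, measurable_fun [set: Z * p.-tuple K]
    (fun zt => comp zt.1 (\row_i tnth zt.2 i) 0 j);
  cmp_C_ge0 : 0 <= Cs;
  cmp_sigma2_ge0 : 0 <= sigma2;
  cmp_error : forall x : 'rV[K]_p,
    ('E_nu[fun z => (fnorm (comp z x - x) ^+ 2)%R]
       <= (Cs * fnorm x ^+ 2 + sigma2)%:E)%E;
  cmp_r_gt0 : 0 < r;
  cmp_delta_gt0 : 0 < delta;
  cmp_delta_le1 : delta <= 1;
  cmp_sigmar2_ge0 : 0 <= sigmar2;
  cmp_scaled_error : forall x : 'rV[K]_p,
    ('E_nu[fun z => (fnorm (r^-1 *: comp z x - x) ^+ 2)%R]
       <= ((1 - delta) * fnorm x ^+ 2 + sigmar2)%:E)%E }.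

(* zeta t i is the seed used by agent i in the t-th round of compression;
   [history zeta t] is the sigma-algebra generated by the rounds before t. *)
Definition history (d d' : measure_display) (Omega : measurableType d)
  (Z : measurableType d') (n : nat) (zeta : nat -> 'I_n -> Omega -> Z)
  (t : nat) : set (set Omega) :=
  <<s [set B | exists t' i A,
         [/\ (t' < t)%N, measurable A & B = zeta t' i @^-1` A]] >>.

(* Every seed is independent of the past; nothing is required of the joint law
   of the n seeds of one round. *)
Record fresh_seeds (K : realType) (d d' : measure_display)
  (Omega : measurableType d) (P : probability Omega K)
  (Z : measurableType d') (nu : probability Z K) (n : nat)
  (zeta : nat -> 'I_n -> Omega -> Z) : Prop := {
  seed_measurable : forall t i, measurable_fun [set: Omega] (zeta t i);
  seed_law : forall t i A, measurable A -> P (zeta t i @^-1` A) = nu A;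
  seed_indep : forall t i A B, measurable A -> history zeta t B ->
    (P (zeta t i @^-1` A `&` B) = P (zeta t i @^-1` A) * P B)%E }.

Definition rowwise (K : realType) (n p : nat)
  (q : 'I_n -> 'rV[K]_p -> 'rV[K]_p) (X : 'M[K]_(n, p)) : 'M[K]_(n, p) :=
  \matrix_(i, j) q i (row i X) 0 j.

Record rcpp_state (K : realType) (n p : nat) := RCPPState {
  st_X : 'M[K]_(n, p);
  st_Y : 'M[K]_(n, p);
  st_Hx : 'M[K]_(n, p);
  st_HR : 'M[K]_(n, p);
  st_Hy : 'M[K]_(n, p);
  st_HC : 'M[K]_(n, p) }.

(* qx and qy are the operators sampled by the agents for the two compressions
   of the iteration; s is its scaling parameter. *)
Definition rcpp_step (K : realType) (n p : nat) (f : 'I_n -> 'rV[K]_p -> K)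
  (R C Lam : 'M[K]_n) (alx aly gx gy s : K)
  (qx qy : 'I_n -> 'rV[K]_p -> 'rV[K]_p) (st : rcpp_state K n p)
  : rcpp_state K n p :=
  let: RCPPState X Y Hx HR Hy HC := st in
  let Xt := X - Lam *m Y in
  let Qx := s *: rowwise qx (s^-1 *: (Xt - Hx)) in
  let Xh := Hx + Qx in
  let XhR := HR + R *m Qx in
  let Hx' := (1 - alx) *: Hx + alx *: Xh in
  let HR' := (1 - alx) *: HR + alx *: XhR in
  let X' := Xt - gx *: (Xh - XhR) in
  let Yt := Y + gradF f X' - gradF f X in
  let Qy := s *: rowwise qy (s^-1 *: (Yt - Hy)) in
  let Yh := Hy + Qy in
  let YhC := HC + C *m Qy in
  let Hy' := (1 - aly) *: Hy + aly *: Yh in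
  let HC' := (1 - aly) *: HC + aly *: YhC in
  let Y' := Yt - gy *: (Yh - YhC) in
  RCPPState X' Y' Hx' HR' Hy' HC'.

(* Iteration k consumes the rounds of seeds 2k (for Q_x^k) and 2k+1 (for
   Q_y^k), evaluated at a fixed outcome: zeta here is t |-> i |-> seed. *)
Fixpoint rcpp (K : realType) (n p : nat) (f : 'I_n -> 'rV[K]_p -> K)
  (R C Lam : 'M[K]_n) (alx aly gx gy : K) (s : nat -> K) (X0 : 'M[K]_(n, p))
  (Z : Type) (comp : Z -> 'rV[K]_p -> 'rV[K]_p) (zeta : nat -> 'I_n -> Z)
  (k : nat) : rcpp_state K n p :=
  if k is k'.+1 then
    rcpp_step f R C Lam alx aly gx gy (s k')
      (fun i => comp (zeta k'.*2 i)) (fun i => comp (zeta k'.*2.+1 i))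
      (rcpp f R C Lam alx aly gx gy s X0 comp zeta k')
  else RCPPState X0 (gradF f X0) 0 0 0 0.

(* An upper bound a / b, read as +oo when b = 0. *)
Definition bfrac (K : realType) (a b : K) : \bar K :=
  if b == 0 then +oo%E else (a / b)%:E.
Arguments bfrac {K} (a b)%_R.

Definition minlist (K : realType) (s : seq (\bar K)) : \bar K :=
  \big[Order.min/+oo%E]_(b <- s) b.

Definition linear_rate (K : realType) (c : K) (u : nat -> \bar K) : Prop :=
  u @ \oo --> 0%E /\
  exists B : K, forall k, (`|u k| <= (B * c ^+ k)%:E)%E.

(* Main.v *)
(** The quantities [f (Xbar^k) - f xs], [||Pi_R X^k||_R^2], [||Pi_C Y^k||_C^2],
[||X^k - Lam Y^k - Hx^k||^2] and [||Y^k - Hy^k||^2] satisfy a coupled system of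
linear inequalities, and the step-size bounds make a positive combination [V]
of them contract up to the compression noise:
[E V_(k+1) <= rho E V_k + B s_k^2].  As [s_k^2 = c0 c^k] with [rho < c < 1],
this gives [E V_k = O(c^k)].

In the descent inequality for [f] a term [- (lb / 2) ||grad f (Xbar)||^2] is
kept: half of it gives the contraction through the Polyak-Lojasiewicz
inequality, the other half absorbs the part of [||Y||^2] that is proportional
to [||grad f (Xbar)||^2].  The equivalence constants satisfy
[dR2^2 >= ||uR||^2 / (2n)] and [dC2^2 >= ||uC||^2 / (2n)]; with the first entry
of [m1] and the last bound on [gx] this yields [lb L <= 1], which the descent
step needs. *)
Require Import Defs.
From HB Require Import structures.
From mathcomp Require Import all_boot all_order all_algebra.
From mathcomp Require Import all_classical all_reals all_analysis.
From mathcomp Require Import measurable_realfun ring lra.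
Set Implicit Arguments.
Unset Strict Implicit.
Unset Printing Implicit Defensive.
Import Order.TTheory GRing.Theory Num.Theory.
Import numFieldNormedType.Exports.
Local Open Scope classical_set_scope.
Local Open Scope ring_scope.

(** * Frobenius and induced norms *)

(** An iteration compresses twice, and the matrix compressed the second time already depends on the
    outcome of the first compression. The potential is therefore bounded in two layers: once with
    [Q_x] frozen ([preY]), and once at the current state alone ([preX]). After each layer one round
    of seeds is integrated, through the product law of a fresh seed and the past; conditional
    expectations never occur as objects.

    All expectations are integrals of nonnegative functions. This avoids integrability questions but
    leaves no room for a negative integrand, whereas the retained gradient term is negative. It is
    therefore kept together with the objective gap, as [o - lb / 2 * G], which is nonnegative
    because a gradient step of length [lb] cannot go below the minimum.

    Norms appear almost only squared, so that the analysis reduces to polynomial inequalities in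
    scalars. *)

Definition sqn (K : realType) (m n : nat) (A : 'M[K]_(m, n)) : K :=
  \sum_i \sum_j A i j ^+ 2.

Section SquaredNorm.
Context {K : realType}.

Lemma sqn_ge0 m n (A : 'M[K]_(m, n)) : 0 <= sqn A.
Proof. by apply: sumr_ge0 => i _; apply: sumr_ge0 => j _; exact: sqr_ge0. Qed.

Lemma fnorm_ge0 m n (A : 'M[K]_(m, n)) : 0 <= fnorm A.
Proof. exact: sqrtr_ge0. Qed.

Lemma sqr_fnorm m n (A : 'M[K]_(m, n)) : fnorm A ^+ 2 = sqn A.
Proof. by rewrite sqr_sqrtr ?sqn_ge0. Qed.

Lemma sqn0 m n : sqn (0 : 'M[K]_(m, n)) = 0.
Proof. by rewrite /sqn big1// => i _; rewrite big1// => j _; rewrite mxE expr0n. Qed.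

Lemma sqn_entry m n (A : 'M[K]_(m, n)) i j : A i j ^+ 2 <= sqn A.
Proof.
rewrite /sqn (bigD1 i)//= (bigD1 j)//= -addrA lerDl addr_ge0//.
  by apply: sumr_ge0 => l _; exact: sqr_ge0.
by apply: sumr_ge0 => k _; apply: sumr_ge0 => l _; exact: sqr_ge0.
Qed.

Lemma sqn_eq0 m n (A : 'M[K]_(m, n)) : sqn A = 0 -> A = 0.
Proof.
move=> A0; apply/matrixP => i j; rewrite mxE; apply/eqP.
by rewrite -sqrf_eq0 eq_le sqr_ge0 -A0 sqn_entry.
Qed.

Lemma sqnZ m n (k : K) (A : 'M[K]_(m, n)) : sqn (k *: A) = k ^+ 2 * sqn A.
Proof.
rewrite /sqn mulr_sumr; apply: eq_bigr => i _; rewrite mulr_sumr.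
by apply: eq_bigr => j _; rewrite mxE exprMn.
Qed.

Lemma sqnN m n (A : 'M[K]_(m, n)) : sqn (- A) = sqn A.
Proof. by rewrite -scaleN1r sqnZ sqrrN expr1n mul1r. Qed.

Lemma sqn_row m n (A : 'M[K]_(m, n)) : sqn A = \sum_i sqn (row i A).
Proof.
apply: eq_bigr => i _; rewrite /sqn big_ord1.
by apply: eq_bigr => j _; rewrite mxE.
Qed.

Lemma sqn_col m n (A : 'M[K]_(m, n)) : sqn A = \sum_j sqn (col j A).
Proof.
rewrite /sqn exchange_big /=; apply: eq_bigr => j _; apply: eq_bigr => i _.
by rewrite big_ord1 mxE.
Qed.

Lemma sqn_tr m n (A : 'M[K]_(m, n)) : sqn A^T = sqn A.
Proof.
rewrite /sqn exchange_big; apply: eq_bigr => i _; apply: eq_bigr => j _.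
by rewrite mxE.
Qed.

(** Young's inequality and convexity hold entry by entry, where the gap is an explicit square; this
    lifts them to matrices. *)
Lemma sqn_linear_le m n (u v : K) (A B : 'M[K]_(m, n)) (T : 'M[K]_(m, n)) :
  (forall i j, T i j ^+ 2 <= u * A i j ^+ 2 + v * B i j ^+ 2) ->
  sqn T <= u * sqn A + v * sqn B.
Proof.
move=> h; rewrite /sqn !mulr_sumr -big_split ler_sum//= => i _.
by rewrite !mulr_sumr -big_split ler_sum.
Qed.

Lemma sqnD_young m n (t : K) (A B : 'M[K]_(m, n)) : 0 < t ->
  sqn (A + B) <= (1 + t) * sqn A + (1 + t^-1) * sqn B.
Proof.
move=> t0; apply: sqn_linear_le => i j; rewrite mxE.
move: (A i j) (B i j) => a b.
have -> : (1 + t) * a ^+ 2 + (1 + t^-1) * b ^+ 2 =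
   (a + b) ^+ 2 + t^-1 * (t * a - b) ^+ 2 by field; rewrite gt_eqF.
by rewrite lerDl mulr_ge0 ?sqr_ge0// invr_ge0 ltW.
Qed.

Lemma sqnD2 m n (A B : 'M[K]_(m, n)) : sqn (A + B) <= 2 * sqn A + 2 * sqn B.
Proof. by have := sqnD_young A B ltr01; rewrite invr1. Qed.

Lemma sqnD3 m n (A B C : 'M[K]_(m, n)) :
  sqn (A + B + C) <= 3 * sqn A + 3 * sqn B + 3 * sqn C.
Proof.
have h2 : (0 < 2 :> K) by [].
(* Ratio 2 gives [1 + 2] on [C] and [1 + 1/2] on [A + B]; splitting [A + B] doubles the latter to
   3. *)
have := sqnD_young C (A + B) (ltr0n K 2); have := sqnD2 A B.
by rewrite (addrC C); lra.
Qed.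

Lemma sqn_convex m n (t : K) (A B : 'M[K]_(m, n)) : 0 <= t -> t <= 1 ->
  sqn ((1 - t) *: A + t *: B) <= (1 - t) * sqn A + t * sqn B.
Proof.
move=> t0 t1; apply: sqn_linear_le => i j; rewrite !mxE.
move: (A i j) (B i j) => a b.
have -> : (1 - t) * a ^+ 2 + t * b ^+ 2 =
  ((1 - t) * a + t * b) ^+ 2 + t * (1 - t) * (a - b) ^+ 2 by ring.
by rewrite lerDl mulr_ge0 ?sqr_ge0// mulr_ge0// subr_ge0.
Qed.

Lemma cauchy_schwarz (I : finType) (a b : I -> K) :
  (\sum_i a i * b i) ^+ 2 <= (\sum_i a i ^+ 2) * (\sum_i b i ^+ 2).
Proof.
set s := \sum_i a i * b i; set p := \sum_i a i ^+ 2; set q := \sum_i b i ^+ 2.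
have p0 : 0 <= p by apply: sumr_ge0 => i _; exact: sqr_ge0.
(* Multiplied by [p], the gap is the sum of the squares of [p * b i - s * a i]; when [p = 0] all the
   [a i] vanish. *)
have key : 0 <= p * (p * q - s ^+ 2).
  have -> : p * (p * q - s ^+ 2) = \sum_i (p * b i - s * a i) ^+ 2.
    transitivity (\sum_i (p ^+ 2 * b i ^+ 2 + - (2 * p * s) * (a i * b i) +
        s ^+ 2 * a i ^+ 2)); last by apply: eq_bigr => i _; ring.
    by rewrite !big_split/= -!mulr_sumr -/s -/p -/q; ring.
  by apply: sumr_ge0 => i _; exact: sqr_ge0.
have [p_gt0|] := ltP 0 p.
  by move: key; rewrite pmulr_rge0// subr_ge0.
move=> p_le0; have p_eq0 : p = 0 by apply/eqP; rewrite eq_le p_le0 p0.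
suff -> : s = 0 by rewrite p_eq0 mul0r expr0n.
rewrite /s big1// => i _; suff /eqP -> : a i == 0 by rewrite mul0r.
by rewrite -sqrf_eq0; apply/eqP; apply: (psumr_eq0P _ p_eq0) => // j _; exact: sqr_ge0.
Qed.

Lemma sqn_mulmx m n p (A : 'M[K]_(m, n)) (B : 'M[K]_(n, p)) :
  sqn (A *m B) <= sqn A * sqn B.
Proof.
rewrite (sqn_row A) (sqn_col B) mulr_suml ler_sum// => i _.
rewrite mulr_sumr ler_sum// => j _; rewrite mxE.
apply: le_trans (cauchy_schwarz _ _) _.
rewrite /sqn big_ord1; under [X in _ <= X * _]eq_bigr do rewrite mxE.
by under [X in _ <= _ * X]eq_bigr do rewrite big_ord1 mxE.
Qed.

Lemma fnorm_mulmx m n p (A : 'M[K]_(m, n)) (B : 'M[K]_(n, p)) :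
  fnorm (A *m B) <= fnorm A * fnorm B.
Proof.
by rewrite /fnorm -sqrtrM ?ler_wsqrtr ?sqn_mulmx//; exact: sqn_ge0.
Qed.

Lemma fnormD m n (A B : 'M[K]_(m, n)) : fnorm (A + B) <= fnorm A + fnorm B.
Proof.
rewrite -(@ler_pXn2r _ 2)// ?nnegrE ?fnorm_ge0 ?addr_ge0 ?fnorm_ge0//.
rewrite sqrrD !sqr_fnorm.
have -> : sqn (A + B) =
    sqn A + 2 * (\sum_(k : 'I_m * 'I_n) A k.1 k.2 * B k.1 k.2) + sqn B.
  rewrite /sqn !pair_bigA/= mulr_sumr -!big_split/=; apply: eq_bigr => k _.
  by rewrite mxE; ring.
rewrite lerD2r lerD2l -[leRHS]mulr_natl ler_pM2l//.
apply: (le_trans (ler_norm _)).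
rewrite -sqrtr_sqr /fnorm -sqrtrM; last exact: sqn_ge0.
apply: ler_wsqrtr.
apply: le_trans (cauchy_schwarz _ _) _.
by rewrite /sqn !pair_bigA.
Qed.

Lemma fnormN m n (A : 'M[K]_(m, n)) : fnorm (- A) = fnorm A.
Proof. by rewrite /fnorm -![\sum_i _]/(sqn _) sqnN. Qed.

Lemma fnormZ m n (k : K) (A : 'M[K]_(m, n)) : fnorm (k *: A) = `|k| * fnorm A.
Proof.
rewrite /fnorm -![\sum_i _]/(sqn _) sqnZ sqrtrM ?sqr_ge0//.
by rewrite sqrtr_sqr.
Qed.

Lemma fnorm_eq0 m n (A : 'M[K]_(m, n)) : fnorm A = 0 -> A = 0.
Proof. by move=> A0; apply: sqn_eq0; rewrite -sqr_fnorm A0 expr0n. Qed.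

Lemma fnorm0 m n : fnorm (0 : 'M[K]_(m, n)) = 0.
Proof. by rewrite -[0 in LHS](scale0r 0) fnormZ normr0 mul0r. Qed.

Lemma col_mulmx m n p (A : 'M[K]_(m, n)) (B : 'M[K]_(n, p)) j :
  col j (A *m B) = A *m col j B.
Proof. by apply/matrixP => i k; rewrite !mxE; apply: eq_bigr => l _; rewrite mxE. Qed.

(** The squared Frobenius norm is a sum over columns, so comparisons known for vectors only, such as
    those of the adapted and induced norms, pass to the [n] by [p] iterates. *)
Lemma sqn_colwise m1 m2 n p (A : 'M[K]_(m1, n)) (B : 'M[K]_(m2, n)) (k : K)
    (X : 'M[K]_(n, p)) : 0 <= k ->
  (forall v : 'cV[K]_n, fnorm (A *m v) <= k * fnorm (B *m v)) ->
  sqn (A *m X) <= k ^+ 2 * sqn (B *m X).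
Proof.
move=> k0 h; rewrite !(sqn_col (_ *m X)) mulr_sumr ler_sum// => j _.
rewrite !col_mulmx -!sqr_fnorm -exprMn ler_pXn2r//.
- by rewrite nnegrE fnorm_ge0.
- by rewrite nnegrE mulr_ge0 ?fnorm_ge0.
Qed.

Lemma sqn_diag n p (lam : 'rV[K]_n) (l : K) (X : 'M[K]_(n, p)) :
  (forall i, 0 <= lam 0 i <= l) -> sqn (diag_mx lam *m X) <= l ^+ 2 * sqn X.
Proof.
move=> h; rewrite /sqn mulr_sumr ler_sum// => i _.
rewrite mulr_sumr ler_sum// => j _; rewrite mul_diag_mx mxE exprMn.
have /andP[l0 l1] := h i.
by rewrite ler_wpM2r ?sqr_ge0// ler_pXn2r// nnegrE ?(le_trans l0).
Qed.

End SquaredNorm.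

Section InducedNorm.
Context {K : realType} {n : nat} (S : 'M[K]_n) (Su : S \in unitmx).
Hypothesis n_gt0 : (0 < n)%N.

Lemma fnorm_unit_gt0 (v : 'cV[K]_n) : v != 0 -> 0 < fnorm (S *m v).
Proof.
move=> v0; rewrite lt_neqAle fnorm_ge0 andbT eq_sym; apply/eqP => /fnorm_eq0.
move=> Sv0; move/eqP: v0; apply.
by rewrite -(mulKmx Su v) Sv0 mulmx0.
Qed.

Let ratios (A : 'M[K]_n) := [set a | exists2 v : 'cV[K]_n,
  v != 0 & a = fnorm (S *m (A *m v)) / fnorm (S *m v)].

Lemma opnorm_ub (A : 'M[K]_n) (v : 'cV[K]_n) :
  fnorm (S *m (A *m v)) <= opnorm S A * fnorm (S *m v).
Proof.
have [->|v0] := eqVneq v 0; first by rewrite !mulmx0 fnorm0 mulr0.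
rewrite -ler_pdivrMr ?fnorm_unit_gt0//.
apply: (@ub_le_sup _ (ratios A)); last by exists v.
(* The Frobenius norm of [S A S^-1] bounds all the ratios, so [sup] is a genuine supremum. *)
exists (fnorm (S *m A *m invmx S)) => _ [w w0 ->].
rewrite ler_pdivrMr ?fnorm_unit_gt0//.
apply: le_trans (fnorm_mulmx _ _).
by rewrite !mulmxA mulmxKV.
Qed.

Lemma opnorm_le (A : 'M[K]_n) (k : K) :
  (forall v : 'cV[K]_n, fnorm (S *m (A *m v)) <= k * fnorm (S *m v)) ->
  opnorm S A <= k.
Proof.
move=> h; apply: ge_sup.
  (* Bounding a [sup] from above requires a nonempty set; the all-ones vector is nonzero since [n]
     is positive. *)
  pose v : 'cV[K]_n := const_mx 1.
  exists (fnorm (S *m (A *m v)) / fnorm (S *m v)); exists v => //.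
  apply/eqP => /matrixP /(_ (Ordinal n_gt0) 0); rewrite !mxE => /eqP.
  by rewrite oner_eq0.
by move=> _ [v v0 ->]; rewrite ler_pdivrMr ?fnorm_unit_gt0.
Qed.

Lemma opnorm_ge0 (A : 'M[K]_n) : 0 <= opnorm S A.
Proof.
pose v : 'cV[K]_n := const_mx 1.
have v0 : v != 0.
  apply/eqP => /matrixP /(_ (Ordinal n_gt0) 0); rewrite !mxE => /eqP.
  by rewrite oner_eq0.
have := opnorm_ub A v; rewrite -ler_pdivrMr ?fnorm_unit_gt0//.
by apply: le_trans; rewrite divr_ge0 ?fnorm_ge0.
Qed.

End InducedNorm.

(** * Smooth functions *)

Definition dotv (K : realType) (p : nat) (u v : 'rV[K]_p) : K :=
  \sum_j u 0 j * v 0 j.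

Section Smooth.
Context {K : realType} {p : nat}.
Implicit Types (x y u v : 'rV[K]_p) (g : 'rV[K]_p -> K).

Lemma sqn_rV u : sqn u = \sum_j u 0 j ^+ 2.
Proof. by rewrite /sqn big_ord1. Qed.

Lemma dotvZr (k : K) u v : dotv u (k *: v) = k * dotv u v.
Proof. by rewrite /dotv mulr_sumr; apply: eq_bigr => j _; rewrite mxE; ring. Qed.

Lemma dotvBl u1 u2 v : dotv (u1 - u2) v = dotv u1 v - dotv u2 v.
Proof.
by rewrite /dotv -sumrB; apply: eq_bigr => j _; rewrite !mxE; ring.
Qed.

Lemma dotv_le (L t : K) u v : 0 <= L -> 0 <= t ->
  sqn u <= L ^+ 2 * (t ^+ 2 * sqn v) -> dotv u v <= L * t * sqn v.
Proof.
move=> L0 t0 h; apply: le_trans (ler_norm _) _.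
rewrite -(@ler_pXn2r _ 2)// ?nnegrE ?normr_ge0 ?mulr_ge0 ?sqn_ge0//.
rewrite real_normK ?num_real//; apply: le_trans (cauchy_schwarz _ _) _.
rewrite -!sqn_rV (le_trans (ler_wpM2r (sqn_ge0 _) h))//.
by rewrite le_eqVlt; apply/orP; left; apply/eqP; ring.
Qed.

(** Jensen's inequality, obtained from Cauchy-Schwarz against the constant 1 in each coordinate. *)
Lemma sqn_mean n (a : 'I_n -> 'rV[K]_p) :
  sqn (n%:R^-1 *: \sum_i a i) <= n%:R^-1 * \sum_i sqn (a i).
Proof.
have [n0|n_gt0] := posnP n.
  subst n; rewrite !big_ord0 scaler0 sqn0 mulr0//.
rewrite sqnZ expr2 -mulrA ler_pM2l ?invr_gt0 ?ltr0n//.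
rewrite ler_pdivrMl ?ltr0n// sqn_rV.
under [X in _ <= _ * X]eq_bigr do rewrite sqn_rV.
rewrite exchange_big/= mulr_sumr ler_sum// => j _.
rewrite summxE; have := cauchy_schwarz (fun=> 1) (fun i => a i 0 j).
under [X in X ^+ 2 <= _ -> _]eq_bigr do rewrite mul1r.
by under [X in _ <= X * _ -> _]eq_bigr do rewrite expr1n;
  rewrite sumr_const card_ord.
Qed.

Lemma derive_grad g x v : differentiable g x -> 'D_v g x = dotv (grad g x) v.
Proof.
move=> dg; rewrite deriveE// [v in LHS]row_sum_delta linear_sum/=.
apply: eq_bigr => j _; rewrite linearZ/= mxE deriveE//.
by rewrite /GRing.scale/= mulrC.
Qed.

Lemma is_derive_line g x v (t : K) : differentiable g (x + t *: v) ->
  is_derive t 1 (fun s : K => g (x + s *: v)) (dotv (grad g (x + t *: v)) v).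
Proof.
move=> dg; have E : (fun h : K => h^-1 *: ((fun s : K => g (x + s *: v))
      \o shift t) (h *: 1) - h^-1 *: g (x + t *: v)) =
   (fun h : K => h^-1 *: ((g \o shift (x + t *: v)) (h *: v) - g (x + t *: v))).
  apply/funext => h /=; rewrite -scalerBr; congr (_ *: (g _ - _)).
  by rewrite [h *: 1]mulr1 scalerDl addrCA.
apply: DeriveDef.
  rewrite /derivable; under eq_fun do rewrite scalerBr.
  by rewrite E; exact: diff_derivable.
rewrite -derive_grad// /derive; under eq_fun do rewrite scalerBr.
by rewrite E.
Qed.

Definition smooth (L : K) g :=
  (forall x, differentiable g x) /\
  forall x y, sqn (grad g x - grad g y) <= L ^+ 2 * sqn (x - y).

Lemma smooth_upper (L : K) g x v : 0 <= L -> smooth L g ->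
  g (x + v) <= g x + dotv (grad g x) v + L / 2 * sqn v.
Proof.
move=> L0 [dg lip].
(* [phi] is [g] on the segment minus the nonconstant part of the claimed quadratic bound. The
   Lipschitz gradient gives [dphi <= 0] on []0, 1[], so the mean value theorem replaces the usual
   integral of the gradient. *)
pose phi := (fun s : K => g (x + s *: v)) -
  ((dotv (grad g x) v) \*: (id : K -> K)) -
  ((L / 2 * sqn v) \*: (@GRing.exp K ^~ 2)).
pose dphi (t : K) := dotv (grad g (x + t *: v)) v - dotv (grad g x) v
  - L * t * sqn v.
have dphiP t : is_derive t (1 : K) phi (dphi t).
  have h1 := is_derive_line (dg (x + t *: v)).
  rewrite /phi; apply: is_derive_eq.
  rewrite /dphi /GRing.scale/=. by field.
have [c /itvP c01 E] : exists2 c, c \in `]0%R, 1[ &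
    phi 1 - phi 0 = dphi c * (1 - 0).
  apply: MVT => //; apply: derivable_within_continuous => t _.
  by apply: ex_derive.
have : dphi c <= 0.
  rewrite /dphi subr_le0 -dotvBl; apply: dotv_le; rewrite ?c01//.
  apply: le_trans (lip _ _) _.
  by rewrite addrC addKr sqnZ.
move: E; rewrite subr0 mulr1 => <-; rewrite subr_le0.
have phiE t : phi t = g (x + t *: v) - dotv (grad g x) v * t -
  L / 2 * sqn v * t ^+ 2 by [].
by rewrite !phiE scale1r scale0r addr0; lra.
Qed.

Lemma dotvN u v : dotv u (- v) = - dotv u v.
Proof. by rewrite -scaleN1r dotvZr mulN1r. Qed.

Lemma sqnB_rV u v : sqn (u - v) = sqn u - 2 * dotv v u + sqn v.
Proof.
rewrite !sqn_rV /dotv mulr_sumr -sumrB -big_split/=.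
by apply: eq_bigr => j _; rewrite !mxE; ring.
Qed.

(** Polarization turns [- <grad, v>] into [(||v - lb grad||^2 - ||v||^2 - lb^2 ||grad||^2) / (2
    lb)]. The remaining multiple of [||v||^2] is [(L - 1 / lb) / 2], which is nonpositive when
    [lb L <= 1]. *)
Lemma smooth_descent (L lb : K) g x v : 0 <= L -> smooth L g ->
  0 < lb -> lb * L <= 1 ->
  g (x - v) <= g x - lb / 2 * sqn (grad g x) +
    (2 * lb)^-1 * sqn (v - lb *: grad g x).
Proof.
move=> L0 sg lb0 lbL; apply: le_trans (smooth_upper _ _ L0 sg) _.
rewrite dotvN sqnN sqnB_rV -[dotv (_ *: _) _]/(_) sqnZ.
have -> : dotv (lb *: grad g x) v = lb * dotv (grad g x) v.
  by rewrite /dotv mulr_sumr; apply: eq_bigr => j _; rewrite mxE mulrA.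
rewrite -subr_ge0.
have -> : g x - lb / 2 * sqn (grad g x) + (2 * lb)^-1 *
   (sqn v - 2 * (lb * dotv (grad g x) v) + lb ^+ 2 * sqn (grad g x)) -
   (g x - dotv (grad g x) v + L / 2 * sqn v) =
   (1 - lb * L) * ((2 * lb)^-1 * sqn v) by field; rewrite gt_eqF.
by rewrite mulr_ge0 ?subr_ge0// mulr_ge0 ?sqn_ge0// invr_ge0 mulr_ge0// ltW.
Qed.

(** Descent along the exact step [lb *: grad g x], compared with the minimum. It keeps the
    integrands nonnegative although a gradient term is subtracted. *)
Lemma smooth_gap (L lb : K) g xs x : 0 <= L -> smooth L g ->
  0 < lb -> lb * L <= 1 -> (forall y, g xs <= g y) ->
  0 <= g x - g xs - lb / 2 * sqn (grad g x).
Proof.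
move=> L0 sg lb0 lbL hmin.
have := smooth_descent x (lb *: grad g x) L0 sg lb0 lbL.
by rewrite subrr sqn0 mulr0 addr0; have := hmin (x - lb *: grad g x); lra.
Qed.

Lemma grad_favg n (f : 'I_n -> 'rV[K]_p -> K) x :
  (forall i x, differentiable (f i) x) ->
  grad (favg f) x = n%:R^-1 *: \sum_i grad (f i) x.
Proof.
move=> df; apply/rowP => j; rewrite !mxE summxE.
have -> : favg f = n%:R^-1 \*: (\sum_i f i).
  by apply/funext => y; rewrite /favg /= fct_sumE.
have dD i : derivable (f i) x (delta_mx 0 j) by exact: diff_derivable.
rewrite deriveZ; last first.
  by apply: derivable_sum.
by rewrite derive_sum//; congr (_ * _); apply: eq_bigr => i _; rewrite mxE.
Qed.

Lemma smooth_favg n (f : 'I_n -> 'rV[K]_p -> K) (L : K) :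
  (0 < n)%N -> (forall i, smooth L (f i)) -> smooth L (favg f).
Proof.
move=> n0 sf; have df i x : differentiable (f i) x by have [] := sf i.
split=> [x|x y].
  have -> : favg f = n%:R^-1 \*: (\sum_i f i).
    by apply/funext => y; rewrite /favg /= fct_sumE.
  by apply: differentiableZ; apply: differentiable_sum.
rewrite !grad_favg// -scalerBr -sumrB.
apply: le_trans (sqn_mean _) _.
rewrite ler_pdivrMl ?ltr0n//.
apply: (@le_trans _ _ (\sum_(i < n) L ^+ 2 * sqn (x - y))).
  by apply: ler_sum => i _; have [_] := sf i; apply.
by rewrite sumr_const card_ord mulr_natl.
Qed.

End Smooth.

(** * Measurability of matrix-valued maps *)

Section MeasurableMatrices.
Context {K : realType} {d : measure_display} {T : measurableType d}.

Definition mxmeas m n (X : T -> 'M[K]_(m, n)) :=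
  forall i j, measurable_fun [set: T] (fun w => X w i j).

Lemma mxmeas_cst m n (A : 'M[K]_(m, n)) : mxmeas (fun=> A).
Proof. by move=> i j; exact: measurable_cst. Qed.

Lemma mxmeasD m n (X Y : T -> 'M[K]_(m, n)) :
  mxmeas X -> mxmeas Y -> mxmeas (fun w => X w + Y w).
Proof.
move=> mX mY i j; under eq_fun do rewrite mxE.
exact: measurable_funD.
Qed.

Lemma mxmeasZ m n (k : K) (X : T -> 'M[K]_(m, n)) :
  mxmeas X -> mxmeas (fun w => k *: X w).
Proof.
move=> mX i j; under eq_fun do rewrite mxE.
exact: measurable_funM.
Qed.

Lemma mxmeasN m n (X : T -> 'M[K]_(m, n)) :
  mxmeas X -> mxmeas (fun w => - X w).
Proof.
by move=> mX; under eq_fun do rewrite -scaleN1r; exact: mxmeasZ.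
Qed.

Lemma mxmeasB m n (X Y : T -> 'M[K]_(m, n)) :
  mxmeas X -> mxmeas Y -> mxmeas (fun w => X w - Y w).
Proof. by move=> mX mY; apply: mxmeasD => //; exact: mxmeasN. Qed.

Lemma mxmeas_mull l m n (A : 'M[K]_(l, m)) (X : T -> 'M[K]_(m, n)) :
  mxmeas X -> mxmeas (fun w => A *m X w).
Proof.
move=> mX i j; under eq_fun do rewrite mxE.
by apply: measurable_sum => k; exact: measurable_funM.
Qed.

Lemma mxmeas_row m n (X : T -> 'M[K]_(m, n)) i :
  mxmeas X -> mxmeas (fun w => row i (X w)).
Proof. by move=> mX k j; under eq_fun do rewrite mxE; exact: mX. Qed.

Lemma measurable_sqn m n (X : T -> 'M[K]_(m, n)) :
  mxmeas X -> measurable_fun [set: T] (fun w => sqn (X w)).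
Proof.
move=> mX; rewrite /sqn; apply: measurable_sum => i; apply: measurable_sum => j.
exact: measurable_funX.
Qed.

Section OpenPreimage.
Context {p : nat} (X : T -> 'rV[K]_p) (mX : mxmeas X).

Let measurable_ball (x : 'rV[K]_p) (e : K) :
  measurable [set w | forall j, `|x 0 j - X w 0 j| < e].
Proof.
rewrite (_ : [set w | _] = \bigcap_(j in [set: 'I_p])
    [set w | `|x 0 j - X w 0 j| < e]); last first.
  by apply/seteqP; split=> [w h j _|w h j]; exact: h.
apply: fin_bigcap_measurable => [|j _]; first exact: finite_finset.
 rewrite -[X in measurable X]setTI.
have mf : measurable_fun [set: T] (fun w => `|x 0 j - X w 0 j|).
  apply: measurableT_comp => //.
  by apply: measurable_funB => //; exact: measurable_cst.
have := mf measurableT `]-oo, e[%classic (measurable_itv _).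
by congr (measurable (_ `&` _)); apply/seteqP; split=> w /=; rewrite in_itv.
Qed.

(* An open set is a countable union of sup-norm balls with rational centers
   and radii 1/(m+1). *)
Lemma measurable_open_preimage (O : set 'rV[K]_p) :
  open O -> measurable (X @^-1` O).
Proof.
move=> oO; pose rad (m : nat) : K := m.+1%:R^-1.
pose ctr (q : 'rV[rat]_p) : 'rV[K]_p := map_mx ratr q.
pose F (i : 'rV[rat]_p * nat) : set T :=
  if `[< ball (ctr i.1) (rad i.2) `<=` O >] then
    [set w | forall j, `|ctr i.1 0 j - X w 0 j| < rad i.2] else set0.
rewrite (_ : X @^-1` O = \bigcup_i F i); last first.
  apply/seteqP; split=> [w /= Ow|w [[q m] _]]; last first.
    rewrite /F; case: asboolP => //= h hw; apply: h; split.
      by rewrite invr_gt0.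
    by move=> i j; rewrite ord1; exact: hw.
  have /nbhs_ballP[e /= e0 he] : nbhs (X w) O by exact: open_nbhs_nbhs.
  have [m me] : exists m, rad m < e / 2.
    have e20 : 0 < e / 2 by rewrite divr_gt0.
    by have [m hm] := ltr_add_invr e20; exists m; rewrite add0r in hm.
  have rm0 : 0 < rad m by rewrite invr_gt0.
  have hq j : exists q : rat, `|ratr q - X w 0 j| < rad m.
    have : X w 0 j - rad m < X w 0 j + rad m by lra.
    move=> /rat_in_itvoo [q]; rewrite in_itv/= => /andP[q1 q2]; exists q.
    by rewrite ltr_norml; lra.
  pose q : 'rV[rat]_p := \row_j xchoose (hq j).
  have hqj j : `|ctr q 0 j - X w 0 j| < rad m.
    by rewrite !mxE; exact: (xchooseP (hq j)).
  exists (q, m) => //; rewrite /F/=; case: asboolP => // h; exfalso; apply: h.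
  move=> y [_ hy]; apply: he; split => // i j; rewrite ord1.
  have := hy 0 j; have := hqj j; rewrite /ball/= distrC => h1 h2.
  apply: le_lt_trans (ler_distD (ctr q 0 j) _ _) _.
  by lra.
apply: countable_bigcupT_measurable; first exact: countableP.
by move=> i; rewrite /F; case: ifP => _; [exact: measurable_ball|exact: measurable0].
Qed.

Lemma measurable_continuous_row (g : 'rV[K]_p -> K) :
  continuous g -> measurable_fun [set: T] (g \o X).
Proof.
move=> /continuousP cg; apply: (measurability _ (RGenOpens.measurableE K)).
move=> _ [_ [a [b ->] <-]]; rewrite setTI comp_preimage.
by apply: measurable_open_preimage; apply: cg; exact: interval_open.
Qed.

End OpenPreimage.

(** Joint measurability of the operator is stated on [p.-tuple K], so the row is repackaged as a
    tuple before composing. *)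
Lemma measurable_comp_tuple (d' : measure_display) (Z : measurableType d')
    (p : nat) (g : Z -> 'rV[K]_p -> K) (z : T -> Z) (X : T -> 'rV[K]_p) :
  measurable_fun [set: Z * p.-tuple K]
    (fun zt => g zt.1 (\row_i tnth zt.2 i)) ->
  measurable_fun [set: T] z -> mxmeas X ->
  measurable_fun [set: T] (fun w => g (z w) (X w)).
Proof.
move=> mg mz mX; pose Xt w := [tuple X w 0 i | i < p].
have mXt : measurable_fun [set: T] Xt.
  apply/measurable_fun_tnthP => i.
  rewrite (_ : _ \o _ = (fun w => X w 0 i)); first exact: mX.
  by apply/funext => w; rewrite /= tnth_mktuple.
rewrite (_ : (fun w => _) = (fun zt => g zt.1 (\row_i tnth zt.2 i)) \o
   (fun w => (z w, Xt w))); last first.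
  apply/funext => w /=; congr (g _ _); apply/rowP => i.
  by rewrite mxE tnth_mktuple.
by apply: measurableT_comp => //; exact: measurable_fun_pair.
Qed.

End MeasurableMatrices.

(** * Fresh seeds *)

Section FreshSeeds.
Context {K : realType} {d d' : measure_display} {Omega : measurableType d}
  {P : probability Omega K} {Z : measurableType d'} {nu : probability Z K}
  {n : nat} {zeta : nat -> 'I_n -> Omega -> Z}.
Hypothesis hzeta : fresh_seeds P nu zeta.

(** The generators of [history zeta t], isolated so that the past is itself a measurable type and
    adaptedness becomes measurability with respect to it. *)
Definition seed_events (t : nat) : set (set Omega) :=
  [set B | exists t' i A,
    [/\ (t' < t)%N, measurable A & B = zeta t' i @^-1` A]].

Notation past t := (g_sigma_algebraType (seed_events t)).

Lemma measurable_seed t t' i : (t' < t)%N ->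
  @measurable_fun _ _ (past t) Z setT (zeta t' i).
Proof.
move=> t't _ A mA; rewrite setTI; apply: sub_sigma_algebra.
by exists t', i, A.
Qed.

Lemma past_measurable t (B : set Omega) :
  @measurable _ (past t) B -> measurable B.
Proof.
apply: smallest_sub; first exact: sigma_algebra_measurable.
move=> _ [t' [i [A [_ mA ->]]]]; rewrite -[X in measurable X]setTI.
exact: (seed_measurable hzeta).
Qed.

Lemma past_le t1 t2 (B : set Omega) : (t1 <= t2)%N ->
  @measurable _ (past t1) B -> @measurable _ (past t2) B.
Proof.
move=> t12; apply: smallest_sub; first exact: smallest_sigma_algebra.
move=> _ [t' [i [A [lt mA ->]]]]; apply: sub_sigma_algebra.
by exists t', i, A; split => //; exact: leq_trans t12.
Qed.

Lemma mxmeas_past t m k (X : Omega -> 'M[K]_(m, k)) :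
  @mxmeas _ _ (past t) _ _ X -> mxmeas X.
Proof. by move=> mX i j _ A mA; apply: (@past_measurable t); exact: mX. Qed.

Lemma mxmeas_past_le t1 t2 m k (X : Omega -> 'M[K]_(m, k)) : (t1 <= t2)%N ->
  @mxmeas _ _ (past t1) _ _ X -> @mxmeas _ _ (past t2) _ _ X.
Proof.
by move=> t12 mX i j _ A mA; apply: (past_le t12); exact: mX.
Qed.

(* The joint law of a fresh seed and of a variable of the past is a product, so
   a bound for every frozen value of the variable can be integrated. *)
Lemma fresh_integral_le t i p (X : Omega -> 'rV[K]_p)
    (g : Z -> 'rV[K]_p -> K) (bd : 'rV[K]_p -> K) :
  @mxmeas _ _ (past t) _ _ X ->
  measurable_fun [set: Z * p.-tuple K]
    (fun zt => g zt.1 (\row_i tnth zt.2 i)) ->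
  measurable_fun [set: p.-tuple K] (fun s => bd (\row_i tnth s i)) ->
  (forall z x, 0 <= g z x) ->
  (forall x, \int[nu]_z (g z x)%:E <= (bd x)%:E)%E ->
  (\int[P]_w (g (zeta t i w) (X w))%:E <= \int[P]_w (bd (X w))%:E)%E.
Proof.
move=> mX mg mbd g0 gbd.
have bd0 x : 0 <= bd x.
  by rewrite -lee_fin (le_trans _ (gbd x))// integral_ge0// => z _; rewrite lee_fin.
pose Xt w := [tuple X w 0 j | j < p].
have XtE w : \row_j tnth (Xt w) j = X w.
  by apply/rowP => j; rewrite mxE tnth_mktuple.
have mXtp : @measurable_fun _ _ (past t) _ setT Xt.
  apply/measurable_fun_tnthP => j.
  rewrite (_ : _ \o _ = (fun w => X w 0 j)); first exact: mX.
  by apply/funext => w; rewrite /= tnth_mktuple.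
have mXt : measurable_fun setT Xt.
  by move=> _ A mA; apply: (@past_measurable t); exact: mXtp.
pose rvX : {RV P >-> p.-tuple K} :=
  HB.pack Xt (isMeasurableFun.Build _ _ _ _ _ mXt).
have mphi : measurable_fun setT (fun w => (zeta t i w, Xt w)).
  apply: measurable_fun_pair => //; exact: (seed_measurable hzeta).
pose rv : {RV P >-> (Z * p.-tuple K)%type} :=
  HB.pack (fun w => (zeta t i w, Xt w)) (isMeasurableFun.Build _ _ _ _ _ mphi).
pose G zt := (g zt.1 (\row_j tnth zt.2 j))%:E.
have mG : measurable_fun [set: Z * p.-tuple K] G by exact/measurable_EFinP.
have G0 zt : (0 <= G zt)%E by rewrite lee_fin.
(* Independence gives the product formula on rectangles only; uniqueness of the product measure
   extends it to all measurable sets. *)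
have lawE A : measurable A -> distribution P rv A =
    (nu \x distribution P rvX)%E A.
  move=> mA; symmetry; apply: product_measure_unique => // B C mB mC.
  rewrite /distribution /pushforward/= -(seed_law hzeta t i mB).
  rewrite -(seed_indep hzeta i mB)//.
  by rewrite -[_ @^-1` C]setTI; exact: mXtp.
rewrite (_ : \int[P]_w _ = \int[P]_w (G \o rv) w)%E; last first.
  by apply: eq_integral => w _; rewrite /G/= XtE.
rewrite -ge0_integral_distribution//.
rewrite (eq_measure_integral (nu \x distribution P rvX)%E); last first.
  by move=> A mA _; exact: lawE.
rewrite fubini_tonelli1// /fubini_F fubini_tonelli//.
rewrite (_ : \int[P]_w _ =
   \int[P]_w ((fun s => (bd (\row_j tnth s j))%:E) \o rvX) w)%E; last first.
  by apply: eq_integral => w _; rewrite /= XtE.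
rewrite -(ge0_integral_distribution rvX); last 2 first.
- exact/measurable_EFinP.
- by move=> s; rewrite lee_fin.
apply: ge0_le_integral => //.
- by move=> s _; apply: integral_ge0.
- exact: measurable_fun_fubini_tonelli_G.
- exact/measurable_EFinP.
- by move=> s _; apply: le_trans (gbd (\row_j tnth s j)); rewrite lexx.
Qed.

End FreshSeeds.

Arguments seed_events {d d' Omega Z n} zeta t.

(** * The Lyapunov inequality for scalars *)

Lemma ler_sqr_ge0 (K : realType) (x y : K) : 0 <= x -> x <= y -> x ^+ 2 <= y ^+ 2.
Proof. by move=> x0 xy; rewrite lerXn2r ?nnegrE ?(le_trans x0). Qed.

(** Separating the drift of an innovation by Young's inequality with ratio [u / 2] costs half of the
    compression rate [u]. For [Y], a second use with ratio [u / 4] absorbs the gradient increment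
    and costs another quarter. *)
Lemma young_loss (K : realType) (u : K) : 0 <= u ->
  (1 + u / 2) * (1 - u) <= 1 - u / 2 /\
  (1 + u / 2) * ((1 - u) * (1 + u / 4)) <= 1 - u / 4.
Proof.
move=> u0; have u2 : 0 <= u ^+ 2 by exact: sqr_ge0.
by have u3 : 0 <= u ^+ 3 := exprn_ge0 3 u0; split; lra.
Qed.

Ltac nonneg := repeat first [done | exact: ltW | exact: sqr_ge0
  | apply: exprn_ge0 | rewrite invr_ge0 | apply: mulr_ge0 | apply: addr_ge0].

Section Lyapunov.
Context {K : realType}.
Variables (n uR uC L l M lb thR thC gx gy N S D F q Cs alr blr delta mu : K).
Let a := thR * gx.
Let b := thC * gy.
Let ax := alr * delta.
Let ay := blr * delta.

(* Here [N = ||I - R||_R], [S = ||I - C||_C], [D] and [F] are the constants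
   delta_{R,2} and delta_{C,2}, [q] bounds [||R_gamma||_R], [alr = alpha_x r]
   and [blr = alpha_y r]; [a, b, ax, ay] are the contraction rates of the
   consensus, tracking and compression errors. *)
Record stepsize_conditions : Prop := StepsizeConditions {
  sc_n : 0 < n; sc_uR : 0 < uR; sc_uC : 0 < uC; sc_L : 0 < L; sc_l : 0 < l;
  sc_M : 0 < M; sc_thR : 0 < thR; sc_thC : 0 < thC; sc_gx : 0 < gx;
  sc_gy : 0 < gy; sc_N : 0 < N; sc_S : 0 < S; sc_D : 1 <= D; sc_F : 1 <= F;
  sc_Cs : 0 <= Cs; sc_alr : 0 < alr; sc_blr : 0 < blr; sc_delta : 0 < delta;
  sc_alr1 : alr <= 1; sc_blr1 : blr <= 1; sc_delta1 : delta <= 1;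
  sc_gx1 : gx <= 1; sc_gy1 : gy <= 1; sc_thR1 : thR <= 1; sc_thC1 : thC <= 1;
  sc_thRN : thR <= N; sc_thCS : thC <= S;
  sc_q0 : 0 <= q; sc_q : q ^+ 2 <= 5 / 3;
  sc_Mn : M * n <= uR * uC;
  sc_lb : M * l <= lb; sc_lbn : lb * n <= l * uR * uC;
  sc_lL : l ^+ 2 * L ^+ 2 <= 1 / 36; sc_lLC : l ^+ 2 * L ^+ 2 * Cs <= 1 / 36;
  sc_gyS : gy * S * F <= 13 / 24;
  sc_k1 : 384 * (l ^+ 2 * L ^+ 2 * uR * uC ^+ 3 * D ^+ 2) <= n ^+ 2 * M * a ^+ 2;
  sc_k2 : 12 * (N ^+ 2 * (2 * F ^+ 2 * (1 + 2 * S ^+ 2 * Cs)) * uR * gx ^+ 2) <=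
    M * uC * b ^+ 2;
  sc_k3 : 64 * (72 * (Cs * D ^+ 2 * N ^+ 4 * gx ^+ 2)) <= thR ^+ 2 * ax ^+ 2;
  sc_k4 : 64 * (72 * (gy ^+ 2 * F ^+ 2 * S ^+ 4 * Cs)) <= thC ^+ 2 * ay ^+ 2 }.

Hypothesis sc : stepsize_conditions.

(* [lyB] and [lyJ] bound the coefficients of the consensus and tracking errors
   in the descent inequality; [lyW / 2] bounds [TA] below. *)
Definition lyJ := uR ^+ 2 * l / (n ^+ 2 * M).
Definition lyB := l * L ^+ 2 * uR * uC / n ^+ 2.
Definition lyW := lyB / (gx ^+ 2 * N ^+ 2).
Definition lyQ := lyJ / (gy ^+ 2 * S ^+ 2).
(** The product of a weight and the contraction rate of its error has to cover what this error feeds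
    into the others: [wc * a = 4 * lyB] and [wg * b = 2 * lyJ]. The factors [ax] and [ay] in [wx]
    and [wy] cancel the [1 / ax] and [1 / ay] that Young's inequality puts on the drift of the
    innovations, which leaves small fixed multiples of [lyW] and [lyQ]. *)
Definition wc := 4 * lyB / a.
Definition wg := 2 * lyJ / b.
Definition wx := lyW * ax / 64.
Definition wy := lyQ * ay / 64.

Let n0 := sc_n sc. Let uR0 := sc_uR sc. Let uC0 := sc_uC sc.
Let L0 := sc_L sc. Let l0 := sc_l sc. Let M0 := sc_M sc.
Let thR0 := sc_thR sc. Let thC0 := sc_thC sc.
Let gx0 := sc_gx sc. Let gy0 := sc_gy sc. Let N0 := sc_N sc.
Let S0 := sc_S sc. Let Cs0 := sc_Cs sc.
Let D0 : 0 < D. Proof. exact: lt_le_trans (sc_D sc). Qed.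
Let F0 : 0 < F. Proof. exact: lt_le_trans (sc_F sc). Qed.
Let D2 : 1 <= D ^+ 2. Proof. by rewrite exprn_ege1// (sc_D sc). Qed.
Let F2 : 1 <= F ^+ 2. Proof. by rewrite exprn_ege1// (sc_F sc). Qed.

Let a0 : 0 < a. Proof. exact: mulr_gt0. Qed.
Let b0 : 0 < b. Proof. exact: mulr_gt0. Qed.
Let ax0 : 0 < ax. Proof. by rewrite mulr_gt0 ?(sc_alr sc) ?(sc_delta sc). Qed.
Let ay0 : 0 < ay. Proof. by rewrite mulr_gt0 ?(sc_blr sc) ?(sc_delta sc). Qed.
Let a1 : a <= 1. Proof. by rewrite mulr_ile1 ?(sc_thR1 sc) ?(sc_gx1 sc) ?ltW. Qed.
Let b1 : b <= 1. Proof. by rewrite mulr_ile1 ?(sc_thC1 sc) ?(sc_gy1 sc) ?ltW. Qed.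
Let ax1 : ax <= 1.
Proof. by rewrite mulr_ile1 ?(sc_alr1 sc) ?(sc_delta1 sc) ?ltW ?(sc_alr sc) ?(sc_delta sc). Qed.
Let ay1 : ay <= 1.
Proof. by rewrite mulr_ile1 ?(sc_blr1 sc) ?(sc_delta1 sc) ?ltW ?(sc_blr sc) ?(sc_delta sc). Qed.
Let lb0 : 0 < lb. Proof. by apply: lt_le_trans (sc_lb sc); rewrite mulr_gt0. Qed.

Let J0 : 0 < lyJ.
Proof. by rewrite /lyJ divr_gt0 ?mulr_gt0 ?exprn_gt0. Qed.
Let B0 : 0 < lyB.
Proof. by rewrite /lyB divr_gt0 ?mulr_gt0 ?exprn_gt0. Qed.
Let W0 : 0 < lyW.
Proof. by apply: divr_gt0 => //; rewrite mulr_gt0 ?exprn_gt0. Qed.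
Let Q0 : 0 < lyQ.
Proof. by apply: divr_gt0 => //; rewrite mulr_gt0 ?exprn_gt0. Qed.

Lemma wc_gt0 : 0 < wc. Proof. by apply: divr_gt0 => //; exact: mulr_gt0. Qed.
Lemma wg_gt0 : 0 < wg. Proof. by apply: divr_gt0 => //; exact: mulr_gt0. Qed.
Lemma wx_gt0 : 0 < wx. Proof. by apply: divr_gt0 => //; exact: mulr_gt0. Qed.
Lemma wy_gt0 : 0 < wy. Proof. by apply: divr_gt0 => //; exact: mulr_gt0. Qed.

Let a_le : a ^+ 2 <= gx ^+ 2 * N ^+ 2.
Proof.
rewrite /a exprMn mulrC ler_wpM2l ?sqr_ge0//.
by apply: ler_sqr_ge0; [exact: ltW|exact: (sc_thRN sc)].
Qed.

Let b_le : b ^+ 2 <= gy ^+ 2 * S ^+ 2.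
Proof.
rewrite /b exprMn mulrC ler_wpM2l ?sqr_ge0//.
by apply: ler_sqr_ge0; [exact: ltW|exact: (sc_thCS sc)].
Qed.

Let Mn2 : M ^+ 2 * n ^+ 2 <= uR ^+ 2 * uC ^+ 2.
Proof.
rewrite -!exprMn; apply: ler_sqr_ge0; last exact: (sc_Mn sc).
by rewrite mulr_ge0 ?ltW.
Qed.

(** A rescaling of [sc_k2]. It lets [lyW] pay for the moves of [X] charged to the tracking error,
    where the weight [wg] and the Young factor each contribute a [1 / b]. *)
Lemma JL_le : 12 * (lyJ * (2 * F ^+ 2 * (1 + 2 * S ^+ 2 * Cs)) * L ^+ 2) <=
  lyW * b ^+ 2.
Proof.
rewrite -subr_ge0.
have -> : lyW * b ^+ 2 -
   12 * (lyJ * (2 * F ^+ 2 * (1 + 2 * S ^+ 2 * Cs)) * L ^+ 2) =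
   uR * l * L ^+ 2 / (n ^+ 2 * M * gx ^+ 2 * N ^+ 2) * (M * uC * b ^+ 2 -
    12 * (N ^+ 2 * (2 * F ^+ 2 * (1 + 2 * S ^+ 2 * Cs)) * uR * gx ^+ 2)).
  by rewrite /lyW /lyJ /lyB; field; rewrite !gt_eqF.
apply: mulr_ge0; last by rewrite subr_ge0 (sc_k2 sc).
by rewrite divr_ge0 ?mulr_ge0 ?exprn_ge0 ?ltW.
Qed.

Lemma QL_le : 24 * (lyQ * L ^+ 2) <= lyW.
Proof.
have e1 : 2 <= 2 * F ^+ 2 * (1 + 2 * S ^+ 2 * Cs).
  have : 0 <= S ^+ 2 * Cs by rewrite mulr_ge0 ?sqr_ge0.
  by move: F2; nra.
have h : 24 * (lyJ * L ^+ 2) <= lyW * (gy ^+ 2 * S ^+ 2).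
  apply: (@le_trans _ _ (lyW * b ^+ 2)); last by rewrite ler_pM2l.
  apply: le_trans JL_le.
  have : 0 < lyJ * L ^+ 2 by rewrite mulr_gt0 ?exprn_gt0.
  by move: e1; nra.
have gS : 0 < gy ^+ 2 * S ^+ 2 by rewrite mulr_gt0 ?exprn_gt0.
rewrite -(ler_pM2r gS) (le_trans _ h)// le_eqVlt; apply/orP; left; apply/eqP.
by rewrite /lyQ; field; rewrite !gt_eqF.
Qed.

(** This bound and [Bl_lM] are rescalings of [sc_k1], here through [a ^+ 2 <= gx ^+ 2 * N ^+ 2].
    Since [l * M <= lb], they measure the cost of [||Y||^2] along [uC] against the retained gradient
    term; cancelling [uC ^+ 2] gives the comparisons with [lyJ]. *)
Lemma Wl_lM : 384 * (D ^+ 2 * lyW * l ^+ 2 * uC ^+ 2) <= l * M.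
Proof.
rewrite -subr_ge0.
have -> : l * M - 384 * (D ^+ 2 * lyW * l ^+ 2 * uC ^+ 2) =
  l / (n ^+ 2 * gx ^+ 2 * N ^+ 2) * (n ^+ 2 * M * (gx ^+ 2 * N ^+ 2) -
   384 * (l ^+ 2 * L ^+ 2 * uR * uC ^+ 3 * D ^+ 2)).
  by rewrite /lyW /lyB; field; rewrite !gt_eqF.
apply: mulr_ge0; first by rewrite divr_ge0 ?mulr_ge0 ?exprn_ge0 ?ltW.
rewrite subr_ge0; apply: le_trans (sc_k1 sc) _.
by rewrite ler_wpM2l// mulr_ge0 ?exprn_ge0 ?ltW.
Qed.

Lemma Bl_lM : 384 * (D ^+ 2 * lyB * l ^+ 2 / a ^+ 2 * uC ^+ 2) <= l * M.
Proof.
rewrite -subr_ge0.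
have -> : l * M - 384 * (D ^+ 2 * lyB * l ^+ 2 / a ^+ 2 * uC ^+ 2) =
  l / (n ^+ 2 * a ^+ 2) * (n ^+ 2 * M * a ^+ 2 -
   384 * (l ^+ 2 * L ^+ 2 * uR * uC ^+ 3 * D ^+ 2)).
  by rewrite /lyB; field; rewrite !gt_eqF.
apply: mulr_ge0; first by rewrite divr_ge0 ?mulr_ge0 ?exprn_ge0 ?ltW.
by rewrite subr_ge0 (sc_k1 sc).
Qed.

Let lM_J : l * M <= lyJ * uC ^+ 2.
Proof.
rewrite -subr_ge0.
have -> : lyJ * uC ^+ 2 - l * M = l / (n ^+ 2 * M) *
   (uR ^+ 2 * uC ^+ 2 - M ^+ 2 * n ^+ 2).
  by rewrite /lyJ; field; rewrite !gt_eqF.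
by apply: mulr_ge0; [rewrite divr_ge0 ?mulr_ge0 ?exprn_ge0 ?ltW|rewrite subr_ge0].
Qed.

Lemma Wl_J : 384 * (D ^+ 2 * lyW * l ^+ 2) <= lyJ.
Proof.
have u2 : 0 < uC ^+ 2 by rewrite exprn_gt0.
by rewrite -(ler_pM2r u2); apply: le_trans lM_J; have := Wl_lM; lra.
Qed.

Lemma Bl_J : 384 * (D ^+ 2 * lyB * l ^+ 2 / a ^+ 2) <= lyJ.
Proof.
have u2 : 0 < uC ^+ 2 by rewrite exprn_gt0.
by rewrite -(ler_pM2r u2); apply: le_trans lM_J; have := Bl_lM; lra.
Qed.

(* [kE], [mE] are the coefficients of the two quantization errors
   [||D - Q||^2], [kR], [mR] those of [||D - Q / r||^2], and [TA] is the total
   coefficient of [||X^(k+1) - X^k||^2]. *)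
Definition kE := wg * (2 * gy ^+ 2 * F ^+ 2 * S ^+ 2 / b) +
  wx * (18 / ax) * l ^+ 2 * gy ^+ 2 * S ^+ 2 * F ^+ 2 +
  wy * (9 / ay) * gy ^+ 2 * S ^+ 2 * F ^+ 2.
Definition kR := wy * (1 + ay / 2) * blr.
Definition cA := wg * (2 * F ^+ 2 * L ^+ 2 / b) +
  wx * (6 / ax) * (1 + 3 * l ^+ 2 * L ^+ 2 * (1 + gy * S * F) ^+ 2) +
  wy * (9 / ay) * gy ^+ 2 * S ^+ 2 * F ^+ 2 * L ^+ 2.
Definition cg1 := uR ^+ 2 * l ^+ 2 / (n ^+ 2 * lb) + wg * (1 - b) +
  wx * (18 / ax) * l ^+ 2 * gy ^+ 2 * S ^+ 2 +
  wy * (9 / ay) * gy ^+ 2 * S ^+ 2.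
Definition TA := cA + kE * Cs * 2 * L ^+ 2 +
  wy * (1 + ay / 2) * (1 - ay) * (5 / ay) * L ^+ 2.
(** [cy] and [KY] multiply [||Y - Hy||^2] and [l^2 ||Y||^2] once the error of [Q_y] has been
    averaged and the move of [X] eliminated. *)
Definition cy := kE * Cs * 2 + wy * (1 + ay / 2) * (1 - ay) * (1 + ay / 4).
Definition KY := wc * (2 * D ^+ 2 / a) + 3 * q ^+ 2 * D ^+ 2 * TA.
Definition mE := wc * (2 * gx ^+ 2 * D ^+ 2 * N ^+ 2 / a) +
  3 * gx ^+ 2 * N ^+ 2 * D ^+ 2 * TA.
Definition mR := wx * (1 + ax / 2) * alr.

Let z1 := gy ^+ 2 * S ^+ 2 * F ^+ 2.
Let z1_ge0 : 0 <= z1. Proof. rewrite /z1; nonneg. Qed.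
(** [z1] is the square of a number at most 13/24, and 169/576 < 3/10. *)
Let z1_le : z1 <= 3 / 10.
Proof.
rewrite /z1 -!exprMn; have := sc_gyS sc.
have : 0 <= gy * S * F by nonneg.
by set t := gy * S * F; move=> t0 t1; nra.
Qed.

Let gS_le : gy ^+ 2 * S ^+ 2 <= 3 / 10.
Proof.
by apply: le_trans z1_le; rewrite /z1 ler_peMr//; nonneg.
Qed.

Let z2_le : 64 * (72 * (z1 * Cs)) <= ay ^+ 2.
Proof.
have t2 : 0 < thC ^+ 2 by rewrite exprn_gt0.
rewrite -(ler_pM2l t2); apply: le_trans (sc_k4 sc).
have st : thC ^+ 2 <= S ^+ 2.
  by apply: ler_sqr_ge0; [exact: ltW|exact: (sc_thCS sc)].
have p0 : 0 <= z1 * Cs by exact: mulr_ge0.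
have -> : 64 * (72 * (gy ^+ 2 * F ^+ 2 * S ^+ 4 * Cs)) =
    S ^+ 2 * (64 * (72 * (z1 * Cs))).
  by rewrite /z1; ring.
by rewrite ler_wpM2r//; nonneg.
Qed.

Let wxax : wx * (18 / ax) = 18 / 64 * lyW.
Proof. by rewrite /wx; field; rewrite gt_eqF. Qed.
Let wxax6 : wx * (6 / ax) = 6 / 64 * lyW.
Proof. by rewrite /wx; field; rewrite gt_eqF. Qed.
Let wyay : wy * (9 / ay) = 9 / 64 * lyQ.
Proof. by rewrite /wy; field; rewrite gt_eqF. Qed.
Let wyay5 : wy * (5 / ay) = 5 / 64 * lyQ.
Proof. by rewrite /wy; field; rewrite gt_eqF. Qed.

Lemma kE_ge0 : 0 <= kE.
Proof.
have hx : 0 <= wx * (18 / ax) by rewrite wxax; nonneg.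
have hy : 0 <= wy * (9 / ay) by rewrite wyay; nonneg.
have hg := wg_gt0.
by rewrite /kE; nonneg.
Qed.

Lemma kR_ge0 : 0 <= kR.
Proof.
have := wy_gt0; have := sc_blr sc => h1 h2.
by rewrite /kR; nonneg.
Qed.

Lemma cA_ge0 : 0 <= cA.
Proof.
have hx : 0 <= wx * (6 / ax) by rewrite wxax6; nonneg.
have hy : 0 <= wy * (9 / ay) by rewrite wyay; nonneg.
have hg := wg_gt0.
by rewrite /cA; nonneg.
Qed.

Lemma TA_ge0 : 0 <= TA.
Proof.
have := cA_ge0; have := kE_ge0; have := wy_gt0 => h1 h2 h3.
have ay' : 0 <= 1 - ay by rewrite subr_ge0.
by rewrite /TA; nonneg.
Qed.

(** The budget: [t1], [t2] and [t4] take 1/6 + 12/100 + 1/100 of [lyW], while [t3], [t5] and [t6]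
    take 2 + 5/100 times [X], with [24 * X <= lyW]. The total is below 0.39 [lyW]. *)
Lemma TA_le : TA <= lyW / 2.
Proof.
pose X := lyQ * L ^+ 2.
have X0 : 0 <= X by nonneg.
have hX : 24 * X <= lyW := QL_le.
have t1 : wg * (2 * F ^+ 2 * L ^+ 2 / b) +
    wg * (2 * gy ^+ 2 * F ^+ 2 * S ^+ 2 / b) * Cs * 2 * L ^+ 2 <= lyW / 6.
  have b2 : 0 < b ^+ 2 by rewrite exprn_gt0.
  rewrite -(ler_pM2r b2).
  have -> : (wg * (2 * F ^+ 2 * L ^+ 2 / b) +
    wg * (2 * gy ^+ 2 * F ^+ 2 * S ^+ 2 / b) * Cs * 2 * L ^+ 2) * b ^+ 2 =
     2 * (lyJ * (2 * F ^+ 2 * (1 + 2 * gy ^+ 2 * S ^+ 2 * Cs)) * L ^+ 2).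
    by rewrite /wg; field; rewrite gt_eqF.
  apply: (@le_trans _ _
     (2 * (lyJ * (2 * F ^+ 2 * (1 + 2 * S ^+ 2 * Cs)) * L ^+ 2))).
    rewrite ler_pM2l// ler_wpM2r ?sqr_ge0// ler_pM2l//.
    rewrite ler_pM2l ?mulr_gt0 ?exprn_gt0// lerD2l ler_wpM2r//.
    rewrite ler_wpM2r ?sqr_ge0// ger_pMr// expr_le1 ?(sc_gy1 sc)//.
    exact: ltW.
  by move: JL_le; lra.
have t2 : wx * (6 / ax) * (1 + 3 * l ^+ 2 * L ^+ 2 * (1 + gy * S * F) ^+ 2) <=
    12 / 100 * lyW.
  rewrite wxax6; have h1 := sc_lL sc; have h2 := sc_gyS sc.
  have p1 : 0 <= l ^+ 2 * L ^+ 2 by nonneg.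
  have p2 : 0 <= gy * S * F by nonneg.
  have h3 : (1 + gy * S * F) ^+ 2 <= 12 / 5 by nra.
  have h4 : l ^+ 2 * L ^+ 2 * (1 + gy * S * F) ^+ 2 <= 1 / 36 * (12 / 5).
    by apply: ler_pM => //; exact: sqr_ge0.
  rewrite (_ : 3 * l ^+ 2 * L ^+ 2 * (1 + gy * S * F) ^+ 2 =
    3 * (l ^+ 2 * L ^+ 2 * (1 + gy * S * F) ^+ 2)); last by ring.
  set u := l ^+ 2 * _ * _ in h4 *; move: W0 h4; nra.
have t3 : wy * (9 / ay) * gy ^+ 2 * S ^+ 2 * F ^+ 2 * L ^+ 2 <= 5 / 100 * X.
  rewrite wyay (_ : _ * L ^+ 2 = 9 / 64 * (X * z1)); last by rewrite /X /z1; ring.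
  by move: z1_le; nra.
have t4 : wx * (18 / ax) * l ^+ 2 * gy ^+ 2 * S ^+ 2 * F ^+ 2 * Cs * 2 * L ^+ 2
    <= 1 / 100 * lyW.
  rewrite wxax (_ : _ * L ^+ 2 =
    36 / 64 * (lyW * (l ^+ 2 * L ^+ 2 * Cs * z1))); last by rewrite /z1; ring.
  have h : l ^+ 2 * L ^+ 2 * Cs * z1 <= 1 / 36 * (3 / 10).
    apply: ler_pM => //; last exact: (sc_lLC sc).
    nonneg.
  by set u := l ^+ 2 * _ * _ * _ in h *; move: W0 h; nra.
have t5 : wy * (9 / ay) * gy ^+ 2 * S ^+ 2 * F ^+ 2 * Cs * 2 * L ^+ 2 <= X.
  rewrite wyay (_ : _ * L ^+ 2 = 18 / 64 * (X * (z1 * Cs))); last first.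
    by rewrite /X /z1; ring.
  have h : z1 * Cs <= 1.
    have : ay ^+ 2 <= 1 by rewrite expr_le1// ltW.
    by have : 0 <= z1 * Cs := mulr_ge0 z1_ge0 Cs0; move: z2_le; lra.
  by have := ler_wpM2l X0 h; lra.
have t6 : wy * (1 + ay / 2) * (1 - ay) * (5 / ay) * L ^+ 2 <= X.
  rewrite (_ : _ * L ^+ 2 = wy * (5 / ay) * L ^+ 2 * ((1 + ay / 2) * (1 - ay)));
    last by ring.
  rewrite wyay5 (_ : _ * L ^+ 2 = 5 / 64 * X); last by rewrite /X; ring.
  have h : (1 + ay / 2) * (1 - ay) <= 1 by move: ay0 ay1; nra.
  by have := ler_wpM2l X0 h; lra.
rewrite /TA /cA /kE; move: t1 t2 t3 t4 t5 t6 hX W0; lra.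
Qed.

Let TA0 := TA_ge0.
Let TAle := TA_le.

(** [young_loss] leaves the rate [ax / 2] to the innovation of [X]. The compression error of [Q_x]
    may consume half of it, and the remaining [ax / 4] is the rate that enters [rho]. *)
Lemma mE_le : mE * Cs <= wx * (ax / 4).
Proof.
have k3 := sc_k3 sc.
have BW : lyB = lyW * (gx ^+ 2 * N ^+ 2).
  by rewrite /lyW; field; rewrite !gt_eqF.
have p1 : wc * (2 * gx ^+ 2 * D ^+ 2 * N ^+ 2 / a) * Cs <=
    8 / 64 / 72 * (lyW * ax ^+ 2).
  have a2 : 0 < a ^+ 2 by rewrite exprn_gt0.
  rewrite -(ler_pM2r a2).
  have -> : wc * (2 * gx ^+ 2 * D ^+ 2 * N ^+ 2 / a) * Cs * a ^+ 2 =
     8 / 64 / 72 * lyW * gx ^+ 2 * (64 * (72 * (Cs * D ^+ 2 * N ^+ 4 * gx ^+ 2))).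
    by rewrite /wc BW; field; rewrite gt_eqF.
  rewrite [leRHS](_ : _ = 8 / 64 / 72 * lyW * gx ^+ 2 * (thR ^+ 2 * ax ^+ 2));
    last by rewrite /a; ring.
  by rewrite ler_wpM2l//; nonneg.
have p2 : 3 * gx ^+ 2 * N ^+ 2 * D ^+ 2 * TA * Cs <=
    3 / 2 / 64 / 72 * (lyW * ax ^+ 2).
  have h : 64 * (72 * (Cs * D ^+ 2 * N ^+ 2 * gx ^+ 2)) <= ax ^+ 2.
    have t2 : 0 < thR ^+ 2 by rewrite exprn_gt0.
    rewrite -(ler_pM2l t2); apply: le_trans k3.
    have st : thR ^+ 2 <= N ^+ 2.
      by apply: ler_sqr_ge0; [exact: ltW|exact: (sc_thRN sc)].
    rewrite [leRHS](_ : _ = N ^+ 2 * (64 * (72 * (Cs * D ^+ 2 * N ^+ 2 * gx ^+ 2))));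
      last by ring.
    by rewrite ler_wpM2r//; nonneg.
  rewrite [leLHS](_ : _ = 3 * (Cs * D ^+ 2 * N ^+ 2 * gx ^+ 2) * TA);
    last by ring.
  have h0 : 0 <= Cs * D ^+ 2 * N ^+ 2 * gx ^+ 2 by nonneg.
  have h2 : Cs * D ^+ 2 * N ^+ 2 * gx ^+ 2 * TA <= ax ^+ 2 / 64 / 72 * (lyW / 2).
    by apply: ler_pM => //; have := h; lra.
  by move: h2; lra.
rewrite /mE mulrDl; apply: le_trans (lerD p1 p2) _.
have : 0 < lyW * ax ^+ 2 by rewrite mulr_gt0 ?exprn_gt0.
by rewrite /wx; lra.
Qed.

(** [young_loss] leaves the rate [ay / 4], of which the compression error of [Q_y] may consume
    [3 * ay / 16]; hence the 16 in the rate. *)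
Lemma cy_le : cy <= wy * (1 - ay / 16).
Proof.
have Qay : 0 < lyQ * ay ^+ 2 by rewrite mulr_gt0 ?exprn_gt0.
have p1 : wg * (2 * gy ^+ 2 * F ^+ 2 * S ^+ 2 / b) * Cs * 2 <=
    8 / 64 / 72 * (lyQ * ay ^+ 2).
  have b2 : 0 < b ^+ 2 by rewrite exprn_gt0.
  rewrite -(ler_pM2r b2).
  have -> : wg * (2 * gy ^+ 2 * F ^+ 2 * S ^+ 2 / b) * Cs * 2 * b ^+ 2 =
     8 / 64 / 72 * lyQ * gy ^+ 2 * (64 * (72 * (gy ^+ 2 * F ^+ 2 * S ^+ 4 * Cs))).
    by rewrite /wg /lyQ; field; rewrite !gt_eqF.
  rewrite [leRHS](_ : _ = 8 / 64 / 72 * lyQ * gy ^+ 2 * (thC ^+ 2 * ay ^+ 2));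
    last by rewrite /b; ring.
  by rewrite ler_wpM2l ?(sc_k4 sc)//; nonneg.
have zay : z1 * Cs <= ay ^+ 2 / 64 / 72 by have := z2_le; lra.
have p2 : wx * (18 / ax) * l ^+ 2 * gy ^+ 2 * S ^+ 2 * F ^+ 2 * Cs * 2 <=
    1 / 64 / 72 * (lyQ * ay ^+ 2) * (1 / 100).
  rewrite wxax [leLHS](_ : _ = 36 / 64 * (lyW * l ^+ 2 * (z1 * Cs)));
    last by rewrite /z1; ring.
  have Wl : lyW * l ^+ 2 <= lyQ * (1 / 100).
    have JQ : lyJ = lyQ * (gy ^+ 2 * S ^+ 2).
      by rewrite /lyQ; field; rewrite !gt_eqF.
    have h1 : lyW * l ^+ 2 <= D ^+ 2 * lyW * l ^+ 2.
      by rewrite -mulrA ler_peMl//; nonneg.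
    have h2 := Wl_J.
    have h3 : lyJ <= lyQ * (3 / 10) by rewrite JQ ler_pM2l.
    by move: Q0; lra.
  have : lyW * l ^+ 2 * (z1 * Cs) <= lyQ * (1 / 100) * (ay ^+ 2 / 64 / 72).
    by apply: ler_pM => //; nonneg.
  by move: Qay; lra.
have p3 : wy * (9 / ay) * gy ^+ 2 * S ^+ 2 * F ^+ 2 * Cs * 2 <=
    18 / 64 * (lyQ * ay ^+ 2) / 64 / 72.
  rewrite wyay [leLHS](_ : _ = 18 / 64 * (lyQ * (z1 * Cs)));
    last by rewrite /z1; ring.
  have : lyQ * (z1 * Cs) <= lyQ * (ay ^+ 2 / 64 / 72) by rewrite ler_pM2l.
  by lra.
have p4 : wy * (1 + ay / 2) * (1 - ay) * (1 + ay / 4) <= wy * (1 - ay / 4).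
  have -> : wy * (1 + ay / 2) * (1 - ay) * (1 + ay / 4) =
    wy * ((1 + ay / 2) * ((1 - ay) * (1 + ay / 4))) by ring.
  rewrite ler_pM2l ?wy_gt0//.
  by have [] := young_loss (ltW ay0).
have := wy_gt0; rewrite /cy /kE.
have -> : wy * (1 - ay / 16) = wy * (1 - ay / 4) + 3 / 16 / 64 * (lyQ * ay ^+ 2).
  by rewrite /wy; field.
by lra.
Qed.

(** Of the 11 units, 8 pay for the consensus error and 5/2 for the moves, as [q ^+ 2 <= 5 / 3] and
    [TA <= lyW / 2]. The first form serves the tracking part of [||Y||^2], the second its part along
    [uC]. *)
Lemma KYl_bounds : [/\ KY * l ^+ 2 <= 11 / 384 * lyJ &
  KY * l ^+ 2 * uC ^+ 2 <= 11 / 384 * (l * M)].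
Proof.
have E : KY * l ^+ 2 = 8 * (D ^+ 2 * lyB * l ^+ 2 / a ^+ 2) +
   3 * q ^+ 2 * (D ^+ 2 * TA * l ^+ 2).
  by rewrite /KY /wc; field; rewrite gt_eqF.
have h : 3 * q ^+ 2 * (D ^+ 2 * TA * l ^+ 2) <= 5 / 2 * (D ^+ 2 * lyW * l ^+ 2).
  have h1 : D ^+ 2 * TA * l ^+ 2 <= D ^+ 2 * (lyW / 2) * l ^+ 2.
    by rewrite ler_wpM2r ?sqr_ge0// ler_wpM2l ?sqr_ge0.
  have h2 : q ^+ 2 * (D ^+ 2 * TA * l ^+ 2) <= 5 / 3 * (D ^+ 2 * (lyW / 2) * l ^+ 2).
    by apply: ler_pM; [nonneg|nonneg|exact: (sc_q sc)|].
  by lra.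
have := Bl_J; have := Wl_J; have := Bl_lM; have := Wl_lM => g1 g2 g3 g4.
split; first by rewrite E; move: J0; lra.
have u2 : 0 <= uC ^+ 2 by rewrite sqr_ge0.
have lM : 0 < l * M by rewrite mulr_gt0.
by have {h} := ler_wpM2r u2 h; rewrite E mulrDl; lra.
Qed.

Lemma KY_ge0 : 0 <= KY.
Proof.
have h := wc_gt0.
by rewrite /KY; nonneg.
Qed.

(** Contraction of the tracking error gains [2 * lyJ]. Descent of the objective takes at most one
    [lyJ], the other uses 77/384 of it, and the rate [b / 8] needs [lyJ / 4]. *)
Lemma cg_le : cg1 + 2 * (KY * l ^+ 2) <= wg * (1 - b / 8).
Proof.
have [k _] := KYl_bounds.
have p1 : uR ^+ 2 * l ^+ 2 / (n ^+ 2 * lb) <= lyJ.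
  rewrite ler_pdivrMr ?mulr_gt0 ?exprn_gt0//.
  have -> : lyJ * (n ^+ 2 * lb) = uR ^+ 2 * l * (lb / M).
    by rewrite /lyJ; field; rewrite !gt_eqF.
  rewrite [leLHS](_ : _ = uR ^+ 2 * l * l); last by ring.
  rewrite ler_wpM2l//; first nonneg.
  by rewrite ler_pdivlMr// mulrC (sc_lb sc).
have p2 : wx * (18 / ax) * l ^+ 2 * gy ^+ 2 * S ^+ 2 <= 1 / 384 * lyJ.
  rewrite wxax [leLHS](_ : _ = 18 / 64 * (lyW * l ^+ 2 * (gy ^+ 2 * S ^+ 2)));
    last by ring.
  have h1 : lyW * l ^+ 2 <= D ^+ 2 * lyW * l ^+ 2.
    by rewrite -mulrA ler_peMl//; nonneg.
  have h2 : lyW * l ^+ 2 * (gy ^+ 2 * S ^+ 2) <= lyJ / 384 * (3 / 10).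
    apply: ler_pM => //; [nonneg|nonneg|].
    by have := Wl_J; lra.
  by move: J0; lra.
have p3 : wy * (9 / ay) * gy ^+ 2 * S ^+ 2 = 9 / 64 * lyJ.
  by rewrite wyay /lyQ; field; rewrite !gt_eqF.
have p4 : wg * (1 - b) = wg - 2 * lyJ by rewrite /wg; field; rewrite gt_eqF.
have p5 : wg * (1 - b / 8) = wg - lyJ / 4 by rewrite /wg; field; rewrite gt_eqF.
by rewrite /cg1 p3 p4 p5; move: J0; lra.
Qed.

(** Contraction of the consensus error gains [4 * lyB]. The objective takes 1, the moves 3/2 and
    [||Y||^2] 1/4 of [lyB]; the rate [a / 16] needs another 1/4. *)
Lemma cc_le : lb * L ^+ 2 / n + wc * (1 - a) + 3 * gx ^+ 2 * N ^+ 2 * TA +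
  KY * l ^+ 2 * (4 * uC ^+ 2 * (L ^+ 2 / n)) <= wc * (1 - a / 16).
Proof.
have Ln : 0 < L ^+ 2 / n by rewrite divr_gt0 ?exprn_gt0.
have lbB : lb * (L ^+ 2 / n) <= lyB.
  have -> : lyB = (l * uR * uC) / n * (L ^+ 2 / n).
    by rewrite /lyB; field; rewrite gt_eqF.
  by rewrite ler_pM2r// ler_pdivlMr// (sc_lbn sc).
have p3 : 3 * gx ^+ 2 * N ^+ 2 * TA <= 3 / 2 * lyB.
  have BW : lyB = lyW * (gx ^+ 2 * N ^+ 2).
    by rewrite /lyW; field; rewrite !gt_eqF.
  have gN : 0 <= gx ^+ 2 * N ^+ 2 by nonneg.
  have := ler_wpM2l gN TAle; rewrite BW; lra.
have p4 : KY * l ^+ 2 * (4 * uC ^+ 2 * (L ^+ 2 / n)) <= 1 / 4 * lyB.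
  have [_ k] := KYl_bounds.
  have h : KY * l ^+ 2 * uC ^+ 2 <= 1 / 16 * lb.
    have : 0 < l * M by rewrite mulr_gt0.
    by have := sc_lb sc; lra.
  by have := ler_wpM2r (ltW Ln) h; lra.
have p1 : wc * (1 - a) = wc - 4 * lyB by rewrite /wc; field; rewrite gt_eqF.
have p2 : wc * (1 - a / 16) = wc - lyB / 4 by rewrite /wc; field; rewrite gt_eqF.
rewrite p1 p2 -mulrA; move: B0; lra.
Qed.

Lemma cG_le : 4 * (KY * l ^+ 2 * uC ^+ 2) <= lb / 4.
Proof.
have [_ k] := KYl_bounds.
have : 0 < l * M by rewrite mulr_gt0.
by have := sc_lb sc; lra.
Qed.

Lemma cy_ge0 : 0 <= cy.
Proof.
have ay' : 0 <= 1 - ay by rewrite subr_ge0.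
have h1 := kE_ge0; have h2 := wy_gt0.
by rewrite /cy; nonneg.
Qed.

(** The bound on the next potential without the two error terms of [Q_y]. Here [om] stands for the
    objective gap minus [lb / 2 * G], [c], [g] and [x] for the consensus, tracking and
    [X]-innovation errors, [yt] for the innovation that [Q_y] compresses, [A] for [||X' - X||^2],
    [Yn] for [||Y||^2], and [ex], [rx] for the two errors of [Q_x]. In [preX] the quantities [yt]
    and [A], which depend on [Q_x], are gone. *)
Definition preY (om c g x yt A Yn ex rx : K) :=
  om + (lb * L ^+ 2 / n + wc * (1 - a)) * c + cg1 * g +
  wc * (2 * D ^+ 2 / a) * (l ^+ 2 * Yn) +
  wc * (2 * gx ^+ 2 * D ^+ 2 * N ^+ 2 / a) * ex + cA * A +
  wx * (1 + ax / 2) * ((1 - alr) * x + alr * rx) +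
  wy * (1 + ay / 2) * (1 - blr) * yt.

Definition preX (om c g x y Yn : K) :=
  om + (lb * L ^+ 2 / n + wc * (1 - a) + 3 * gx ^+ 2 * N ^+ 2 * TA) * c +
  cg1 * g + KY * (l ^+ 2 * Yn) + wx * (1 + ax / 2) * (1 - alr) * x + cy * y.

Lemma cg1_ge0 : 0 <= cg1.
Proof.
have b' : 0 <= 1 - b by rewrite subr_ge0.
have hx := wx_gt0; have hy := wy_gt0; have hg := wg_gt0.
by rewrite /cg1; nonneg.
Qed.

Lemma preY_ge0 (om c g x yt A Yn ex rx : K) : 0 <= om -> 0 <= c -> 0 <= g ->
  0 <= x -> 0 <= yt -> 0 <= A -> 0 <= Yn -> 0 <= ex -> 0 <= rx ->
  0 <= preY om c g x yt A Yn ex rx.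
Proof.
move=> om0 c0' g0' x0 yt0 A0 Yn0 ex0 rx0.
have a' : 0 <= 1 - a by rewrite subr_ge0.
have alr' : 0 <= 1 - alr by rewrite subr_ge0 (sc_alr1 sc).
have blr' : 0 <= 1 - blr by rewrite subr_ge0 (sc_blr1 sc).
have alr0 := sc_alr sc.
have h1 := cg1_ge0; have h2 := cA_ge0.
have hc := wc_gt0; have hx := wx_gt0; have hy := wy_gt0.
by rewrite /preY; nonneg.
Qed.

Lemma preX_ge0 (om c g x y Yn : K) : 0 <= om -> 0 <= c -> 0 <= g ->
  0 <= x -> 0 <= y -> 0 <= Yn -> 0 <= preX om c g x y Yn.
Proof.
move=> om0 c0' g0' x0 y0 Yn0.
have a' : 0 <= 1 - a by rewrite subr_ge0.
have alr' : 0 <= 1 - alr by rewrite subr_ge0 (sc_alr1 sc).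
have h1 := cg1_ge0; have h2 := KY_ge0; have h3 := cy_ge0; have h4 := TA_ge0.
have hc := wc_gt0; have hx := wx_gt0.
by rewrite /preX; nonneg.
Qed.

Lemma mE_ge0 : 0 <= mE.
Proof.
by have hc := wc_gt0; have h4 := TA_ge0; rewrite /mE; nonneg.
Qed.

Lemma mR_ge0 : 0 <= mR.
Proof.
by have hx := wx_gt0; have alr0 := sc_alr sc; rewrite /mR; nonneg.
Qed.

Lemma lyapunov_preY (om c g x yt A Yn ex rx ey ry dY o' c' g' x' y' : K) :
  o' <= om + lb * L ^+ 2 / n * c + uR ^+ 2 * l ^+ 2 / (n ^+ 2 * lb) * g ->
  c' <= (1 - a) * c + 2 * D ^+ 2 / a * (l ^+ 2 * Yn) +
    2 * gx ^+ 2 * D ^+ 2 * N ^+ 2 / a * ex ->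
  g' <= (1 - b) * g + 2 * F ^+ 2 * L ^+ 2 / b * A +
    2 * gy ^+ 2 * F ^+ 2 * S ^+ 2 / b * ey ->
  x' <= (1 + ax / 2) * ((1 - alr) * x + alr * rx) +
    3 / ax * (2 * A + 2 * l ^+ 2 * dY) ->
  dY <= 3 * (1 + gy * S * F) ^+ 2 * L ^+ 2 * A + 3 * gy ^+ 2 * S ^+ 2 * g +
    3 * gy ^+ 2 * S ^+ 2 * F ^+ 2 * ey ->
  y' <= (1 + ay / 2) * ((1 - blr) * yt + blr * ry) +
    9 / ay * (gy ^+ 2 * S ^+ 2 * g + gy ^+ 2 * S ^+ 2 * F ^+ 2 * L ^+ 2 * A +
      gy ^+ 2 * S ^+ 2 * F ^+ 2 * ey) ->
  o' + wc * c' + wg * g' + wx * x' + wy * y' <=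
    preY om c g x yt A Yn ex rx + kE * ey + kR * ry.
Proof.
move=> ho hc hg hx hdY hy.
have h6 : 0 <= 6 / ax * l ^+ 2 by nonneg.
have {}hdY := ler_wpM2l h6 hdY.
have {}hx : x' <= (1 + ax / 2) * ((1 - alr) * x + alr * rx) + 6 / ax * A +
    6 / ax * l ^+ 2 * (3 * (1 + gy * S * F) ^+ 2 * L ^+ 2 * A +
    3 * gy ^+ 2 * S ^+ 2 * g + 3 * gy ^+ 2 * S ^+ 2 * F ^+ 2 * ey).
  by apply: le_trans hx _; lra.
have {}hc := ler_wpM2l (ltW wc_gt0) hc.
have {}hg := ler_wpM2l (ltW wg_gt0) hg.
have {}hx := ler_wpM2l (ltW wx_gt0) hx.
have {}hy := ler_wpM2l (ltW wy_gt0) hy.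
rewrite /preY /cg1 /kE /kR /cA.
by move: wc wg wx wy hc hg hx hy ho => vc vg vx vy hc hg hx hy ho; lra.
Qed.

Lemma preY_preX (om c g x y yt A Yn ex rx : K) :
  yt <= (1 + ay / 4) * y + 5 / ay * (L ^+ 2 * A) ->
  yt <= 2 * y + 2 * (L ^+ 2 * A) ->
  A <= 3 * gx ^+ 2 * N ^+ 2 * c + 3 * q ^+ 2 * D ^+ 2 * (l ^+ 2 * Yn) +
    3 * gx ^+ 2 * N ^+ 2 * D ^+ 2 * ex ->
  preY om c g x yt A Yn ex rx + (kE * Cs + kR * (1 - delta)) * yt <=
    preX om c g x y Yn + mE * ex + mR * rx.
Proof.
move=> h1 h2 hA.
have ay' : 0 <= 1 - ay by rewrite subr_ge0.
have w0 : 0 <= wy * (1 + ay / 2) * (1 - ay).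
  by have := wy_gt0 => ?; nonneg.
have k0 : 0 <= kE * Cs by apply: mulr_ge0 => //; exact: kE_ge0.
have {}h1 := ler_wpM2l w0 h1.
have {}h2 := ler_wpM2l k0 h2.
have {}hA := ler_wpM2l TA_ge0 hA.
(* The retained share [1 - blr] and the compressed share [blr * (1 - delta)] add up to [1 - ay]. *)
have E : wy * (1 + ay / 2) * (1 - blr) * yt + kR * (1 - delta) * yt =
  wy * (1 + ay / 2) * (1 - ay) * yt by rewrite /kR /ay; ring.
have ETA : TA * A = cA * A + kE * Cs * (2 * (L ^+ 2 * A)) +
  wy * (1 + ay / 2) * (1 - ay) * (5 / ay * (L ^+ 2 * A)) by rewrite /TA; ring.
rewrite /preY /preX /KY /mE /mR /cy.
rewrite ETA in hA; move: h1 h2 hA E.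
move: wc wx wy cg1 cA kE kR TA => vc vx vy vg vA vE vR vT h1 h2 hA E.
lra.
Qed.

Lemma preX_contract (rho o c g x y G Yn : K) :
  0 <= o -> 0 <= c -> 0 <= g -> 0 <= x -> 0 <= y -> 0 <= G ->
  2 * mu * o <= G -> Yn <= 2 * g + 4 * uC ^+ 2 * (G + L ^+ 2 / n * c) ->
  1 - 2^-1 * lb * mu <= rho -> 1 - a / 16 <= rho -> 1 - b / 8 <= rho ->
  1 - ax / 4 <= rho -> 1 - ay / 16 <= rho ->
  preX (o - lb / 2 * G) c g x y Yn + (mE * Cs + mR * (1 - delta)) * x <=
    rho * (o + wc * c + wg * g + wx * x + wy * y).
Proof.
move=> o0 c0 g0 x0 y0 G0 hG hY r1 r2 r3 r4 r5.
have kl : 0 <= KY * l ^+ 2 by rewrite mulr_ge0 ?sqr_ge0// KY_ge0.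
have {}hY := ler_wpM2l kl hY.
have ho : o - lb / 2 * G + lb / 4 * G <= rho * o.
  apply: (@le_trans _ _ ((1 - 2^-1 * lb * mu) * o)); last by rewrite ler_wpM2r.
  by have := ler_wpM2l (ltW lb0) hG; lra.
have hc : (lb * L ^+ 2 / n + wc * (1 - a) + 3 * gx ^+ 2 * N ^+ 2 * TA +
    KY * l ^+ 2 * (4 * uC ^+ 2 * (L ^+ 2 / n))) * c <= rho * (wc * c).
  rewrite [leRHS]mulrA ler_wpM2r//; apply: le_trans cc_le _.
  by rewrite [leLHS]mulrC; apply: ler_wpM2r => //; exact: ltW wc_gt0.
have hg : (cg1 + 2 * (KY * l ^+ 2)) * g <= rho * (wg * g).
  rewrite [leRHS]mulrA ler_wpM2r//; apply: le_trans cg_le _.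
  by rewrite [leLHS]mulrC; apply: ler_wpM2r => //; exact: ltW wg_gt0.
have hx : (wx * (1 + ax / 2) * (1 - alr) + (mE * Cs + mR * (1 - delta))) * x <=
    rho * (wx * x).
  rewrite [leRHS]mulrA ler_wpM2r//; apply: (@le_trans _ _ (wx * (1 - ax / 4))).
    have E : wx * (1 + ax / 2) * (1 - alr) + mR * (1 - delta) =
       wx * ((1 + ax / 2) * (1 - ax)) by rewrite /mR /ax; ring.
    have [y1 _] := young_loss (ltW ax0).
    have := ler_wpM2l (ltW wx_gt0) y1; have := mE_le; rewrite -E.
    by lra.
  by rewrite [leLHS]mulrC; apply: ler_wpM2r => //; exact: ltW wx_gt0.
have hy : cy * y <= rho * (wy * y).
  rewrite [leRHS]mulrA ler_wpM2r//; apply: le_trans cy_le _.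
  by rewrite [leLHS]mulrC; apply: ler_wpM2r => //; exact: ltW wy_gt0.
have hG' : KY * l ^+ 2 * (4 * uC ^+ 2) * G <= lb / 4 * G.
  by rewrite ler_wpM2r//; have := cG_le; lra.
rewrite /preX; move: ho hc hg hx hy hG' hY.
move: wc wg wx wy cg1 cy KY mE mR TA.
move=> vc vg vx vy vg1 vcy vY vE vR vT ho hc hg hx hy hG' hY.
lra.
Qed.

End Lyapunov.

(** * Adapted norms and projections *)

Section AdaptedNorm.
Context {K : realType} {n : nat} {Pi B S : 'M[K]_n} {theta d2 : K}.
Hypotheses (an : adapted_norm Pi B S theta d2) (n_gt0 : (0 < n)%N).
Hypotheses (PiPi : Pi *m Pi = Pi) (PiT : Pi *m (1%:M - B) = 1%:M - B)
  (TPi : (1%:M - B) *m Pi = 1%:M - B).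

Let T := 1%:M - B.
Let N := opnorm S T.
Let Su := an_unit an.

Lemma an_d2_ge1 : 1 <= d2.
Proof.
pose v : 'cV[K]_n := const_mx 1.
have v0 : 0 < fnorm v.
  rewrite lt_neqAle fnorm_ge0 andbT eq_sym; apply/eqP => /fnorm_eq0.
  move=> /matrixP /(_ (Ordinal n_gt0) 0); rewrite !mxE => /eqP.
  by rewrite oner_eq0.
rewrite -(ler_pM2r v0) mul1r.
by apply: le_trans (an_d2 an v); exact: an_normalized an v.
Qed.

Lemma an_N_ge0 : 0 <= N. Proof. exact: opnorm_ge0. Qed.

Lemma an_contractP gam (v : 'cV[K]_n) : 0 < gam -> gam <= 1 ->
  fnorm (S *m (Pi *m relaxed B gam *m v)) <= (1 - theta * gam) * fnorm (S *m v).
Proof.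
move=> g0 g1; apply: le_trans (opnorm_ub Su _ _) _.
by rewrite ler_wpM2r ?fnorm_ge0// (an_contract an).
Qed.

Lemma an_PiP (v : 'cV[K]_n) : fnorm (S *m (Pi *m v)) <= fnorm (S *m v).
Proof. by have := opnorm_ub Su Pi v; rewrite (an_Pi an) mul1r. Qed.

(** At [gam = 1] the relaxed matrix is [B], and [Pi (I - B) = I - B] gives [I - B = Pi - Pi B], of
    norm at most [1 + (1 - theta)]. *)
Lemma an_N_le2 : N <= 2.
Proof.
apply: opnorm_le => // v.
have -> : T *m v = Pi *m v - Pi *m relaxed B 1 *m v.
  rewrite -mulmxBl; congr (_ *m v).
  rewrite /relaxed scale1r.
  rewrite -{1}(mulmx1 Pi) -mulmxBr.
  by rewrite opprB addrC subrK PiT.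
rewrite mulmxBr; apply: le_trans (fnormD _ _) _; rewrite fnormN.
have := an_PiP v; have := an_contractP v ltr01 (lexx 1).
have : 0 <= theta * 1 * fnorm (S *m v).
  by rewrite !mulr_ge0 ?fnorm_ge0// ltW// (an_theta_gt0 an).
lra.
Qed.

(** On the range of [Pi], the contraction at [gam = 1] gives [||w|| <= (1 - theta) ||w|| + N ||w||].
    If [N < theta] this forces [Pi = 0], against [||Pi|| = 1]. *)
Lemma an_theta_le_N : theta <= N.
Proof.
rewrite leNgt; apply/negP => Nth.
have Pi0 (v : 'cV[K]_n) : fnorm (S *m (Pi *m v)) = 0.
  have := an_contractP (Pi *m v) ltr01 (lexx 1).
  have := opnorm_ub Su T (Pi *m v).
  have -> : Pi *m relaxed B 1 *m (Pi *m v) = Pi *m v - T *m (Pi *m v).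
    rewrite /relaxed scale1r mulmxBr mulmx1 PiT mulmxBl.
    by rewrite (mulmxA Pi Pi v) PiPi.
  have := fnormD (S *m (Pi *m v - T *m (Pi *m v))) (S *m (T *m (Pi *m v))).
  rewrite -mulmxDr subrK; have := fnorm_ge0 (S *m (Pi *m v)).
  by rewrite -/N; set t := fnorm (S *m (Pi *m v)); nra.
have : opnorm S Pi <= 0.
  by apply: opnorm_le => // v; rewrite Pi0 mul0r.
by rewrite (an_Pi an) ler10.
Qed.

Context {p : nat}.
Implicit Types X : 'M[K]_(n, p).

Lemma sqn_le_adapted X : sqn X <= sqn (S *m X).
Proof.
have := @sqn_colwise K n n n p 1%:M S 1 X ler01.
rewrite mul1mx expr1n mul1r; apply => v.
by rewrite mul1mx mul1r; exact: an_normalized an v.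
Qed.

Lemma sqn_adapted_le X : sqn (S *m X) <= d2 ^+ 2 * sqn X.
Proof.
have := @sqn_colwise K n n n p S 1%:M d2 X (ltW (an_d2_gt0 an)).
by rewrite mul1mx; apply => v; rewrite mul1mx; exact: an_d2 an v.
Qed.

Lemma sqn_T X : sqn (S *m (T *m X)) <= N ^+ 2 * sqn (S *m X).
Proof.
have := @sqn_colwise K n n n p (S *m T) S N X an_N_ge0.
by rewrite -!mulmxA; apply => v; rewrite -mulmxA; exact: opnorm_ub.
Qed.

Lemma sqn_TPi X : sqn (T *m X) <= N ^+ 2 * sqn (S *m (Pi *m X)).
Proof.
apply: le_trans (sqn_le_adapted _) _.
by rewrite /T -{1}TPi -mulmxA; exact: sqn_T.
Qed.

Lemma sqn_T_d2 X : sqn (S *m (T *m X)) <= N ^+ 2 * d2 ^+ 2 * sqn X.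
Proof.
apply: le_trans (sqn_T _) _.
by rewrite -mulrA ler_wpM2l ?sqr_ge0// sqn_adapted_le.
Qed.

Lemma sqn_T_d2' X : sqn (T *m X) <= N ^+ 2 * d2 ^+ 2 * sqn X.
Proof. exact: le_trans (sqn_le_adapted _) (sqn_T_d2 _). Qed.

Lemma fnorm_relaxed gam (v : 'cV[K]_n) : 0 <= gam ->
  fnorm (S *m (relaxed B gam *m v)) <= (1 + gam * N) * fnorm (S *m v).
Proof.
move=> g0; rewrite /relaxed mulmxBl mul1mx -scalemxAl mulmxBr -scalemxAr.
apply: le_trans (fnormD _ _) _; rewrite fnormN fnormZ ger0_norm//.
by rewrite mulrDl mul1r lerD2l -mulrA ler_wpM2l// opnorm_ub.
Qed.

Lemma sqn_relaxed gam X : 0 <= gam ->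
  sqn (relaxed B gam *m X) <= (1 + gam * N) ^+ 2 * d2 ^+ 2 * sqn X.
Proof.
move=> g0; apply: le_trans (sqn_le_adapted _) _.
have k0 : 0 <= 1 + gam * N by rewrite addr_ge0// mulr_ge0// an_N_ge0.
have h : sqn (S *m relaxed B gam *m X) <= (1 + gam * N) ^+ 2 * sqn (S *m X).
  by apply: sqn_colwise => // v; rewrite -mulmxA; exact: fnorm_relaxed.
rewrite mulmxA; apply: le_trans h _.
by rewrite -mulrA ler_wpM2l ?sqr_ge0// sqn_adapted_le.
Qed.

(** Only the part through [I - B] passes by the adapted norm, so [d2] multiplies [gam * N] alone.
    The factor stays close to 1 when [gam * N * d2] is small, unlike that of [sqn_relaxed]. *)
Lemma sqn_relaxed_euclid gam X : 0 <= gam ->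
  sqn (relaxed B gam *m X) <= (1 + gam * N * d2) ^+ 2 * sqn X.
Proof.
move=> g0.
have d0 : 0 <= d2 by exact: ltW (an_d2_gt0 an).
have k0 : 0 <= 1 + gam * N * d2.
  by rewrite addr_ge0// !mulr_ge0// an_N_ge0.
have := @sqn_colwise K n n n p (relaxed B gam) 1%:M _ X k0.
rewrite mul1mx; apply => v; rewrite mul1mx.
rewrite /relaxed mulmxBl mul1mx -scalemxAl.
apply: le_trans (fnormD _ _) _; rewrite fnormN fnormZ ger0_norm//.
rewrite mulrDl mul1r lerD2l -!mulrA ler_wpM2l//.
apply: le_trans (an_normalized an _) _.
apply: le_trans (opnorm_ub Su _ _) _.
by rewrite ler_wpM2l ?an_N_ge0//; exact: an_d2 an v.
Qed.

Lemma sqn_contract gam X : 0 < gam -> gam <= 1 -> theta * gam <= 1 ->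
  sqn (S *m (Pi *m relaxed B gam *m X)) <= (1 - theta * gam) ^+ 2 * sqn (S *m X).
Proof.
move=> g0 g1 a1.
have k0 : 0 <= 1 - theta * gam by rewrite subr_ge0.
have := @sqn_colwise K n n n p (S *m (Pi *m relaxed B gam)) S _ X k0.
rewrite -!mulmxA; apply => v; rewrite -!mulmxA mulmxA -(mulmxA S) mulmxA.
by have := an_contractP v g0 g1; rewrite !mulmxA.
Qed.

Lemma Pi_relaxed gam : Pi *m relaxed B gam = Pi *m relaxed B gam *m Pi.
Proof.
by rewrite /relaxed mulmxBr mulmx1 -scalemxAr PiT mulmxBl PiPi -scalemxAl TPi.
Qed.

(* Young's inequality with ratio a / (1 - a), where a = theta gam. *)
Lemma sqn_contract_step gam X W : 0 < gam -> gam <= 1 -> theta * gam < 1 ->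
  sqn (S *m (Pi *m relaxed B gam *m X + W)) <=
  (1 - theta * gam) * sqn (S *m (Pi *m X)) + (theta * gam)^-1 * sqn (S *m W).
Proof.
move=> g0 g1 a1; have a0 : 0 < theta * gam by rewrite mulr_gt0// (an_theta_gt0 an).
have a10 : 0 < 1 - theta * gam by rewrite subr_gt0.
have t0 : 0 < theta * gam / (1 - theta * gam) by rewrite divr_gt0.
rewrite mulmxDr; apply: le_trans (sqnD_young _ _ t0) _.
rewrite Pi_relaxed -mulmxA.
have := sqn_contract (Pi *m X) g0 g1 (ltW a1).
set u := sqn _; set v := sqn (S *m (Pi *m X)); set w := sqn (S *m W).
move: {t0 a1} (theta * gam) a0 a10 => a a0 a10 uv; have -> : 1 + (a / (1 - a))^-1 = a^-1.
  by field; rewrite !gt_eqF.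
rewrite lerD2r.
have -> : 1 + a / (1 - a) = (1 - a)^-1.
  by field; rewrite gt_eqF.
by rewrite ler_pdivrMl// (le_trans uv)// mulrA.
Qed.

End AdaptedNorm.

(** * Projections off the consensus directions, and the size of the eigenvectors *)

Section Projections.
Context {K : realType} {n : nat}.
Hypothesis n_gt0 : (0 < n)%N.

Let nK : n%:R != 0 :> K. Proof. by rewrite pnatr_eq0 -lt0n. Qed.

Lemma ones_mul (u : 'cV[K]_n) (k : K) : \sum_i u i 0 = k ->
  (const_mx 1 : 'rV[K]_n) *m u = k%:M.
Proof.
move=> <-; apply/matrixP => i j; rewrite !ord1 !mxE eqxx mulr1n.
by apply: eq_bigr => l _; rewrite mxE mul1r.
Qed.

Lemma mul_ones (u : 'cV[K]_n) (k : K) : \sum_i u i 0 = k ->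
  u^T *m (const_mx 1 : 'cV[K]_n) = k%:M.
Proof.
move=> <-; apply/matrixP => i j; rewrite !ord1 !mxE eqxx mulr1n.
by apply: eq_bigr => l _; rewrite !mxE mulr1.
Qed.

Section Row.
Context {R : 'M[K]_n} {uR : 'cV[K]_n}.
Hypotheses (huR : left_eigvec R uR)
  (R1 : R *m const_mx 1 = const_mx 1 :> 'cV[K]_n).

Let uR1 : uR^T *m (const_mx 1 : 'cV[K]_n) = n%:R%:M.
Proof. by have [_ _ s] := huR; exact: mul_ones. Qed.

Lemma uR_IR : uR^T *m (1%:M - R) = 0.
Proof. by have [_ s _] := huR; rewrite mulmxBr mulmx1 s subrr. Qed.

Lemma IR_ones : (1%:M - R) *m (const_mx 1 : 'cV[K]_n) = 0.
Proof. by rewrite mulmxBl mul1mx R1 subrr. Qed.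

Lemma uR_relaxed g : uR^T *m relaxed R g = uR^T.
Proof. by rewrite /relaxed mulmxBr mulmx1 -scalemxAr uR_IR scaler0 subr0. Qed.

Lemma PiR_idem : Pi_R uR *m Pi_R uR = Pi_R uR.
Proof.
rewrite {2}/Pi_R mulmxBr mulmx1 -scalemxAr mulmxA.
have -> : Pi_R uR *m (const_mx 1 : 'cV[K]_n) = 0.
  rewrite /Pi_R mulmxBl mul1mx -scalemxAl -mulmxA uR1 mul_mx_scalar scalerA.
  by rewrite mulVf// scale1r subrr.
by rewrite mul0mx scaler0 subr0.
Qed.

Lemma PiR_IR : Pi_R uR *m (1%:M - R) = 1%:M - R.
Proof.
by rewrite {1}/Pi_R mulmxBl mul1mx -scalemxAl -mulmxA uR_IR mulmx0 scaler0 subr0.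
Qed.

Lemma IR_PiR : (1%:M - R) *m Pi_R uR = 1%:M - R.
Proof.
by rewrite {1}/Pi_R mulmxBr mulmx1 -scalemxAr mulmxA IR_ones mul0mx scaler0 subr0.
Qed.

Lemma row_PiR p (X : 'M[K]_(n, p)) i :
  row i (Pi_R uR *m X) = row i X - n%:R^-1 *: (uR^T *m X).
Proof.
rewrite /Pi_R mulmxBl mul1mx -scalemxAl linearB/= linearZ/= -mulmxA.
congr (_ - _ *: _); apply/rowP => j; rewrite !mxE big_ord1 !mxE mul1r.
by apply: eq_bigr => k _; rewrite mxE.
Qed.

(** The bound [||Pi_R||_R = 1] is tested on [uR] itself: [Pi_R uR = uR - (||uR||^2 / n) 1] has
    squared norm [||uR||^2 (||uR||^2 / n - 1)]. Hence [||uR||^2 / n <= 1 + dR^2 <= 2 dR^2]. *)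
Lemma sqn_uR_le Rt thR dR : adapted_norm (Pi_R uR) R Rt thR dR ->
  sqn uR <= 2 * dR ^+ 2 * n%:R.
Proof.
move=> an; have Su := an_unit an; have d1 := an_d2_ge1 an n_gt0.
have n0 : 0 < n%:R :> K by rewrite ltr0n.
have [->|uR0] := eqVneq uR 0; first by rewrite sqn0; nonneg.
have s0 : 0 < sqn uR.
  by rewrite lt_neqAle sqn_ge0 andbT eq_sym; apply: contra_neq uR0 => /sqn_eq0.
have h : sqn (Pi_R uR *m uR) <= dR ^+ 2 * sqn uR.
  apply: le_trans (sqn_le_adapted an _) _.
  apply: le_trans (sqn_adapted_le an _).
  by rewrite -!sqr_fnorm ler_sqr_ge0 ?fnorm_ge0// (an_PiP an).
have suR : uR^T *m uR = (sqn uR)%:M.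
  apply/matrixP => i j; rewrite !ord1 !mxE eqxx mulr1n /sqn.
  by apply: eq_bigr => l _; rewrite big_ord1 !mxE expr2.
have E : sqn (Pi_R uR *m uR) = sqn uR * (sqn uR / n%:R - 1).
  rewrite /Pi_R mulmxBl mul1mx -scalemxAl -mulmxA suR mul_mx_scalar scalerA.
  have [_ _ sm] := huR; set t := n%:R^-1 * sqn uR.
  have -> : sqn (uR - t *: const_mx 1) = sqn uR - 2 * t * n%:R + t ^+ 2 * n%:R.
    transitivity (\sum_i (uR i 0 ^+ 2 + - (2 * t) * uR i 0 + t ^+ 2)).
      by apply: eq_bigr => i _; rewrite big_ord1 !mxE; ring.
    rewrite !big_split/= -mulr_sumr sm sumr_const card_ord -mulr_natr.
    rewrite [sqn uR](_ : _ = \sum_i uR i 0 ^+ 2); first by ring.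
    by apply: eq_bigr => i _; rewrite big_ord1.
  by rewrite /t; field.
move: h; rewrite E [leRHS]mulrC ler_pM2l// lerBlDr ler_pdivrMr// => h.
apply: le_trans h _; rewrite ler_pM2r//.
have : 1 <= dR ^+ 2 by rewrite exprn_ege1.
lra.
Qed.

End Row.

Section Column.
Context {C : 'M[K]_n} {uC : 'cV[K]_n}.
Hypotheses (huC : right_eigvec C uC)
  (C1 : const_mx 1 *m C = const_mx 1 :> 'rV[K]_n).

Let uC1 : (const_mx 1 : 'rV[K]_n) *m uC = n%:R%:M.
Proof. by have [_ _ s] := huC; exact: ones_mul. Qed.

Lemma IC_uC : (1%:M - C) *m uC = 0.
Proof. by have [_ s _] := huC; rewrite mulmxBl mul1mx s subrr. Qed.

Lemma ones_IC : (const_mx 1 : 'rV[K]_n) *m (1%:M - C) = 0.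
Proof. by rewrite mulmxBr mulmx1 C1 subrr. Qed.

Lemma PiC_idem : Pi_C uC *m Pi_C uC = Pi_C uC.
Proof.
rewrite {1}/Pi_C mulmxBl mul1mx -scalemxAl -mulmxA.
have -> : (const_mx 1 : 'rV[K]_n) *m Pi_C uC = 0.
  rewrite /Pi_C mulmxBr mulmx1 -scalemxAr mulmxA uC1 mul_scalar_mx scalerA.
  by rewrite mulVf// scale1r subrr.
by rewrite mulmx0 scaler0 subr0.
Qed.

Lemma PiC_IC : Pi_C uC *m (1%:M - C) = 1%:M - C.
Proof.
by rewrite {1}/Pi_C mulmxBl mul1mx -scalemxAl -mulmxA ones_IC mulmx0 scaler0 subr0.
Qed.

Lemma IC_PiC : (1%:M - C) *m Pi_C uC = 1%:M - C.
Proof.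
by rewrite {1}/Pi_C mulmxBr mulmx1 -scalemxAr mulmxA IC_uC mul0mx scaler0 subr0.
Qed.

Lemma PiC_decomp p (Y : 'M[K]_(n, p)) :
  Y = Pi_C uC *m Y + uC *m (n%:R^-1 *: (const_mx 1 *m Y)).
Proof.
by rewrite /Pi_C mulmxBl mul1mx -scalemxAl -scalemxAr mulmxA subrK.
Qed.

(** Here the test vector is the all-ones vector: [Pi_C 1 = 1 - uC] has squared norm [||uC||^2 - n],
    which is at most [dC^2 n]. *)
Lemma sqn_uC_le Ct thC dC : adapted_norm (Pi_C uC) C Ct thC dC ->
  sqn uC <= 2 * dC ^+ 2 * n%:R.
Proof.
move=> an; have Su := an_unit an; have d1 := an_d2_ge1 an n_gt0.
have n0 : 0 < n%:R :> K by rewrite ltr0n.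
pose o : 'cV[K]_n := const_mx 1.
have so : sqn o = n%:R.
  rewrite /sqn -[n in RHS]card_ord -sumr_const; apply: eq_bigr => i _.
  by rewrite big_ord1 mxE expr1n.
have h : sqn (Pi_C uC *m o) <= dC ^+ 2 * sqn o.
  apply: le_trans (sqn_le_adapted an _) _.
  apply: le_trans (sqn_adapted_le an _).
  by rewrite -!sqr_fnorm ler_sqr_ge0 ?fnorm_ge0// (an_PiP an).
have E : sqn (Pi_C uC *m o) = sqn uC - n%:R.
  have -> : Pi_C uC *m o = o - uC.
    rewrite /Pi_C mulmxBl mul1mx -scalemxAl -mulmxA.
    have -> : (const_mx 1 : 'rV[K]_n) *m o = n%:R%:M.
      apply: ones_mul; rewrite -[n in RHS]card_ord -sumr_const.
      by apply: eq_bigr => i _; rewrite mxE.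
    by rewrite mul_mx_scalar scalerA mulVf// scale1r.
  have [_ _ sm] := huC.
  have -> : sqn (o - uC) = sqn o - 2 * \sum_i uC i 0 + sqn uC.
    rewrite mulr_sumr /sqn -sumrB -big_split/=; apply: eq_bigr => i _.
    by rewrite !big_ord1 !mxE; ring.
  by rewrite so sm; ring.
move: h; rewrite E so; have : 1 <= dC ^+ 2 by rewrite exprn_ege1.
by move: n0; set m := n%:R; nra.
Qed.

End Column.

End Projections.

(** * One iteration at a fixed outcome *)

Section GradientField.
Context {K : realType} {n p : nat} {f : 'I_n -> 'rV[K]_p -> K} {L : K}.
Hypotheses (n_gt0 : (0 < n)%N) (L0 : 0 <= L) (sf : forall i, smooth L (f i)).

Lemma row_gradF (X : 'M[K]_(n, p)) i : row i (gradF f X) = grad (f i) (row i X).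
Proof. by apply/rowP => j; rewrite !mxE. Qed.

Lemma sqn_gradF_le (X X' : 'M[K]_(n, p)) :
  sqn (gradF f X' - gradF f X) <= L ^+ 2 * sqn (X' - X).
Proof.
rewrite !(sqn_row (_ - _)) mulr_sumr ler_sum// => i _.
by rewrite !linearB/= !row_gradF; have [_] := sf i; apply.
Qed.

Lemma ones_gradF (X : 'M[K]_(n, p)) :
  (const_mx 1 : 'rV[K]_n) *m gradF f X = \sum_i grad (f i) (row i X).
Proof.
apply/rowP => j; rewrite !mxE summxE; apply: eq_bigr => i _.
by rewrite !mxE mul1r.
Qed.

Lemma mean_grad_deviation (uR : 'cV[K]_n) (X : 'M[K]_(n, p)) :
  sqn (n%:R^-1 *: (const_mx 1 *m gradF f X) -
    grad (favg f) (n%:R^-1 *: (uR^T *m X))) <=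
  L ^+ 2 / n%:R * sqn (Pi_R uR *m X).
Proof.
rewrite ones_gradF grad_favg; last by move=> i; have [] := sf i.
rewrite -scalerBr -sumrB; apply: le_trans (sqn_mean _) _.
rewrite mulrAC [leRHS]mulrC ler_wpM2l ?invr_ge0 ?ler0n//.
rewrite (sqn_row (Pi_R _ *m _)) mulr_sumr ler_sum// => i _.
by rewrite row_PiR; have [_] := sf i; apply.
Qed.

End GradientField.

(** Mixing with the estimate [H] instead of [X] is exact relaxed mixing plus a multiple of the
    compression error [X - H], seen through [I - B]. *)
Lemma relaxed_mixing (K : realType) n p (B : 'M[K]_n) (g : K) (X H : 'M[K]_(n, p)) :
  X - g *: (H - B *m H) = relaxed B g *m X + g *: ((1%:M - B) *m (X - H)).
Proof.
rewrite (_ : H - B *m H = (1%:M - B) *m H); last by rewrite mulmxBl mul1mx.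
have -> : relaxed B g *m X = X - g *: ((1%:M - B) *m X).
  by rewrite /relaxed mulmxBl mul1mx -scalemxAl.
by rewrite mulmxBr scalerBr addrA subrK.
Qed.

Section PointwiseStep.
Context {K : realType} {n p : nat} {R C : 'M[K]_n} {uR uC : 'cV[K]_n}
  {Rt Ct : 'M[K]_n} {thR thC dR dC : K} {f : 'I_n -> 'rV[K]_p -> K} {L : K}
  {lam : 'rV[K]_n} {l lb gx gy alx aly r : K}.
Hypotheses (n_gt0 : (0 < n)%N) (huR : left_eigvec R uR)
  (huC : right_eigvec C uC)
  (R1 : R *m const_mx 1 = const_mx 1 :> 'cV[K]_n)
  (C1 : const_mx 1 *m C = const_mx 1 :> 'rV[K]_n)
  (anR : adapted_norm (Pi_R uR) R Rt thR dR)
  (anC : adapted_norm (Pi_C uC) C Ct thC dC)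
  (L0 : 0 <= L) (sf : forall i, smooth L (f i))
  (lam_l : forall i, 0 <= lam 0 i <= l)
  (lbE : lb = n%:R^-1 * (uR^T *m diag_mx lam *m uC) 0 0)
  (lb0 : 0 < lb) (lbL : lb * L <= 1)
  (gx0 : 0 < gx) (gx1 : gx <= 1) (gy0 : 0 < gy) (gy1 : gy <= 1)
  (ax1 : thR * gx < 1) (ay1 : thC * gy < 1).

Let Lam := diag_mx lam.
Let N := opnorm Rt (1%:M - R).
Let S := opnorm Ct (1%:M - C).
Let TR := 1%:M - R.
Let TC := 1%:M - C.
Let RR := PiR_idem n_gt0 huR.
Let RT : Pi_R uR *m TR = TR := PiR_IR huR.
Let TRP := IR_PiR (uR := uR) R1.
Let CC := PiC_idem n_gt0 huC.
Let CT : Pi_C uC *m TC = TC := PiC_IC (uC := uC) C1.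
Let TCP := IC_PiC huC.
Let a0 : 0 < thR * gx.
Proof. by rewrite mulr_gt0// (an_theta_gt0 anR). Qed.
Let b0 : 0 < thC * gy.
Proof. by rewrite mulr_gt0// (an_theta_gt0 anC). Qed.

Context {X Y Hx HR Hy HC Qx Qy : 'M[K]_(n, p)}.
Hypotheses (HRE : HR = R *m Hx) (HCE : HC = C *m Hy)
  (sumY : (const_mx 1 : 'rV[K]_n) *m Y = const_mx 1 *m gradF f X).

Let Xt := X - Lam *m Y.
Let Dx := Xt - Hx.
Let X' := Xt - gx *: (Hx + Qx - (HR + R *m Qx)).
Let Yt := Y + gradF f X' - gradF f X.
Let Dy := Yt - Hy.
Let Y' := Yt - gy *: (Hy + Qy - (HC + C *m Qy)).
Let xbar := n%:R^-1 *: (uR^T *m X).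
Let gF := grad (favg f) xbar.
Let ybar : 'rV[K]_p := n%:R^-1 *: (const_mx 1 *m Y).
Let dF := gradF f X' - gradF f X.

Let X'E : X' = relaxed R gx *m Xt + gx *: (TR *m (Dx - Qx)).
Proof.
by rewrite /X' HRE -mulmxDr relaxed_mixing opprD addrA.
Qed.

Let Y'E : Y' = relaxed C gy *m Yt + gy *: (TC *m (Dy - Qy)).
Proof.
by rewrite /Y' HCE -mulmxDr relaxed_mixing opprD addrA.
Qed.

Let sqnLamY : sqn (Lam *m Y) <= l ^+ 2 * sqn Y.
Proof. exact: sqn_diag. Qed.

Let sqn_dF : sqn dF <= L ^+ 2 * sqn (X' - X).
Proof. exact: sqn_gradF_le. Qed.

Lemma step_consensus : sqn (Rt *m (Pi_R uR *m X')) <=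
  (1 - thR * gx) * sqn (Rt *m (Pi_R uR *m X)) +
  2 * dR ^+ 2 / (thR * gx) * (l ^+ 2 * sqn Y) +
  2 * gx ^+ 2 * dR ^+ 2 * N ^+ 2 / (thR * gx) * sqn (Dx - Qx).
Proof.
pose W := - (Pi_R uR *m relaxed R gx *m (Lam *m Y)) + gx *: (TR *m (Dx - Qx)).
have -> : Pi_R uR *m X' = Pi_R uR *m relaxed R gx *m X + W.
  rewrite X'E mulmxDr -scalemxAr !mulmxA RT /W addrA; congr (_ + _).
  by rewrite -mulmxN -mulmxDr.
apply: le_trans (sqn_contract_step anR RR RT TRP _ _ gx0 gx1 ax1) _.
rewrite -addrA lerD2l.
have hW : sqn (Rt *m W) <= 2 * (dR ^+ 2 * (l ^+ 2 * sqn Y)) +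
    2 * (gx ^+ 2 * (N ^+ 2 * dR ^+ 2 * sqn (Dx - Qx))).
  rewrite /W mulmxDr; apply: le_trans (sqnD2 _ _) _.
  rewrite mulmxN sqnN -scalemxAr sqnZ.
  apply: lerD; rewrite ler_pM2l//; last first.
    by rewrite ler_wpM2l ?sqr_ge0//; exact: (sqn_T_d2 anR n_gt0).
  apply: le_trans (sqn_contract anR _ gx0 gx1 (ltW ax1)) _.
  apply: (@le_trans _ _ (1 * sqn (Rt *m (Lam *m Y)))).
    by rewrite ler_wpM2r ?sqn_ge0// expr_le1 ?subr_ge0 ?(ltW ax1)// gerBl ltW.
  rewrite mul1r; apply: le_trans (sqn_adapted_le anR _) _.
  by rewrite ler_wpM2l ?sqr_ge0.
have i0 : 0 <= (thR * gx)^-1 by rewrite invr_ge0 ltW.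
have := ler_wpM2l i0 hW; lra.
Qed.

Lemma step_move : sqn (X' - X) <=
  3 * gx ^+ 2 * N ^+ 2 * sqn (Rt *m (Pi_R uR *m X)) +
  3 * (1 + gx * N) ^+ 2 * dR ^+ 2 * (l ^+ 2 * sqn Y) +
  3 * gx ^+ 2 * N ^+ 2 * dR ^+ 2 * sqn (Dx - Qx).
Proof.
have -> : X' - X = - (gx *: (TR *m X)) - relaxed R gx *m (Lam *m Y) +
    gx *: (TR *m (Dx - Qx)).
  have E : relaxed R gx *m X = X - gx *: (TR *m X).
    by rewrite /relaxed mulmxBl mul1mx -scalemxAl.
  rewrite X'E mulmxBr E; move: (gx *: (TR *m X)) (relaxed R gx *m _) (gx *: _).
  by move=> A1 A2 A3; apply/matrixP => i j; rewrite !mxE; ring.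
apply: le_trans (sqnD3 _ _ _) _; rewrite !sqnN !sqnZ.
have h1 := sqn_TPi anR n_gt0 TRP X.
have h2 : sqn (relaxed R gx *m (Lam *m Y)) <=
    (1 + gx * N) ^+ 2 * dR ^+ 2 * (l ^+ 2 * sqn Y).
  apply: le_trans (sqn_relaxed anR n_gt0 _ (ltW gx0)) _.
  by rewrite ler_wpM2l// mulr_ge0 ?sqr_ge0.
have h3 := sqn_T_d2' anR n_gt0 (Dx - Qx).
have {}h1 := ler_wpM2l (sqr_ge0 gx) h1.
have {}h3 := ler_wpM2l (sqr_ge0 gx) h3.
by move: h1 h2 h3; rewrite -/N -/TR; lra.
Qed.

Lemma step_tracking : sqn (Ct *m (Pi_C uC *m Y')) <=
  (1 - thC * gy) * sqn (Ct *m (Pi_C uC *m Y)) +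
  2 * dC ^+ 2 * L ^+ 2 / (thC * gy) * sqn (X' - X) +
  2 * gy ^+ 2 * dC ^+ 2 * S ^+ 2 / (thC * gy) * sqn (Dy - Qy).
Proof.
pose W := Pi_C uC *m relaxed C gy *m dF + gy *: (TC *m (Dy - Qy)).
have -> : Pi_C uC *m Y' = Pi_C uC *m relaxed C gy *m Y + W.
  rewrite Y'E mulmxDr -scalemxAr !mulmxA CT /W addrA; congr (_ + _).
  by rewrite -mulmxDr /Yt /dF addrA.
apply: le_trans (sqn_contract_step anC CC CT TCP _ _ gy0 gy1 ay1) _.
rewrite -addrA lerD2l.
have hW : sqn (Ct *m W) <= 2 * (dC ^+ 2 * (L ^+ 2 * sqn (X' - X))) +
    2 * (gy ^+ 2 * (S ^+ 2 * dC ^+ 2 * sqn (Dy - Qy))).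
  rewrite /W mulmxDr; apply: le_trans (sqnD2 _ _) _.
  rewrite -scalemxAr sqnZ.
  apply: lerD; rewrite ler_pM2l//; last first.
    by rewrite ler_wpM2l ?sqr_ge0//; exact: (sqn_T_d2 anC n_gt0).
  apply: le_trans (sqn_contract anC _ gy0 gy1 (ltW ay1)) _.
  apply: (@le_trans _ _ (1 * sqn (Ct *m dF))).
    by rewrite ler_wpM2r ?sqn_ge0// expr_le1 ?subr_ge0 ?(ltW ay1)// gerBl ltW.
  rewrite mul1r; apply: le_trans (sqn_adapted_le anC _) _.
  by rewrite ler_wpM2l ?sqr_ge0.
have i0 : 0 <= (thC * gy)^-1 by rewrite invr_ge0 ltW.
have := ler_wpM2l i0 hW; lra.
Qed.

Lemma step_dY : sqn (Y' - Y) <=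
  3 * (1 + gy * S * dC) ^+ 2 * L ^+ 2 * sqn (X' - X) +
  3 * gy ^+ 2 * S ^+ 2 * sqn (Ct *m (Pi_C uC *m Y)) +
  3 * gy ^+ 2 * S ^+ 2 * dC ^+ 2 * sqn (Dy - Qy).
Proof.
have -> : Y' - Y = relaxed C gy *m dF + (- (gy *: (TC *m Y))) +
    gy *: (TC *m (Dy - Qy)).
  have E : relaxed C gy *m Y = Y - gy *: (TC *m Y).
    by rewrite /relaxed mulmxBl mul1mx -scalemxAl.
  have -> : Y' = relaxed C gy *m Y + relaxed C gy *m dF + gy *: (TC *m (Dy - Qy)).
    by rewrite Y'E -mulmxDr /Yt /dF addrA.
  rewrite E; move: (gy *: (TC *m Y)) (relaxed C gy *m _) (gy *: _).
  by move=> A1 A2 A3; apply/matrixP => i j; rewrite !mxE; ring.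
apply: le_trans (sqnD3 _ _ _) _; rewrite !sqnN !sqnZ.
have h1 := sqn_TPi anC n_gt0 TCP Y.
have h2 : sqn (relaxed C gy *m dF) <=
    (1 + gy * S * dC) ^+ 2 * (L ^+ 2 * sqn (X' - X)).
  apply: le_trans (sqn_relaxed_euclid anC n_gt0 _ (ltW gy0)) _.
  by rewrite ler_wpM2l ?sqr_ge0.
have h3 := sqn_T_d2' anC n_gt0 (Dy - Qy).
have {}h1 := ler_wpM2l (sqr_ge0 gy) h1.
have {}h3 := ler_wpM2l (sqr_ge0 gy) h3.
by move: h1 h2 h3; rewrite -/S -/TC; lra.
Qed.

(** [D - al Q] is the convex combination of [D] and [D - Q / r] with weights [1 - al r] and [al r];
    this is where [al <= 1 / r] enters. *)
Lemma innovation_update (ar : K) (D Q : 'M[K]_(n, p)) (al : K) :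
  0 < r -> ar = al * r -> 0 <= ar -> ar <= 1 ->
  sqn (D - al *: Q) <= (1 - ar) * sqn D + ar * sqn (D - r^-1 *: Q).
Proof.
move=> r0 arE ar0 ar1; apply: le_trans (sqn_convex _ _ ar0 ar1).
rewrite le_eqVlt; apply/orP; left; apply/eqP; congr sqn.
rewrite scalerBr scalerA arE -mulrA mulfV ?gt_eqF// mulr1 addrA.
by rewrite scalerBl scale1r subrK.
Qed.

Lemma step_innovation_x (ax del : K) : 0 < r -> 0 < alx -> alx * r <= 1 ->
  0 < del -> del <= 1 -> ax = alx * r * del ->
  sqn (X' - Lam *m Y' - ((1 - alx) *: Hx + alx *: (Hx + Qx))) <=
  (1 + ax / 2) * ((1 - alx * r) * sqn Dx + alx * r * sqn (Dx - r^-1 *: Qx)) +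
  3 / ax * (2 * sqn (X' - X) + 2 * l ^+ 2 * sqn (Y' - Y)).
Proof.
move=> r0 al0 al1 del0 del1 axE.
have ar0 : 0 < alx * r by rewrite mulr_gt0.
have ax0 : 0 < ax by rewrite axE mulr_gt0.
have ax1' : ax <= 1 by rewrite axE mulr_ile1// ltW.
have -> : X' - Lam *m Y' - ((1 - alx) *: Hx + alx *: (Hx + Qx)) =
   (Dx - alx *: Qx) + ((X' - X) - Lam *m (Y' - Y)).
  rewrite scalerDr addrA -scalerDl subrK scale1r /Dx /Xt (mulmxBr Lam Y' Y).
  move: (X' : 'M[K]_(n, p)) (Lam *m _) (Lam *m _) => A1 A2 A3.
  by apply/matrixP => i j; rewrite !mxE; ring.
(* Young's inequality with ratio [ax / 2] puts [1 + 2 / ax <= 3 / ax] on the drift, as [ax <= 1]. *)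
have t0 : 0 < ax / 2 by rewrite divr_gt0.
apply: le_trans (sqnD_young _ _ t0) _; apply: lerD.
  rewrite ler_pM2l ?addr_gt0//.
  by apply: innovation_update => //; exact: ltW.
have h : sqn ((X' - X) - Lam *m (Y' - Y)) <=
    2 * sqn (X' - X) + 2 * l ^+ 2 * sqn (Y' - Y).
  apply: le_trans (sqnD2 _ _) _; rewrite lerD2l sqnN -[leRHS]mulrA ler_pM2l//.
  exact: sqn_diag.
apply: ler_pM => //; rewrite ?sqn_ge0//; first by rewrite addr_ge0 ?invr_ge0 ?ltW.
rewrite invf_div (_ : 3 / ax = 1 / ax + 2 / ax); last by field; rewrite gt_eqF.
by rewrite lerD2r ler_pdivlMr// mul1r.
Qed.

(** The error tracked is that of [Y'] and not of the next [Yt], whose gradient increment depends on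
    the following move of [X]; the increment is added in [innovation_y_bounds]. The 9 is 3 from
    Young's inequality times 3 from the three terms of [V]. *)
Lemma step_innovation_y (ay del : K) : 0 < r -> 0 < aly -> aly * r <= 1 ->
  0 < del -> del <= 1 -> ay = aly * r * del ->
  sqn (Y' - ((1 - aly) *: Hy + aly *: (Hy + Qy))) <=
  (1 + ay / 2) * ((1 - aly * r) * sqn Dy + aly * r * sqn (Dy - r^-1 *: Qy)) +
  9 / ay * (gy ^+ 2 * S ^+ 2 * sqn (Ct *m (Pi_C uC *m Y)) +
    gy ^+ 2 * S ^+ 2 * dC ^+ 2 * L ^+ 2 * sqn (X' - X) +
    gy ^+ 2 * S ^+ 2 * dC ^+ 2 * sqn (Dy - Qy)).
Proof.
move=> r0 al0 al1 del0 del1 ayE.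
have ar0 : 0 < aly * r by rewrite mulr_gt0.
have ay0 : 0 < ay by rewrite ayE mulr_gt0.
have ay1' : ay <= 1 by rewrite ayE mulr_ile1// ltW.
pose V := - (gy *: (TC *m Y)) + (- (gy *: (TC *m dF))) + gy *: (TC *m (Dy - Qy)).
have -> : Y' - ((1 - aly) *: Hy + aly *: (Hy + Qy)) = (Dy - aly *: Qy) + V.
  rewrite scalerDr addrA -scalerDl subrK scale1r /V Y'E /relaxed mulmxBl mul1mx.
  rewrite -scalemxAl -/TC (_ : TC *m Yt = TC *m Y + TC *m dF); last first.
    by rewrite -mulmxDr /Yt /dF addrA.
  move: (TC *m Y) (TC *m dF) (TC *m _) => A1 A2 A3; rewrite /Dy.
  move: (Yt : 'M[K]_(n, p)) => A4.
  by apply/matrixP => i j; rewrite !mxE; ring.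
have t0 : 0 < ay / 2 by rewrite divr_gt0.
apply: le_trans (sqnD_young _ _ t0) _; apply: lerD.
  rewrite ler_pM2l ?addr_gt0//.
  by apply: innovation_update => //; exact: ltW.
have h : sqn V <= 3 * (gy ^+ 2 * S ^+ 2 * sqn (Ct *m (Pi_C uC *m Y)) +
    gy ^+ 2 * S ^+ 2 * dC ^+ 2 * L ^+ 2 * sqn (X' - X) +
    gy ^+ 2 * S ^+ 2 * dC ^+ 2 * sqn (Dy - Qy)).
  apply: le_trans (sqnD3 _ _ _) _; rewrite !sqnN !sqnZ.
  have h1 := sqn_TPi anC n_gt0 TCP Y.
  have h2 : sqn (TC *m dF) <= S ^+ 2 * dC ^+ 2 * (L ^+ 2 * sqn (X' - X)).
    apply: le_trans (sqn_T_d2' anC n_gt0 _) _.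
    by rewrite ler_wpM2l// mulr_ge0 ?sqr_ge0.
  have h3 := sqn_T_d2' anC n_gt0 (Dy - Qy).
  have {}h1 := ler_wpM2l (sqr_ge0 gy) h1.
  have {}h2 := ler_wpM2l (sqr_ge0 gy) h2.
  have {}h3 := ler_wpM2l (sqr_ge0 gy) h3.
  by move: h1 h2 h3; rewrite -/S -/TC; lra.
rewrite (_ : 9 / ay = 3 / ay * 3); last by field; rewrite gt_eqF.
rewrite -[leRHS]mulrA.
apply: ler_pM => //; rewrite ?sqn_ge0//; first by rewrite addr_ge0 ?invr_ge0 ?ltW.
rewrite invf_div (_ : 3 / ay = 1 / ay + 2 / ay); last by field; rewrite gt_eqF.
by rewrite lerD2r ler_pdivlMr// mul1r.
Qed.

Lemma innovation_y_bounds (ay : K) : 0 < ay -> ay <= 1 ->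
  sqn Dy <= (1 + ay / 4) * sqn (Y - Hy) + 5 / ay * (L ^+ 2 * sqn (X' - X)) /\
  sqn Dy <= 2 * sqn (Y - Hy) + 2 * (L ^+ 2 * sqn (X' - X)).
Proof.
move=> ay0 ay1'; have E : Dy = (Y - Hy) + dF.
  rewrite /Dy /Yt /dF; move: (gradF f X') (gradF f X) => A1 A2.
  by apply/matrixP => i j; rewrite !mxE; ring.
split; rewrite E; last first.
  by apply: le_trans (sqnD2 _ _) _; rewrite lerD2l ler_pM2l.
have t0 : 0 < ay / 4 by rewrite divr_gt0.
apply: le_trans (sqnD_young _ _ t0) _; rewrite lerD2l.
apply: ler_pM => //; rewrite ?sqn_ge0//; first by rewrite addr_ge0 ?invr_ge0 ?ltW.
rewrite invf_div (_ : 5 / ay = 1 / ay + 4 / ay); last by field; rewrite gt_eqF.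
by rewrite lerD2r ler_pdivlMr// mul1r.
Qed.

Let ybarE : ybar = n%:R^-1 *: (const_mx 1 *m gradF f X).
Proof. by rewrite /ybar sumY. Qed.

Let sqn_ybar_gF : sqn (ybar - gF) <=
  L ^+ 2 / n%:R * sqn (Rt *m (Pi_R uR *m X)).
Proof.
rewrite ybarE; apply: le_trans (mean_grad_deviation sf uR X) _.
by rewrite ler_wpM2l ?divr_ge0 ?sqr_ge0 ?ler0n// (sqn_le_adapted anR).
Qed.

Lemma sqn_Y_le : sqn Y <= 2 * sqn (Ct *m (Pi_C uC *m Y)) +
  4 * fnorm uC ^+ 2 * (sqn gF + L ^+ 2 / n%:R * sqn (Rt *m (Pi_R uR *m X))).
Proof.
rewrite {1}(PiC_decomp (uC := uC) Y) -/ybar; apply: le_trans (sqnD2 _ _) _.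
apply: lerD; first by rewrite ler_pM2l// (sqn_le_adapted anC).
rewrite sqr_fnorm.
have h1 : sqn ybar <= 2 * (sqn gF + L ^+ 2 / n%:R * sqn (Rt *m (Pi_R uR *m X))).
  rewrite -(subrK gF ybar); apply: le_trans (sqnD2 _ _) _.
  by have := sqn_ybar_gF; lra.
have h2 := sqn_mulmx uC ybar.
have := ler_wpM2l (sqn_ge0 uC) h1; lra.
Qed.

(** [uR^T (I - R) = 0] removes mixing and compression error from the average, which moves by [- v].
    As [lb] is exactly [uR^T Lam uC / n], the deviation [v - lb gF] splits into a tracking part and
    [lb (ybar - gF)], the latter controlled by consensus. *)
Lemma step_objective (xs : 'rV[K]_p) :
  favg f (n%:R^-1 *: (uR^T *m X')) - favg f xs <=
  favg f xbar - favg f xs - lb / 2 * sqn gF +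
  lb * L ^+ 2 / n%:R * sqn (Rt *m (Pi_R uR *m X)) +
  fnorm uR ^+ 2 * l ^+ 2 / (n%:R ^+ 2 * lb) * sqn (Ct *m (Pi_C uC *m Y)).
Proof.
have n0 : 0 < n%:R :> K by rewrite ltr0n.
pose v := n%:R^-1 *: (uR^T *m (Lam *m Y)).
have -> : n%:R^-1 *: (uR^T *m X') = xbar - v.
  rewrite X'E mulmxDr mulmxA (uR_relaxed huR) -scalemxAr mulmxA (uR_IR huR).
  by rewrite mul0mx scaler0 addr0 /Xt mulmxBr scalerBr.
have sF : smooth L (favg f) by exact: smooth_favg.
have h := smooth_descent xbar v L0 sF lb0 lbL.
have E : v - lb *: gF = n%:R^-1 *: (uR^T *m (Lam *m (Pi_C uC *m Y))) +
    lb *: (ybar - gF).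
  rewrite /v {1}(PiC_decomp (uC := uC) Y) -/ybar !mulmxDr scalerDr scalerBr addrA.
  congr (_ + _ - _); rewrite !mulmxA.
  rewrite (mx11_scalar (uR^T *m Lam *m uC)) mul_scalar_mx scalerA.
  by rewrite lbE.
have h2 : sqn (v - lb *: gF) <=
    2 * (n%:R^-1 ^+ 2 * (fnorm uR ^+ 2 * (l ^+ 2 * sqn (Ct *m (Pi_C uC *m Y))))) +
    2 * (lb ^+ 2 * (L ^+ 2 / n%:R * sqn (Rt *m (Pi_R uR *m X)))).
  rewrite E; apply: le_trans (sqnD2 _ _) _; rewrite !sqnZ; apply: lerD.
    rewrite ler_pM2l// ler_wpM2l ?sqr_ge0// sqr_fnorm -(sqn_tr uR).
    apply: le_trans (sqn_mulmx _ _) _; rewrite ler_wpM2l ?sqn_ge0//.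
    apply: le_trans (sqn_diag _ lam_l) _; rewrite ler_wpM2l ?sqr_ge0//.
    exact: (sqn_le_adapted anC).
  by rewrite ler_pM2l// ler_wpM2l ?sqr_ge0.
have i0 : 0 <= (2 * lb)^-1 by rewrite invr_ge0 mulr_ge0 ?ltW.
have {}h2 := ler_wpM2l i0 h2.
rewrite -/gF in h.
have E2 : (2 * lb)^-1 *
   (2 * (n%:R^-1 ^+ 2 * (fnorm uR ^+ 2 * (l ^+ 2 * sqn (Ct *m (Pi_C uC *m Y))))) +
    2 * (lb ^+ 2 * (L ^+ 2 / n%:R * sqn (Rt *m (Pi_R uR *m X))))) =
  lb * L ^+ 2 / n%:R * sqn (Rt *m (Pi_R uR *m X)) +
  fnorm uR ^+ 2 * l ^+ 2 / (n%:R ^+ 2 * lb) * sqn (Ct *m (Pi_C uC *m Y)).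
  by field; rewrite !gt_eqF.
rewrite E2 in h2; lra.
Qed.

(** The ones vector annihilates [I - C] on the left, so the compression error never disturbs the
    tracked sum of gradients. *)
Lemma step_sumY : (const_mx 1 : 'rV[K]_n) *m Y' = const_mx 1 *m gradF f X'.
Proof.
have E : (const_mx 1 : 'rV[K]_n) *m relaxed C gy = const_mx 1.
  by rewrite /relaxed mulmxBr mulmx1 -scalemxAr (ones_IC C1) scaler0 subr0.
rewrite Y'E mulmxDr -scalemxAr !mulmxA (ones_IC C1) mul0mx scaler0 addr0 E.
by rewrite /Yt mulmxBr mulmxDr sumY addrAC subrr add0r.
Qed.

End PointwiseStep.

(** * Expected compression errors *)

Section NonnegExpectation.
Context {K : realType} {d : measure_display} {T : measurableType d}
  (P : probability T K).
Implicit Types h e b : T -> K.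

(** The integral behind ['E_P], used on nonnegative integrands only; finiteness comes out of the
    final rate. *)
Definition Ex h : \bar K := (\int[P]_w (h w)%:E)%E.

Lemma Ex_ge0 h : (forall w, 0 <= h w) -> (0 <= Ex h)%E.
Proof. by move=> h0; apply: integral_ge0 => w _; rewrite lee_fin. Qed.

Lemma Ex_le h1 h2 : measurable_fun [set: T] h1 -> measurable_fun [set: T] h2 ->
  (forall w, 0 <= h1 w) -> (forall w, h1 w <= h2 w) -> (Ex h1 <= Ex h2)%E.
Proof.
move=> m1 m2 h0 h12; apply: ge0_le_integral => //.
- by move=> w _; rewrite lee_fin.
- exact/measurable_EFinP.
- exact/measurable_EFinP.
- by move=> w _; rewrite lee_fin.
Qed.

Lemma ExD h1 h2 : measurable_fun [set: T] h1 -> measurable_fun [set: T] h2 ->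
  (forall w, 0 <= h1 w) -> (forall w, 0 <= h2 w) ->
  Ex (fun w => h1 w + h2 w) = (Ex h1 + Ex h2)%E.
Proof.
move=> m1 m2 h10 h20; rewrite /Ex; under eq_integral do rewrite EFinD.
apply: ge0_integralD => //.
- by move=> w _; rewrite lee_fin.
- exact/measurable_EFinP.
- by move=> w _; rewrite lee_fin.
- exact/measurable_EFinP.
Qed.

Lemma ExZ (k : K) h : measurable_fun [set: T] h -> 0 <= k ->
  (forall w, 0 <= h w) -> Ex (fun w => k * h w) = (k%:E * Ex h)%E.
Proof.
move=> mh k0 h0; rewrite /Ex; under eq_integral do rewrite EFinM.
apply: ge0_integralZl_EFin => //.
- by move=> w _; rewrite lee_fin.
- exact/measurable_EFinP.
Qed.

Lemma Ex_cst (k : K) : Ex (fun=> k) = k%:E.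
Proof.
rewrite /Ex integral_cst// -[RHS]mule1; congr (_ * _)%E.
exact: probability_setT.
Qed.

Lemma Ex_sum n (h : 'I_n -> T -> K) :
  (forall i, measurable_fun [set: T] (h i)) -> (forall i w, 0 <= h i w) ->
  Ex (fun w => \sum_i h i w) = (\sum_i Ex (h i))%E.
Proof.
move=> mh h0; rewrite /Ex; under eq_integral do rewrite -sumEFin.
apply: ge0_integral_sum => //.
- by move=> i; exact/measurable_EFinP.
- by move=> i w _; rewrite lee_fin.
Qed.

Lemma measurable_combine (k1 k2 : K) h e1 e2 :
  measurable_fun [set: T] h ->
  measurable_fun [set: T] e1 -> measurable_fun [set: T] e2 ->
  measurable_fun [set: T] (fun w => h w + k1 * e1 w + k2 * e2 w).
Proof.
move=> mh me1 me2; apply: measurable_funD; last exact: measurable_funM.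
by apply: measurable_funD => //; exact: measurable_funM.
Qed.

(** The quantization errors [e1], [e2] are comparable with [b1], [b2] in expectation only, not at
    each outcome. *)
Lemma Ex_combine (k1 k2 : K) h e1 e2 b1 b2 :
  measurable_fun [set: T] h ->
  measurable_fun [set: T] e1 -> measurable_fun [set: T] e2 ->
  measurable_fun [set: T] b1 -> measurable_fun [set: T] b2 ->
  0 <= k1 -> 0 <= k2 ->
  (forall w, 0 <= h w) -> (forall w, 0 <= e1 w) -> (forall w, 0 <= e2 w) ->
  (forall w, 0 <= b1 w) -> (forall w, 0 <= b2 w) ->
  (Ex e1 <= Ex b1)%E -> (Ex e2 <= Ex b2)%E ->
  (Ex (fun w => h w + k1 * e1 w + k2 * e2 w)%R <=
   Ex (fun w => h w + k1 * b1 w + k2 * b2 w)%R)%E.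
Proof.
move=> mh me1 me2 mb1 mb2 k10 k20 h0 e10 e20 b10 b20 eb1 eb2.
have mk k (g : T -> K) : measurable_fun [set: T] g ->
    measurable_fun [set: T] (fun w => k * g w).
  by move=> mg; exact: measurable_funM.
rewrite !ExD ?ExZ//; try (by move=> w; rewrite ?addr_ge0 ?mulr_ge0);
  try exact: mk; try (by apply: measurable_funD => //; exact: mk).
by apply: leeD; [apply: leeD => //|]; apply: lee_wpmul2l => //; rewrite lee_fin.
Qed.

End NonnegExpectation.

(** * Measurability of quantized matrices and of gradients *)

Section CompressionMeasurable.
Context {K : realType} {n p : nat} {d' : measure_display}
  {Z : measurableType d'} {comp : Z -> 'rV[K]_p -> 'rV[K]_p}.
Hypothesis mcomp : forall j, measurable_fun [set: Z * p.-tuple K]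
  (fun zt => comp zt.1 (\row_i tnth zt.2 i) 0 j).

Definition quant (s : K) (z : 'I_n -> Z) (D : 'M[K]_(n, p)) : 'M[K]_(n, p) :=
  s *: rowwise (fun i => comp (z i)) (s^-1 *: D).

Lemma mxmeas_quant d (T : measurableType d) (s : K) (z : 'I_n -> T -> Z)
    (D : T -> 'M[K]_(n, p)) :
  (forall i, measurable_fun [set: T] (z i)) -> mxmeas D ->
  mxmeas (fun w => quant s (fun i => z i w) (D w)).
Proof.
move=> mz mD; apply: mxmeasZ => i j; under eq_fun do rewrite mxE.
apply: (measurable_comp_tuple (g := fun z x => comp z x 0 j)) => //.
by apply: mxmeas_row; exact: mxmeasZ.
Qed.

Lemma row_quant s z (D : 'M[K]_(n, p)) i :
  row i (quant s z D) = s *: comp (z i) (s^-1 *: row i D).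
Proof. by apply/rowP => j; rewrite !mxE linearZ. Qed.

End CompressionMeasurable.

Arguments quant {K n p d' Z} comp s z D.

Section GradientMeasurable.
Context {K : realType} {n p : nat} {f : 'I_n -> 'rV[K]_p -> K} {L : K}.
Hypotheses (L0 : 0 <= L) (sf : forall i, smooth L (f i)).

Lemma grad_continuous (g : 'rV[K]_p -> K) j : smooth L g ->
  continuous (fun x => grad g x 0 j).
Proof.
move=> [_ lip] x; apply/(@cvgrPdist_lt _ _ _ (nbhs x) (nbhs_filter x)) => e e0.
(* [p + 1] and [L + 1] keep the radius defined when [p] or [L] is 0, and [L / (L + 1) < 1] makes the
   last inequality strict. *)
pose q : K := p.+1%:R.
have q1 : 1 <= q by rewrite ler1n.
have L1 : 0 < L + 1 by rewrite ltr_wpDl.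
pose del := e / ((L + 1) * q).
have del0 : 0 < del by rewrite divr_gt0// mulr_gt0// (lt_le_trans ltr01).
near=> y.
have xy : forall i, `|x 0 i - y 0 i| < del.
  move=> i; have [_ h] : ball x del y by near: y; exact: nbhsx_ballx.
  exact: h.
rewrite -(@ltr_pXn2r _ 2)// ?nnegrE ?normr_ge0 ?(ltW e0)//.
rewrite real_normK ?num_real//.
have h1 : (grad g x 0 j - grad g y 0 j) ^+ 2 <= L ^+ 2 * sqn (x - y).
  apply: le_trans (lip x y); have := sqn_entry (grad g x - grad g y) 0 j.
  by rewrite !mxE.
have h2 : sqn (x - y) <= p%:R * del ^+ 2.
  apply: (@le_trans _ _ (\sum_(i < p) del ^+ 2)); last first.
    by rewrite sumr_const card_ord mulr_natl.
  rewrite sqn_rV; apply: ler_sum => i _; rewrite !mxE -real_normK ?num_real//.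
  by rewrite ler_sqr_ge0// ltW.
apply: le_lt_trans h1 _.
apply: (@le_lt_trans _ _ (L ^+ 2 * (q ^+ 2 * del ^+ 2))).
  rewrite ler_wpM2l ?sqr_ge0//; apply: le_trans h2 _.
  rewrite ler_wpM2r ?sqr_ge0//; apply: (@le_trans _ _ q).
    by rewrite /q ler_nat.
  by rewrite expr2 ler_peMl// (le_trans ler01).
have -> : L ^+ 2 * (q ^+ 2 * del ^+ 2) = (L / (L + 1)) ^+ 2 * e ^+ 2.
  by rewrite /del; field; rewrite !gt_eqF// (lt_le_trans ltr01).
rewrite gtr_pMl ?exprn_gt0// expr_lt1// ?divr_ge0 ?(ltW L1)//.
by rewrite ltr_pdivrMr// mul1r ltrDl.
Unshelve. all: by end_near.
Qed.

Lemma mxmeas_gradF d (T : measurableType d) (X : T -> 'M[K]_(n, p)) :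
  mxmeas X -> mxmeas (fun w => gradF f (X w)).
Proof.
move=> mX i j; under eq_fun do rewrite mxE.
exact: (measurable_continuous_row (mxmeas_row i mX) (grad_continuous (sf i))).
Qed.

Lemma mxmeas_grad_favg d (T : measurableType d) (x : T -> 'rV[K]_p) :
  (0 < n)%N -> mxmeas x -> mxmeas (fun w => grad (favg f) (x w)).
Proof.
move=> n_gt0 mx i j; rewrite ord1.
exact: (measurable_continuous_row mx (grad_continuous (smooth_favg n_gt0 sf))).
Qed.

Lemma measurable_favg d (T : measurableType d) (x : T -> 'rV[K]_p) :
  (0 < n)%N -> mxmeas x -> measurable_fun [set: T] (fun w => favg f (x w)).
Proof.
move=> n_gt0 mx; apply: (measurable_continuous_row mx) => y.
by apply: differentiable_continuous; have [] := smooth_favg n_gt0 sf.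
Qed.

End GradientMeasurable.

Section Quantization.
Context {K : realType} {n p : nat} {d d' : measure_display}
  {Omega : measurableType d} {P : probability Omega K}
  {Z : measurableType d'} {nu : probability Z K}
  {comp : Z -> 'rV[K]_p -> 'rV[K]_p} {zeta : nat -> 'I_n -> Omega -> Z}.
Hypotheses (hzeta : fresh_seeds P nu zeta)
  (mcomp : forall j, measurable_fun [set: Z * p.-tuple K]
    (fun zt => comp zt.1 (\row_i tnth zt.2 i) 0 j)).

Notation past t := (g_sigma_algebraType (seed_events zeta t)).

(** Taking [u = 1] or [u = r^-1] covers both compression bounds. The squared norm is additive over
    rows, so only the law of each single seed enters; rescaling by [s] turns the noise [sb] of a row
    into [s ^+ 2 * sb]. *)
Lemma quant_integral_le t (s u cb sb : K) (D : Omega -> 'M[K]_(n, p)) :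
  0 < s -> 0 <= cb -> 0 <= sb -> @mxmeas _ _ (past t) _ _ D ->
  (forall x, (Ex nu (fun z => sqn (u *: comp z x - x)) <=
    (cb * sqn x + sb)%:E)%E) ->
  (Ex P (fun w => sqn (D w - u *: quant comp s (fun i => zeta t i w) (D w))) <=
   Ex P (fun w => cb * sqn (D w) + n%:R * s ^+ 2 * sb)%R)%E.
Proof.
move=> s0 cb0 sb0 mD hE.
pose x i w := s^-1 *: row i (D w).
have mx i : @mxmeas _ _ (past t) _ _ (x i) by apply: mxmeasZ; exact: mxmeas_row.
have mx' i : mxmeas (x i) by apply: (mxmeas_past hzeta); exact: mx.
pose g z (y : 'rV[K]_p) := s ^+ 2 * sqn (u *: comp z y - y).
pose bd (y : 'rV[K]_p) := s ^+ 2 * (cb * sqn y + sb).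
have rowE i w : row i (D w) = s *: x i w.
  by rewrite /x scalerA mulfV ?gt_eqF// scale1r.
have mrow : mxmeas (fun zt : Z * p.-tuple K => \row_i tnth zt.2 i : 'rV[K]_p).
  move=> a j; under eq_fun do rewrite mxE.
  by apply: (measurableT_comp (measurable_tnth j)); exact: measurable_snd.
have mg : measurable_fun [set: Z * p.-tuple K]
    (fun zt => g zt.1 (\row_i tnth zt.2 i)).
  apply: measurable_funM; first exact: measurable_cst.
  apply: measurable_sqn; apply: mxmeasB => //; apply: mxmeasZ => a j.
  by rewrite ord1; exact: mcomp.
have mrow' : mxmeas (fun q : p.-tuple K => \row_i tnth q i : 'rV[K]_p).
  by move=> a j; under eq_fun do rewrite mxE; exact: measurable_tnth.
have mbd : measurable_fun [set: p.-tuple K] (fun q => bd (\row_i tnth q i)).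
  apply: measurable_funM; first exact: measurable_cst.
  apply: measurable_funD; last exact: measurable_cst.
  by apply: measurable_funM; [exact: measurable_cst|exact: measurable_sqn].
have -> : Ex P (fun w => sqn (D w - u *: quant comp s (fun i => zeta t i w) (D w)))
    = Ex P (fun w => \sum_i g (zeta t i w) (x i w)).
  rewrite /Ex; apply: eq_integral => w _; congr (_%:E).
  rewrite sqn_row; apply: eq_bigr => i _; rewrite linearB/= linearZ/= row_quant.
  rewrite -/(x i w) rowE /g -sqnZ scalerA mulrC -scalerA -scalerBr -sqnN.
  by rewrite -scalerN opprB.
have -> : Ex P (fun w => cb * sqn (D w) + n%:R * s ^+ 2 * sb)%R =
    Ex P (fun w => \sum_i bd (x i w)).
  rewrite /Ex; apply: eq_integral => w _; congr (_%:E).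
  rewrite /bd -mulr_sumr big_split/= sumr_const card_ord -mulr_sumr.
  rewrite sqn_row; under eq_bigr do rewrite rowE sqnZ.
  by rewrite -mulr_sumr -[sb *+ n]mulr_natl; ring.
have bd0 y : 0 <= bd y.
  by rewrite /bd mulr_ge0 ?sqr_ge0// addr_ge0// mulr_ge0 ?sqn_ge0.
have g0 z y : 0 <= g z y by rewrite /g mulr_ge0 ?sqr_ge0 ?sqn_ge0.
have m1 i : measurable_fun setT (fun w => g (zeta t i w) (x i w)).
  apply: (measurable_comp_tuple (g := g) mg) => //.
  exact: (seed_measurable hzeta).
have m2 i : measurable_fun setT (fun w => bd (x i w)).
  apply: measurable_funM; first exact: measurable_cst.
  apply: measurable_funD; last exact: measurable_cst.
  by apply: measurable_funM; [exact: measurable_cst|exact: measurable_sqn].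
rewrite (Ex_sum _ m1) ?(Ex_sum _ m2)//.
apply: lee_sum => i _.
apply: (fresh_integral_le hzeta i (mx i) mg mbd g0) => y.
have mz : measurable_fun [set: Z] (fun z => sqn (u *: comp z y - y)).
  apply: measurable_sqn; apply: mxmeasB; last exact: mxmeas_cst.
  apply: mxmeasZ => a j; rewrite ord1.
  exact: (measurable_comp_tuple (g := fun z x => comp z x 0 j) (mcomp j)
    (@measurable_id _ _ _) (mxmeas_cst y)).
rewrite -[leLHS]/(Ex nu (fun z => s ^+ 2 * sqn (u *: comp z y - y))%R).
rewrite ExZ ?sqr_ge0//; last by move=> z; exact: sqn_ge0.
by rewrite /bd [leRHS]EFinM; apply: lee_wpmul2l => //; rewrite lee_fin sqr_ge0.
Qed.

End Quantization.

(** * Recursion for the expected potential *)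

Ltac measure := repeat first [assumption | exact: measurable_cst
  | apply: measurable_sqn | apply: measurable_funB | apply: measurable_funD
  | apply: measurable_funM].

Section Recursion.
Context {K : realType} {n p : nat} {R C : 'M[K]_n} {uR uC : 'cV[K]_n}
  {Rt Ct : 'M[K]_n} {thR thC dR dC : K} {f : 'I_n -> 'rV[K]_p -> K}
  {xs : 'rV[K]_p} {mu L : K} {d d' : measure_display}
  {Omega : measurableType d} {P : probability Omega K}
  {Z : measurableType d'} {nu : probability Z K}
  {comp : Z -> 'rV[K]_p -> 'rV[K]_p} {Cs sigma2 r delta sigmar2 : K}
  {zeta : nat -> 'I_n -> Omega -> Z} {lam : 'rV[K]_n}
  {l lb alx aly gx gy M rho : K} {s : nat -> K} {X0 : 'M[K]_(n, p)}.

Local Notation N := (opnorm Rt (1%:M - R)).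
Local Notation S := (opnorm Ct (1%:M - C)).
Local Notation Lam := (diag_mx lam).

Hypotheses (n_gt0 : (0 < n)%N) (huR : left_eigvec R uR)
  (huC : right_eigvec C uC)
  (R1 : R *m const_mx 1 = const_mx 1 :> 'cV[K]_n)
  (C1 : const_mx 1 *m C = const_mx 1 :> 'rV[K]_n)
  (anR : adapted_norm (Pi_R uR) R Rt thR dR)
  (anC : adapted_norm (Pi_C uC) C Ct thC dC)
  (hmin : forall x, favg f xs <= favg f x)
  (hPL : forall x, 2 * mu * (favg f x - favg f xs) <= sqn (grad (favg f) x))
  (L0 : 0 <= L) (sf : forall i, smooth L (f i))
  (hQ : compression_assumption nu comp Cs sigma2 r delta sigmar2)
  (hzeta : fresh_seeds P nu zeta)
  (lam_l : forall i, 0 <= lam 0 i <= l)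
  (lbE : lb = n%:R^-1 * (uR^T *m Lam *m uC) 0 0) (lbL : lb * L <= 1)
  (alx0 : 0 < alx) (aly0 : 0 < aly) (a_lt1 : thR * gx < 1) (b_lt1 : thC * gy < 1)
  (s0 : forall k, 0 < s k)
  (sc : stepsize_conditions n%:R (fnorm uR) (fnorm uC) L l M lb thR thC gx gy
    N S dR dC (1 + gx * N) Cs (alx * r) (aly * r) delta)
  (rho_o : 1 - 2^-1 * lb * mu <= rho) (rho_c : 1 - thR * gx / 16 <= rho)
  (rho_g : 1 - thC * gy / 8 <= rho) (rho_x : 1 - alx * r * delta / 4 <= rho)
  (rho_y : 1 - aly * r * delta / 16 <= rho).

Notation past t := (g_sigma_algebraType (seed_events zeta t)).
Notation state := (rcpp_state K n p).

Let lb0 : 0 < lb.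
Proof.
by apply: lt_le_trans (sc_lb sc); rewrite mulr_gt0 ?(sc_M sc) ?(sc_l sc).
Qed.
Let gx0 := sc_gx sc. Let gx1 := sc_gx1 sc.
Let gy0 := sc_gy sc. Let gy1 := sc_gy1 sc.
Let r0 : 0 < r := cmp_r_gt0 hQ.
Let delta0 : 0 < delta := cmp_delta_gt0 hQ.
Let delta1 : delta <= 1 := cmp_delta_le1 hQ.

Definition innovX (st : state) := st_X st - Lam *m st_Y st - st_Hx st.
Definition nextX (st : state) (Qx : 'M[K]_(n, p)) :=
  st_X st - Lam *m st_Y st - gx *: (st_Hx st + Qx - (st_HR st + R *m Qx)).
Definition trackY (st : state) (Qx : 'M[K]_(n, p)) :=
  st_Y st + gradF f (nextX st Qx) - gradF f (st_X st).
Definition innovY (st : state) (Qx : 'M[K]_(n, p)) := trackY st Qx - st_Hy st.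
Definition next (st : state) (Qx Qy : 'M[K]_(n, p)) : state :=
  RCPPState (nextX st Qx)
    (trackY st Qx - gy *: (st_Hy st + Qy - (st_HC st + C *m Qy)))
    ((1 - alx) *: st_Hx st + alx *: (st_Hx st + Qx))
    ((1 - alx) *: st_HR st + alx *: (st_HR st + R *m Qx))
    ((1 - aly) *: st_Hy st + aly *: (st_Hy st + Qy))
    ((1 - aly) *: st_HC st + aly *: (st_HC st + C *m Qy)).

Let st k w : state := rcpp f R C Lam alx aly gx gy s X0 comp
  (fun t i => zeta t i w) k.
Let Qx k w := quant comp (s k) (fun i => zeta k.*2 i w) (innovX (st k w)).
Let Qy k w := quant comp (s k) (fun i => zeta k.*2.+1 i w)
  (innovY (st k w) (Qx k w)).

Lemma st_next k w : st k.+1 w = next (st k w) (Qx k w) (Qy k w).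
Proof.
by rewrite {1}/st /= -/(st k w) /Qy /Qx; case: (st k w).
Qed.

(** [HR] and [HC] follow the same linear updates as [Hx] and [Hy], so they remain their exact
    images; this is what makes [relaxed_mixing] applicable. *)
Definition invariant (S : state) := [/\ st_HR S = R *m st_Hx S,
  st_HC S = C *m st_Hy S &
  (const_mx 1 : 'rV[K]_n) *m st_Y S = const_mx 1 *m gradF f (st_X S)].

Lemma invariant_next S Q1 Q2 : invariant S -> invariant (next S Q1 Q2).
Proof.
move=> [h1 h2 h3]; split => /=.
- by rewrite h1 -mulmxDr !scalemxAr -mulmxDr.
- by rewrite h2 -mulmxDr !scalemxAr -mulmxDr.
- exact: (step_sumY C1 h2 h3).
Qed.

Lemma invariant_st k w : invariant (st k w).
Proof.
elim: k => [|k IH]; first by split; rewrite /= ?mulmx0.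
by rewrite st_next; exact: invariant_next.
Qed.

Let o_ (S : state) := favg f (n%:R^-1 *: (uR^T *m st_X S)) - favg f xs.
Let G_ (S : state) := sqn (grad (favg f) (n%:R^-1 *: (uR^T *m st_X S))).
Let c_ (S : state) := sqn (Rt *m (Pi_R uR *m st_X S)).
Let g_ (S : state) := sqn (Ct *m (Pi_C uC *m st_Y S)).
Let x_ (S : state) := sqn (innovX S).
Let y_ (S : state) := sqn (st_Y S - st_Hy S).

Let Wc := wc n%:R (fnorm uR) (fnorm uC) L l thR gx.
Let Wg := wg n%:R (fnorm uR) l M thC gy.
Let Wx := wx n%:R (fnorm uR) (fnorm uC) L l gx N (alx * r) delta.
Let Wy := wy n%:R (fnorm uR) l M gy S (aly * r) delta.
Let KE := kE n%:R (fnorm uR) (fnorm uC) L l M thC gx gy N S dC (alx * r)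
  (aly * r) delta.
Let KR := kR n%:R (fnorm uR) l M gy S (aly * r) delta.
Let ME := mE n%:R (fnorm uR) (fnorm uC) L l M thR thC gx gy N S dR dC Cs
  (alx * r) (aly * r) delta.
Let MR := mR n%:R (fnorm uR) (fnorm uC) L l gx N (alx * r) delta.
Let PY := preY n%:R (fnorm uR) (fnorm uC) L l M lb thR thC gx gy N S dR dC
  (alx * r) (aly * r) delta.
Let PX := preX n%:R (fnorm uR) (fnorm uC) L l M lb thR thC gx gy N S dR dC
  (1 + gx * N) Cs (alx * r) (aly * r) delta.

Definition potential (S : state) :=
  o_ S + Wc * c_ S + Wg * g_ S + Wx * x_ S + Wy * y_ S.

Let gap (S : state) : 0 <= o_ S - lb / 2 * G_ S.
Proof.
by apply: (smooth_gap _ L0 (smooth_favg n_gt0 sf)).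
Qed.

Let o_ge0 (S : state) : 0 <= o_ S. Proof. by rewrite subr_ge0. Qed.

Let parts_ge0 S : [/\ 0 <= Wc * c_ S, 0 <= Wg * g_ S, 0 <= Wx * x_ S &
  0 <= Wy * y_ S].
Proof.
have hc := wc_gt0 sc; have hg := wg_gt0 sc.
have hx := wx_gt0 sc; have hy := wy_gt0 sc.
by split; apply: mulr_ge0; rewrite ?sqn_ge0// ltW.
Qed.

Lemma potential_ge0 S : 0 <= potential S.
Proof.
have [h1 h2 h3 h4] := parts_ge0 S; have := o_ge0 S.
by rewrite /potential; lra.
Qed.

Let hY1 (S : state) Q := PY (o_ S - lb / 2 * G_ S) (c_ S) (g_ S) (x_ S)
  (sqn (innovY S Q)) (sqn (nextX S Q - st_X S)) (sqn (st_Y S))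
  (sqn (innovX S - Q)) (sqn (innovX S - r^-1 *: Q)).

Let hX1 (S : state) := PX (o_ S - lb / 2 * G_ S) (c_ S) (g_ S) (x_ S) (y_ S)
  (sqn (st_Y S)).

Let potential_next S Q1 Q2 : invariant S -> potential (next S Q1 Q2) <=
  hY1 S Q1 + KE * sqn (innovY S Q1 - Q2) +
  KR * sqn (innovY S Q1 - r^-1 *: Q2).
Proof.
move=> [h1 h2 h3].
have := lyapunov_preY sc
  (step_objective n_gt0 huR anR anC L0 sf lam_l lbE lb0 lbL h1 h3 xs)
  (step_consensus n_gt0 huR R1 anR lam_l gx0 gx1 a_lt1 h1)
  (step_tracking n_gt0 huC C1 anC sf gy0 gy1 b_lt1 h2)
  (step_innovation_x (R := R) (C := C) (f := f) lam_l r0 alx0 (sc_alr1 sc) delta0 delta1 erefl)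
  (step_dY n_gt0 huC anC sf gy0 h2)
  (step_innovation_y n_gt0 huC anC sf h2 r0 aly0 (sc_blr1 sc) delta0 delta1 erefl).
exact.
Qed.

Let hY1_hX1 S Q : invariant S ->
  hY1 S Q + (KE * Cs + KR * (1 - delta)) * sqn (innovY S Q) <=
  hX1 S + ME * sqn (innovX S - Q) + MR * sqn (innovX S - r^-1 *: Q).
Proof.
move=> [h1 _ _].
have ay0 : 0 < aly * r * delta by rewrite !mulr_gt0.
have ay1 : aly * r * delta <= 1.
  by rewrite mulr_ile1 ?(sc_blr1 sc)// ltW// mulr_gt0.
have [y1 y2] := innovation_y_bounds (Y := st_Y S) (Hy := st_Hy S)
  (X := st_X S) (Hx := st_Hx S) (HR := st_HR S) (Qx := Q) (R := R)
  (lam := lam) (gx := gx) sf ay0 ay1.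
exact: (preY_preX sc _ _ _ _ y1 y2 (step_move n_gt0 R1 anR lam_l gx0 h1)).
Qed.

Let hX1_le S : invariant S ->
  hX1 S + (ME * Cs + MR * (1 - delta)) * x_ S <= rho * potential S.
Proof.
move=> [_ _ h3].
exact: (preX_contract sc (o_ge0 S) (sqn_ge0 _) (sqn_ge0 _) (sqn_ge0 _)
  (sqn_ge0 _) (sqn_ge0 _) (hPL _) (sqn_Y_le anR anC sf h3)
  rho_o rho_c rho_g rho_x rho_y).
Qed.

Definition mxmeas_state {dT} {T : measurableType dT} (S : T -> state) :=
  [/\ mxmeas (fun w => st_X (S w)), mxmeas (fun w => st_Y (S w)) &
     mxmeas (fun w => st_Hx (S w))] /\
  [/\ mxmeas (fun w => st_HR (S w)), mxmeas (fun w => st_Hy (S w)) &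
     mxmeas (fun w => st_HC (S w))].

Section Measurability.
Context {dT} {T : measurableType dT} {S : T -> state}
  {Q1 Q2 : T -> 'M[K]_(n, p)}.
Hypotheses (mS : mxmeas_state S) (mQ1 : mxmeas Q1) (mQ2 : mxmeas Q2).

Lemma mxmeas_innovX : mxmeas (fun w => innovX (S w)).
Proof.
move: mS => [[mX mY mHx] _]; apply: mxmeasB => //.
by apply: mxmeasB => //; exact: mxmeas_mull.
Qed.

Lemma mxmeas_nextX : mxmeas (fun w => nextX (S w) (Q1 w)).
Proof.
move: mS => [[mX mY mHx] [mHR _ _]]; apply: mxmeasB.
  by apply: mxmeasB => //; exact: mxmeas_mull.
apply: mxmeasZ; apply: mxmeasB; apply: mxmeasD => //.
exact: mxmeas_mull.
Qed.

Lemma mxmeas_trackY : mxmeas (fun w => trackY (S w) (Q1 w)).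
Proof.
move: mS => [[mX mY mHx] _]; apply: mxmeasB; first apply: mxmeasD => //.
  by apply: (mxmeas_gradF L0 sf); exact: mxmeas_nextX.
exact: (mxmeas_gradF L0 sf).
Qed.

Lemma mxmeas_innovY : mxmeas (fun w => innovY (S w) (Q1 w)).
Proof.
by move: mS => [_ [_ mHy _]]; apply: mxmeasB => //; exact: mxmeas_trackY.
Qed.

Lemma mxmeas_next : mxmeas_state (fun w => next (S w) (Q1 w) (Q2 w)).
Proof.
have mX' := mxmeas_nextX; have mY' := mxmeas_trackY.
move: mS => [[mX mY mHx] [mHR mHy mHC]]; split; split => //=.
- apply: mxmeasB => //; apply: mxmeasZ; apply: mxmeasB; apply: mxmeasD => //.
  exact: mxmeas_mull.
- by apply: mxmeasD; apply: mxmeasZ => //; exact: mxmeasD.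
- apply: mxmeasD; apply: mxmeasZ => //; apply: mxmeasD => //.
  exact: mxmeas_mull.
- by apply: mxmeasD; apply: mxmeasZ => //; exact: mxmeasD.
- apply: mxmeasD; apply: mxmeasZ => //; apply: mxmeasD => //.
  exact: mxmeas_mull.
Qed.

Let mxbar : mxmeas (fun w => n%:R^-1 *: (uR^T *m st_X (S w))).
Proof.
by move: mS => [[mX _ _] _]; apply: mxmeasZ; exact: mxmeas_mull.
Qed.

Lemma measurable_o : measurable_fun [set: T] (fun w => o_ (S w)).
Proof.
apply: measurable_funB; last exact: measurable_cst.
exact: (measurable_favg sf n_gt0 mxbar).
Qed.

Lemma measurable_c : measurable_fun [set: T] (fun w => c_ (S w)).
Proof.
move: mS => [[mX _ _] _]; apply: measurable_sqn.
by apply: mxmeas_mull; exact: mxmeas_mull.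
Qed.

Let mG : measurable_fun [set: T] (fun w => G_ (S w)).
Proof. by apply: measurable_sqn; exact: (mxmeas_grad_favg L0 sf n_gt0 mxbar). Qed.

Let mg : measurable_fun [set: T] (fun w => g_ (S w)).
Proof.
move: mS => [[_ mY _] _]; apply: measurable_sqn.
by apply: mxmeas_mull; exact: mxmeas_mull.
Qed.

Let mx : measurable_fun [set: T] (fun w => x_ (S w)).
Proof. by apply: measurable_sqn; exact: mxmeas_innovX. Qed.

Let my : measurable_fun [set: T] (fun w => y_ (S w)).
Proof.
by move: mS => [[_ mY _] [_ mHy _]]; apply: measurable_sqn; exact: mxmeasB.
Qed.

Let mYn : measurable_fun [set: T] (fun w => sqn (st_Y (S w))).
Proof. by move: mS => [[_ mY _] _]; exact: measurable_sqn. Qed.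

Let mo := measurable_o. Let mc := measurable_c.

Lemma measurable_potential : measurable_fun [set: T] (fun w => potential (S w)).
Proof. by rewrite /potential; measure. Qed.

Lemma measurable_hX1 : measurable_fun [set: T] (fun w => hX1 (S w)).
Proof. by rewrite /hX1 /PX /preX; measure. Qed.

Lemma measurable_hY1 : measurable_fun [set: T] (fun w => hY1 (S w) (Q1 w)).
Proof.
have m1 := mxmeas_innovX; have m2 := mxmeas_innovY; have m3 := mxmeas_nextX.
have [[mX _ _] _] := mS.
have m4 := measurable_sqn m2.
have m5 := measurable_sqn (mxmeasB m3 mX).
have m6 := measurable_sqn (mxmeasB m1 mQ1).
have m7 := measurable_sqn (mxmeasB m1 (mxmeasZ r^-1 mQ1)).
by rewrite /hY1 /PY /preY; measure.
Qed.

End Measurability.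

Let mseed t t' : (t' < t)%N -> forall i,
  @measurable_fun _ _ (past t) Z setT (zeta t' i).
Proof. by move=> lt i; exact: measurable_seed. Qed.

Let mxmeas_state_le t1 t2 (S : Omega -> state) : (t1 <= t2)%N ->
  @mxmeas_state _ (past t1) S -> @mxmeas_state _ (past t2) S.
Proof.
by move=> t12 [[m1 m2 m3] [m4 m5 m6]];
  split; split; apply: (mxmeas_past_le t12).
Qed.

(** State [k] depends on the rounds below [2k]. [Q_x] reads round [2k] and [Q_y] round [2k + 1], so
    each compressed matrix is known strictly before its own round. *)
Lemma adapted_innovations k : @mxmeas_state _ (past k.*2) (st k) ->
  @mxmeas _ _ (past k.*2.+1) _ _ (Qx k) /\
  @mxmeas _ _ (past k.+1.*2) _ _ (Qy k).
Proof.
move=> mS.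
have mQx : @mxmeas _ _ (past k.*2.+1) _ _ (Qx k).
  apply: (mxmeas_quant (cmp_measurable hQ)); first exact: mseed.
  by apply: mxmeas_innovX; apply: mxmeas_state_le mS.
split=> //; apply: (mxmeas_quant (cmp_measurable hQ)).
  by apply: mseed; rewrite doubleS.
apply: mxmeas_innovY; first by apply: mxmeas_state_le mS; rewrite doubleS 2?leqW.
by apply: mxmeas_past_le mQx; rewrite doubleS.
Qed.

Lemma adapted_st k : @mxmeas_state _ (past k.*2) (st k).
Proof.
elim: k => [|k IH].
  by split; split; move=> i j; exact: measurable_cst.
have [mQx mQy] := adapted_innovations IH.
rewrite (_ : st k.+1 = fun w => next (st k w) (Qx k w) (Qy k w)); last first.
  by apply/funext => w; exact: st_next.
apply: mxmeas_next => //; last by apply: mxmeas_past_le mQx; rewrite doubleS.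
by apply: mxmeas_state_le IH; rewrite doubleS 2?leqW.
Qed.

Lemma measurable_st k : mxmeas_state (st k).
Proof.
have [[m1 m2 m3] [m4 m5 m6]] := adapted_st k.
by split; split; apply: (mxmeas_past hzeta).
Qed.

Let compression_error x : (Ex nu (fun z => sqn (1 *: comp z x - x)) <=
  (Cs * sqn x + sigma2)%:E)%E.
Proof.
have := cmp_error hQ x; rewrite sqr_fnorm unlock => /(le_trans _); apply.
rewrite le_eqVlt; apply/orP; left; apply/eqP; apply: eq_integral => z _.
by rewrite scale1r sqr_fnorm.
Qed.

Let compression_scaled_error x : (Ex nu (fun z => sqn (r^-1 *: comp z x - x)) <=
  ((1 - delta) * sqn x + sigmar2)%:E)%E.
Proof.
have := cmp_scaled_error hQ x; rewrite sqr_fnorm unlock => /(le_trans _); apply.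
rewrite le_eqVlt; apply/orP; left; apply/eqP; apply: eq_integral => z _.
by rewrite sqr_fnorm.
Qed.

(** Averages one round: [h] is carried along, and the two quantization errors become multiples of
    [||D||^2] plus noise of order [sk ^+ 2]. *)
Lemma quant_round t sk (D : Omega -> 'M[K]_(n, p)) (h : Omega -> K) (k1 k2 : K) :
  0 < sk -> @mxmeas _ _ (past t) _ _ D ->
  measurable_fun [set: Omega] h -> (forall w, 0 <= h w) -> 0 <= k1 -> 0 <= k2 ->
  let Q w := quant comp sk (fun i => zeta t i w) (D w) in
  mxmeas Q ->
  (Ex P (fun w => h w + k1 * sqn (D w - Q w) + k2 * sqn (D w - r^-1 *: Q w))%R <=
   Ex P (fun w => h w + (k1 * Cs + k2 * (1 - delta)) * sqn (D w) +
     n%:R * sk ^+ 2 * (k1 * sigma2 + k2 * sigmar2))%R)%E.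
Proof.
move=> sk0 mD mh h0 k10 k20 Q mQ.
have mD' : mxmeas D by apply: (mxmeas_past hzeta); exact: mD.
have mDs := measurable_sqn mD'.
have me1 := measurable_sqn (mxmeasB mD' mQ).
have me2 := measurable_sqn (mxmeasB mD' (mxmeasZ r^-1 mQ)).
have del' : 0 <= 1 - delta by rewrite subr_ge0.
have n0 : 0 <= n%:R :> K by rewrite ler0n.
have sg := cmp_sigma2_ge0 hQ; have sgr := cmp_sigmar2_ge0 hQ.
have Cs0 := cmp_C_ge0 hQ.
pose b1 w := Cs * sqn (D w) + n%:R * sk ^+ 2 * sigma2.
pose b2 w := (1 - delta) * sqn (D w) + n%:R * sk ^+ 2 * sigmar2.
have sD w : 0 <= sqn (D w) := sqn_ge0 _.
have E1 := quant_integral_le hzeta (cmp_measurable hQ) sk0 Cs0 sg mD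
  compression_error.
have E2 := quant_integral_le hzeta (cmp_measurable hQ) sk0 del' sgr mD
  compression_scaled_error.
have {}E1 : (Ex P (fun w => sqn (D w - Q w)) <= Ex P b1)%E.
  apply: le_trans E1; rewrite le_eqVlt; apply/orP; left; apply/eqP.
  by apply: eq_integral => w _; rewrite scale1r.
have mb1 : measurable_fun setT b1 by rewrite /b1; measure.
have mb2 : measurable_fun setT b2 by rewrite /b2; measure.
have b10 w : 0 <= b1 w by have := sD w; rewrite /b1 => ?; nonneg.
have b20 w : 0 <= b2 w by have := sD w; rewrite /b2 => ?; nonneg.
have e10 w : 0 <= sqn (D w - Q w) := sqn_ge0 _.
have e20 w : 0 <= sqn (D w - r^-1 *: Q w) := sqn_ge0 _.
apply: le_trans (Ex_combine mh me1 me2 mb1 mb2 k10 k20 h0 e10 e20 b10 b20 E1 E2) _.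
rewrite le_eqVlt; apply/orP; left; apply/eqP; apply: eq_integral => w _.
by congr (_%:E); rewrite /b1 /b2; ring.
Qed.

Definition noise : K :=
  n%:R * (KE * sigma2 + KR * sigmar2 + (ME * sigma2 + MR * sigmar2)).

Lemma noise_ge0 : 0 <= noise.
Proof.
have sg := cmp_sigma2_ge0 hQ; have sgr := cmp_sigmar2_ge0 hQ.
have n0 : 0 <= n%:R :> K by rewrite ler0n.
have k1 := kE_ge0 sc; have k2 := kR_ge0 sc.
have k3 := mE_ge0 sc; have k4 := mR_ge0 sc.
by rewrite /noise /KE /KR /ME /MR; nonneg.
Qed.

Let rho0 : 0 <= rho.
Proof.
apply: le_trans rho_c; rewrite subr_ge0 ler_pdivrMr// mul1r.
by rewrite (le_trans (ltW a_lt1))// ler1n.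
Qed.

Lemma potential_recursion k : (Ex P (fun w => potential (st k.+1 w)) <=
  rho%:E * Ex P (fun w => potential (st k w)) + (noise * s k ^+ 2)%:E)%E.
Proof.
have mS := measurable_st k; have aS := adapted_st k.
have [aQx aQy] := adapted_innovations aS.
have mQx : mxmeas (Qx k) by apply: (mxmeas_past hzeta); exact: aQx.
have mQy : mxmeas (Qy k) by apply: (mxmeas_past hzeta); exact: aQy.
have aD1 := mxmeas_innovX aS.
have aD2 : @mxmeas _ _ (past k.*2.+1) _ _ (fun w => innovY (st k w) (Qx k w)).
  by apply: mxmeas_innovY => //; apply: mxmeas_state_le aS.
have mD1 := measurable_sqn (mxmeas_innovX mS).
have mD2 := measurable_sqn (mxmeas_innovY mS mQx).
have mY1 := measurable_hY1 mS mQx; have mX1 := measurable_hX1 mS.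
have ke0 : 0 <= KE := kE_ge0 sc; have kr0 : 0 <= KR := kR_ge0 sc.
have me0 : 0 <= ME := mE_ge0 sc; have mr0 : 0 <= MR := mR_ge0 sc.
have sg := cmp_sigma2_ge0 hQ; have sgr := cmp_sigmar2_ge0 hQ.
have n0 : 0 <= n%:R :> K by rewrite ler0n.
have c10 : 0 <= n%:R * s k ^+ 2 * (KE * sigma2 + KR * sigmar2).
  by nonneg.
have mV' := measurable_potential (measurable_st k.+1).
have mV := measurable_potential mS.
have Y0 w : 0 <= hY1 (st k w) (Qx k w).
  by apply: (preY_ge0 sc); rewrite ?gap ?sqn_ge0.
have X0' w : 0 <= hX1 (st k w).
  by apply: (preX_ge0 sc); rewrite ?gap ?sqn_ge0.
have mXc : measurable_fun [set: Omega] (fun w => hX1 (st k w) +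
    n%:R * s k ^+ 2 * (KE * sigma2 + KR * sigmar2)) by measure.
have Xc0 w : 0 <= hX1 (st k w) + n%:R * s k ^+ 2 * (KE * sigma2 + KR * sigmar2).
  exact: addr_ge0.
have me1 := measurable_sqn (mxmeasB (mxmeas_innovY mS mQx) mQy).
have me2 := measurable_sqn (mxmeasB (mxmeas_innovY mS mQx) (mxmeasZ r^-1 mQy)).
have me3 := measurable_sqn (mxmeasB (mxmeas_innovX mS) mQx).
have me4 := measurable_sqn (mxmeasB (mxmeas_innovX mS) (mxmeasZ r^-1 mQx)).
apply: (@le_trans _ _ (Ex P (fun w => hY1 (st k w) (Qx k w) +
    KE * sqn (innovY (st k w) (Qx k w) - Qy k w) +
    KR * sqn (innovY (st k w) (Qx k w) - r^-1 *: Qy k w))%R)).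
  apply: Ex_le; [exact: mV'|exact: measurable_combine mY1 me1 me2| |].
    by move=> w; exact: potential_ge0.
  move=> w; rewrite st_next; apply: potential_next; exact: invariant_st.
(* Round [2k + 1] is averaged first, with [Q_x] belonging to its past. *)
apply: le_trans (quant_round (s0 k) aD2 mY1 Y0 ke0 kr0 mQy) _.
apply: (@le_trans _ _ (Ex P (fun w => hX1 (st k w) +
    n%:R * s k ^+ 2 * (KE * sigma2 + KR * sigmar2) +
    ME * sqn (innovX (st k w) - Qx k w) +
    MR * sqn (innovX (st k w) - r^-1 *: Qx k w))%R)).
  apply: Ex_le; [by measure|exact: measurable_combine mXc me3 me4| |].
    move=> w; rewrite addr_ge0//.
    rewrite addr_ge0// mulr_ge0 ?sqn_ge0// addr_ge0// mulr_ge0//.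
      exact: cmp_C_ge0 hQ.
    by rewrite subr_ge0.
  move=> w; have := hY1_hX1 (Qx k w) (invariant_st k w); lra.
(* Round [2k] follows; the noise of the other round is carried inside the fixed part. *)
apply: le_trans (quant_round (s0 k) aD1 mXc Xc0 me0 mr0 mQx) _.
apply: (@le_trans _ _ (Ex P (fun w => rho * potential (st k w) +
    noise * s k ^+ 2)%R)).
  apply: Ex_le; [by measure|by measure| |].
    move=> w; rewrite addr_ge0//; last by nonneg.
    rewrite addr_ge0// mulr_ge0 ?sqn_ge0// addr_ge0// mulr_ge0//.
      exact: cmp_C_ge0 hQ.
    by rewrite subr_ge0.
  by move=> w; have := hX1_le (invariant_st k w); rewrite /noise /x_; lra.
have p0 w : 0 <= potential (st k w) by exact: potential_ge0.
have nz : 0 <= noise * s k ^+ 2 by rewrite mulr_ge0 ?noise_ge0 ?sqr_ge0.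
have mr : measurable_fun setT (fun w => rho * potential (st k w)) by measure.
rewrite ExD//; last by move=> w; exact: mulr_ge0.
by rewrite ExZ// Ex_cst.
Qed.

Hypotheses (c c0 : K) (rho_c' : rho < c) (c00 : 0 < c0)
  (sE : forall k, s k ^+ 2 = c0 * c ^+ k).

Let pot0 := potential (RCPPState X0 (gradF f X0) 0 0 0 0).

Lemma potential_rate : exists2 A : K, 0 <= A &
  forall k, (Ex P (fun w => potential (st k w)) <= (A * c ^+ k)%:E)%E.
Proof.
have cr : 0 < c - rho by rewrite subr_gt0.
have cge0 : 0 <= c by rewrite (le_trans rho0)// ltW.
(* [A] dominates the initial potential and satisfies [rho * A + noise * c0 <= c * A], as the
   induction requires. *)
pose A := pot0 + noise * c0 / (c - rho).
have pot00 : 0 <= pot0 by exact: potential_ge0.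
have A2 : 0 <= noise * c0 / (c - rho).
  by have nz := noise_ge0; nonneg.
exists A; first exact: addr_ge0.
elim=> [|k IH].
  rewrite (_ : (fun w => _) = (fun=> pot0)); last by apply/funext.
  by rewrite Ex_cst lee_fin expr0 mulr1 lerDl.
apply: le_trans (potential_recursion k) _.
apply: (@le_trans _ _ (rho%:E * (A * c ^+ k)%:E + (noise * s k ^+ 2)%:E)%E).
  by rewrite leeD2r// lee_wpmul2l// lee_fin.
rewrite -EFinM -EFinD lee_fin sE exprS.
have ck : 0 <= c ^+ k by rewrite exprn_ge0.
have h : noise * c0 <= A * (c - rho).
  rewrite /A mulrDl divfK ?gt_eqF// lerDr mulr_ge0// ltW//.
by have := ler_wpM2r ck h; lra.
Qed.

Lemma objective_rate : exists B : K, forall k,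
  (Ex P (fun w => o_ (st k w)) <= (B * c ^+ k)%:E)%E.
Proof.
have [A A0 hA] := potential_rate; exists A => k; apply: le_trans (hA k).
have mS := measurable_st k.
apply: Ex_le; [exact: measurable_o|exact: measurable_potential|by []|].
move=> w; have [h1 h2 h3 h4] := parts_ge0 (st k w).
by rewrite /potential; lra.
Qed.

Lemma consensus_rate : exists B : K, forall k,
  (Ex P (fun w => c_ (st k w)) <= (B * c ^+ k)%:E)%E.
Proof.
have [A A0 hA] := potential_rate.
have hc : 0 < Wc := wc_gt0 sc.
exists (A / Wc) => k; have mS := measurable_st k; have mc := measurable_c mS.
have c0' w : 0 <= c_ (st k w) := sqn_ge0 _.
have h : (Wc%:E * Ex P (fun w => c_ (st k w)) <= (A * c ^+ k)%:E)%E.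
  apply: le_trans (hA k); rewrite -ExZ//; last exact: ltW.
  apply: Ex_le; [by measure|exact: measurable_potential| |].
    by move=> w; apply: mulr_ge0 => //; exact: ltW.
  move=> w; have [h1 h2 h3 h4] := parts_ge0 (st k w).
  by have := o_ge0 (st k w); rewrite /potential; lra.
by rewrite mulrAC EFinM lee_pdivlMr// muleC.
Qed.

End Recursion.

(** * Consequences of the step-size bounds *)

Section Bounds.
Context {K : realType}.
Implicit Types a b x y z : K.

(* When [b = 0] the conclusion is [0 <= a], in accordance with the reading of
   [a / 0] as [+oo]. *)
Lemma le_bfrac x a b : 0 <= a -> 0 <= b -> (x%:E <= bfrac a b)%E -> x * b <= a.
Proof.
move=> a0 b0; rewrite /bfrac; case: eqVneq => [->|bN0]; first by rewrite mulr0.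
by rewrite lee_fin ler_pdivlMr// lt_neqAle eq_sym bN0.
Qed.

Lemma bfrac_fin a b : b != 0 -> bfrac a b = (a / b)%:E.
Proof. by rewrite /bfrac => /negPf ->. Qed.

Lemma le_mul_sqrt x k y z : 0 <= x -> 0 <= k -> 0 <= y ->
  x * (k * Num.sqrt y) <= z -> k ^+ 2 * (x ^+ 2 * y) <= z ^+ 2.
Proof.
move=> x0 k0 y0 h.
have -> : k ^+ 2 * (x ^+ 2 * y) = (x * (k * Num.sqrt y)) ^+ 2.
  by rewrite !exprMn sqr_sqrtr//; ring.
by apply: ler_sqr_ge0 => //; rewrite !mulr_ge0 ?sqrtr_ge0.
Qed.

(** Serves the case [L = 0], where bounds with denominator [L] are [+oo] and a positive surrogate is
    needed. With [t = 1 / (1 + x + y + z)] one has [t ^+ 2 <= t], so [t ^+ 2] times each of [x],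
    [y], [z] is at most 1. *)
Lemma small_lipschitz (l Cs uR uC D q : K) : 0 <= Cs -> 0 <= uR -> 0 <= uC -> 0 < q ->
  exists2 t : K, 0 < t & [/\ l ^+ 2 * t ^+ 2 <= 1 / 36,
    l ^+ 2 * t ^+ 2 * Cs <= 1 / 36 &
    384 * (l ^+ 2 * t ^+ 2 * uR * uC ^+ 3 * D ^+ 2) <= q].
Proof.
move=> Cs0 uR0 uC0 q0.
pose x := 36 * l ^+ 2; pose y := 36 * (l ^+ 2 * Cs).
pose z := 384 * (l ^+ 2 * uR * uC ^+ 3 * D ^+ 2) / q.
have x0 : 0 <= x by rewrite /x; nonneg.
have y0 : 0 <= y by rewrite /y; nonneg.
have z0 : 0 <= z.
  by apply: divr_ge0 (ltW q0); apply: mulr_ge0; [exact: ler0n|nonneg].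
have s0 : 0 < 1 + x + y + z by lra.
have t1 : (1 + x + y + z)^-1 ^+ 2 <= (1 + x + y + z)^-1.
  rewrite expr2 ger_pMl ?invr_gt0// invf_le1//; lra.
have key u : 0 <= u -> u <= 1 + x + y + z -> (1 + x + y + z)^-1 ^+ 2 * u <= 1.
  move=> u0 us; apply: (le_trans (ler_wpM2r u0 t1)).
  by rewrite ler_pdivrMl// mulr1.
exists (1 + x + y + z)^-1; first by rewrite invr_gt0.
move: {t1 s0} _^-1 key => t key; split.
- by have : t ^+ 2 * x <= 1 by [apply: key => //; lra]; rewrite /x; lra.
- by have : t ^+ 2 * y <= 1 by [apply: key => //; lra]; rewrite /y; lra.
- have : t ^+ 2 * z <= 1 by apply: key => //; lra.
  by rewrite /z [_ * (_ / q)]mulrA ler_pdivrMr// mul1r; lra.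
Qed.

Lemma linear_rateP (c : K) (u : nat -> \bar K) : 0 <= c -> c < 1 ->
  (forall k, (0 <= u k)%E) ->
  (exists B : K, forall k, (u k <= (B * c ^+ k)%:E)%E) -> linear_rate c u.
Proof.
move=> c0 c1 u0 [B hB]; split; last by exists B => k; rewrite gee0_abs.
apply: (@squeeze_cvge _ _ _ _ (fun=> 0%E) _ (fun k => (B * c ^+ k)%:E)).
- by near=> k; rewrite u0 hB.
- exact: cvg_cst.
- apply: cvg_EFin; first by near=> k.
  by apply: cvg_geometric; rewrite ger0_norm.
Unshelve. all: by end_near.
Qed.

End Bounds.

Section StepsizeConditions.
Context {K : realType}.
Variables (n uR uC l M lb thR thC gx gy N S D F Cs alr blr delta : K).
Let a := thR * gx.
Let b := thC * gy.
Let ax := alr * delta.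
Let ay := blr * delta.
Let e1 := 2 * F ^+ 2 + 4 * F ^+ 2 * S ^+ 2 * Cs.
Let e2 := 12 * S ^+ 2 * (Cs + 1) + 4.

Hypotheses (n0 : 0 < n) (uR0 : 0 < uR) (uC0 : 0 < uC) (l0 : 0 < l) (M0 : 0 < M)
  (thR0 : 0 < thR) (thC0 : 0 < thC) (gx0 : 0 < gx) (gy0 : 0 < gy)
  (D1 : 1 <= D) (F1 : 1 <= F) (Cs0 : 0 <= Cs) (alr0 : 0 < alr) (blr0 : 0 < blr)
  (delta0 : 0 < delta) (alr1 : alr <= 1) (blr1 : blr <= 1) (delta1 : delta <= 1)
  (gx1 : gx <= 1) (gy1 : gy <= 1) (thR1 : thR <= 1) (thC1 : thC <= 1)
  (thRN : thR <= N) (thCS : thC <= S) (S2 : S <= 2)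
  (uRD : uR ^+ 2 <= 2 * D ^+ 2 * n) (uCF : uC ^+ 2 <= 2 * F ^+ 2 * n)
  (Mn : M * n <= uR * uC) (Mlb : M * l <= lb) (lbn : lb * n <= l * uR * uC).

Hypothesis gx_b : gx * (2 * Num.sqrt (uR * e1 * (3 * N ^+ 2))) <=
  Num.sqrt (M * uC) * b.
Hypothesis gx_ax : gx * (8 * Num.sqrt (Cs * (36 * N ^+ 2) * (2 * D ^+ 2 * N ^+ 2)))
  <= thR * ax.
Hypothesis gy_e2 : gy * (4 * e1 * (3 * N ^+ 2) * (12 * S ^+ 2)) <=
  thC * e2 * (3 * N ^+ 2).
Hypothesis gy_ay : gy * (16 * Cs * e2 * (3 * N ^+ 2) * (36 * S ^+ 2)) <=
  thC * ay ^+ 2 * (36 * N ^+ 2).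

Let N0 : 0 < N. Proof. exact: lt_le_trans thRN. Qed.
Let S0 : 0 < S. Proof. exact: lt_le_trans thCS. Qed.
Let D0 : 0 < D. Proof. exact: lt_le_trans D1. Qed.
Let F0 : 0 < F. Proof. exact: lt_le_trans F1. Qed.
Let N2 : 0 < N ^+ 2. Proof. by rewrite exprn_gt0. Qed.
Let S22 : 0 < S ^+ 2. Proof. by rewrite exprn_gt0. Qed.
Let b0 : 0 < b. Proof. exact: mulr_gt0. Qed.
Let b1 : b <= 1. Proof. by rewrite mulr_ile1// ltW. Qed.
Let e1_gt0 : 0 < e1.
Proof.
by apply: ltr_pwDl; [rewrite mulr_gt0 ?exprn_gt0|nonneg].
Qed.
Let e1E : e1 = 2 * F ^+ 2 * (1 + 2 * S ^+ 2 * Cs). Proof. by rewrite /e1; ring. Qed.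
Let e2_gt0 : 0 < e2.
Proof.
by apply: ltr_wpDl => //; nonneg.
Qed.

Let k2 : 12 * (N ^+ 2 * e1 * uR * gx ^+ 2) <= M * uC * b ^+ 2.
Proof.
have y0 : 0 <= uR * e1 * (3 * N ^+ 2) by nonneg.
have := le_mul_sqrt (ltW gx0) (ler0n K 2) y0 gx_b.
by rewrite exprMn sqr_sqrtr; [lra|nonneg].
Qed.

(** Multiplying [k2] by [n] and using [b <= 1], [M n <= uR uC] and [uC^2 <= 2 F^2 n <= e1 n] cancels
    everything but [12 (gx N)^2 <= 1]. Then [thR <= N] gives [thR gx <= 1 / sqrt 12 < 29/100]. *)
Lemma a_bound : thR * gx <= 29 / 100 /\ (gx * N) ^+ 2 <= 1 / 12.
Proof.
have h : (gx * N) ^+ 2 <= 1 / 12.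
  have p0 : 0 < 12 * e1 * uR * n by rewrite !mulr_gt0.
  rewrite -(ler_pM2l p0).
  have h1 : 12 * e1 * uR * n * (gx * N) ^+ 2 <= n * (M * uC * b ^+ 2).
    by have := ler_wpM2l (ltW n0) k2; lra.
  apply: le_trans h1 _.
  have b2 : b ^+ 2 <= 1 by rewrite expr_le1// ltW.
  have h2 : n * (M * uC * b ^+ 2) <= uR * uC ^+ 2.
    rewrite (_ : n * _ = M * n * uC * b ^+ 2); last by ring.
    apply: (@le_trans _ _ (M * n * uC * 1)).
      by apply: ler_wpM2l => //; nonneg.
    by rewrite mulr1 expr2 mulrA ler_pM2r.
  have h3 : uC ^+ 2 <= e1 * n.
    apply: le_trans uCF _; rewrite ler_pM2r// e1E ler_peMr//; first by nonneg.
    by rewrite lerDl; nonneg.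
  by have := ler_wpM2l (ltW uR0) h3; lra.
split=> //.
have h' : (thR * gx) ^+ 2 <= 1 / 12.
  apply: le_trans h; apply: ler_sqr_ge0; first by nonneg.
  by rewrite mulrC ler_pM2l.
have a0 : 0 < thR * gx by exact: mulr_gt0.
by move: (thR * gx) a0 h' => t t0 ht; nra.
Qed.

Let gyS : 96 * (gy * F ^+ 2 * S ^+ 2 * (1 + 2 * S ^+ 2 * Cs)) <= thC * e2.
Proof.
have p0 : 0 < 3 * N ^+ 2 by rewrite mulr_gt0.
rewrite -(ler_pM2r p0); apply: le_trans gy_e2; rewrite e1E; lra.
Qed.

Let gyC : 48 * (gy * Cs * e2 * S ^+ 2) <= thC * ay ^+ 2.
Proof.
have p0 : 0 < 36 * N ^+ 2 by rewrite mulr_gt0.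
rewrite -(ler_pM2r p0); apply: le_trans gy_ay; lra.
Qed.

Let k4 : 64 * (72 * (gy ^+ 2 * F ^+ 2 * S ^+ 4 * Cs)) <= thC ^+ 2 * ay ^+ 2.
Proof.
rewrite -(ler_pM2l e2_gt0).
have u0 : 0 <= 96 * (gy * F ^+ 2 * S ^+ 2 * (1 + 2 * S ^+ 2 * Cs)).
  by nonneg.
have v0 : 0 <= 48 * (gy * Cs * e2 * S ^+ 2).
  by nonneg.
(* The product of the two bounds on [gy] cancels [e2], and 96 * 48 = 64 * 72. *)
have := ler_pM u0 v0 gyS gyC.
have w0 : 0 <= e2 * (gy ^+ 2 * F ^+ 2 * S ^+ 4 * Cs) * (S ^+ 2 * Cs).
  by nonneg.
lra.
Qed.

(** As [S^2 <= 4], [e2] is at most [52 (1 + 2 S^2 Cs)]; inserted in [gyS] with [thC <= S] this gives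
    52/96 = 13/24. *)
Let gySF : gy * S * F <= 13 / 24.
Proof.
have sc0 : 0 <= S ^+ 2 * Cs by nonneg.
have s4 : S ^+ 2 <= 4.
  by rewrite (_ : 4 = 2 ^+ 2); [exact: ler_sqr_ge0 (ltW S0) S2|ring].
have q0 : 0 < 1 + 2 * S ^+ 2 * Cs by lra.
have h : gy * S * F ^+ 2 <= 13 / 24.
  have p0 : 0 < 96 * S * (1 + 2 * S ^+ 2 * Cs) by rewrite !mulr_gt0.
  rewrite -(ler_pM2l p0).
  have h1 : thC * e2 <= S * (52 * (1 + 2 * S ^+ 2 * Cs)).
    apply: ler_pM; rewrite ?(ltW thC0) ?(ltW e2_gt0)//.
    by rewrite /e2; lra.
  by have := gyS; lra.
apply: le_trans h; rewrite ler_pM2l ?mulr_gt0// expr2 ler_peMl//.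
exact: ltW.
Qed.

Let k3 : 64 * (72 * (Cs * D ^+ 2 * N ^+ 4 * gx ^+ 2)) <= thR ^+ 2 * ax ^+ 2.
Proof.
have y0 : 0 <= Cs * (36 * N ^+ 2) * (2 * D ^+ 2 * N ^+ 2).
  by nonneg.
have := le_mul_sqrt (ltW gx0) (ler0n K 8) y0 gx_ax.
by rewrite [(thR * ax) ^+ 2]exprMn; lra.
Qed.

Section Lipschitz.
Variable L : K.
Hypotheses (L0 : 0 < L) (lL : l ^+ 2 * L ^+ 2 <= 1 / 36)
  (lLC : l ^+ 2 * L ^+ 2 * Cs <= 1 / 36)
  (k1 : 384 * (l ^+ 2 * L ^+ 2 * uR * uC ^+ 3 * D ^+ 2) <= n ^+ 2 * M * a ^+ 2).

Lemma stepsize_conditionsP : stepsize_conditions n uR uC L l M lb thR thC gx gy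
  N S D F (1 + gx * N) Cs alr blr delta.
Proof.
have [_ gN] := a_bound.
have gN0 : 0 <= gx * N by nonneg.
split => //.
- by rewrite addr_ge0.
(* The square of [1 + 1 / sqrt 12] is about 1.661, just below 5/3. *)
- by move: (gx * N) gN gN0 => t; nra.
- by rewrite -e1E.
Qed.

Lemma lb_L_le1 : lb * L <= 1.
Proof.
have [a_le _] := a_bound.
have a0 : 0 < thR * gx by exact: mulr_gt0.
have a2 : a ^+ 2 <= 1 by rewrite expr_le1 ?ltW// (le_lt_trans a_le)//; lra.
have lb0 : 0 < lb by apply: lt_le_trans Mlb; exact: mulr_gt0.
have h1 : 384 * (l ^+ 2 * L ^+ 2 * uR ^+ 2 * uC ^+ 2) <= 2 * n ^+ 2.
  (* This factor makes the left side [uR * n] times that of [k1]; [M n <= uR uC] and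
     [uR^2 <= 2 D^2 n] then bound the right side. *)
  have p0 : 0 < uC * D ^+ 2 * n by rewrite !mulr_gt0 ?exprn_gt0.
  rewrite -(ler_pM2l p0).
  have q1 : n ^+ 2 * M * a ^+ 2 <= n ^+ 2 * M * 1.
    by apply: ler_wpM2l => //; nonneg.
  have q2 := ler_wpM2l (mulr_ge0 (ltW uR0) (ltW n0)) (le_trans k1 q1).
  have q3 := ler_wpM2l (mulr_ge0 (sqr_ge0 n) (ltW uR0)) Mn.
  have q4 := ler_wpM2l (mulr_ge0 (sqr_ge0 n) (ltW uC0)) uRD.
  by lra.
have h2 : (lb * L) ^+ 2 <= 1 ^+ 2.
  have n2 : 0 < n ^+ 2 by rewrite exprn_gt0.
  rewrite -(ler_pM2l n2) expr1n mulr1.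
  have h3 : (lb * n) ^+ 2 <= (l * uR * uC) ^+ 2.
    by apply: ler_sqr_ge0 => //; nonneg.
  have := ler_wpM2r (sqr_ge0 L) h3; move: h1 n2; rewrite !exprMn; lra.
rewrite -(@ler_pXn2r _ 2)// ?nnegrE//; by nonneg.
Qed.

End Lipschitz.

(** Squaring gives the constant 4 * 2 * 96 = 768 and the factor [(1 - thR gx)^2], which is at least
    0.71^2 > 1/2 by [a_bound]; hence 384. *)
Lemma lhat_k1 (L : K) : 0 < L ->
  l <= (1 / (2 * Num.sqrt (2 * D ^+ 2)) * (thR / (1 - thR * gx))) *
    (1 / (Num.sqrt (96 * (uR * uC / (n ^+ 2 * M))) * uC) * (gx / L)) ->
  384 * (l ^+ 2 * L ^+ 2 * uR * uC ^+ 3 * D ^+ 2) <= n ^+ 2 * M * a ^+ 2.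
Proof.
move=> L0 h; have [a_le _] := a_bound.
have a1 : 0 < 1 - thR * gx by lra.
pose E := uR * uC / (n ^+ 2 * M).
have E0 : 0 < E by rewrite /E divr_gt0 ?mulr_gt0 ?exprn_gt0.
have sE0 : 0 < Num.sqrt (96 * E) by rewrite sqrtr_gt0 mulr_gt0.
have sD0 : 0 < Num.sqrt (2 * D ^+ 2) by rewrite sqrtr_gt0 mulr_gt0 ?exprn_gt0.
have {}h : l * (2 * Num.sqrt (2 * D ^+ 2) * (1 - thR * gx) *
    (Num.sqrt (96 * E) * uC * L)) <= a.
  have p0 : 0 < 2 * Num.sqrt (2 * D ^+ 2) * (1 - thR * gx) *
    (Num.sqrt (96 * E) * uC * L) by rewrite !mulr_gt0.
  rewrite -ler_pdivlMr//; apply: le_trans h _.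
  rewrite le_eqVlt; apply/orP; left; apply/eqP; rewrite /a -/E.
  by field; rewrite !gt_eqF.
have {}h : 768 * (l ^+ 2 * L ^+ 2 * D ^+ 2 * (1 - thR * gx) ^+ 2 * uC ^+ 2 * E)
    <= a ^+ 2.
  rewrite (_ : 768 * _ = (l * (2 * Num.sqrt (2 * D ^+ 2) * (1 - thR * gx) *
    (Num.sqrt (96 * E) * uC * L))) ^+ 2); first by apply: ler_sqr_ge0 => //; nonneg.
  have s1 : Num.sqrt (2 * D ^+ 2) ^+ 2 = 2 * D ^+ 2 by rewrite sqr_sqrtr//; nonneg.
  have s2 : Num.sqrt (96 * E) ^+ 2 = 96 * E by rewrite sqr_sqrtr//; nonneg.
  by rewrite !exprMn s1 s2; ring.
have h2 : 1 / 2 <= (1 - thR * gx) ^+ 2.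
  by have a0 := mulr_gt0 thR0 gx0; move: (thR * gx) a0 a_le => t t0 t1; nra.
have nM : 0 < n ^+ 2 * M by rewrite mulr_gt0 ?exprn_gt0.
have {}h := ler_wpM2l (ltW nM) h.
have q0 : 0 <= l ^+ 2 * L ^+ 2 * uR * uC ^+ 3 * D ^+ 2 by nonneg.
have {}h2 := ler_wpM2l q0 h2.
have EE : uR * uC = n ^+ 2 * M * E by rewrite /E; field; rewrite !gt_eqF.
have QE : l ^+ 2 * L ^+ 2 * uR * uC ^+ 3 * D ^+ 2 =
  l ^+ 2 * L ^+ 2 * (n ^+ 2 * M * E) * uC ^+ 2 * D ^+ 2 by rewrite -EE; ring.
by rewrite QE in h2 *; move: h h2; rewrite -/a; move: ((1 - a) ^+ 2) => v; lra.
Qed.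

End StepsizeConditions.

Section NetworkBounds.
Context {K : realType} {n : nat}.
Hypothesis n_gt0 : (0 < n)%N.

Lemma fnorm_gt0_sum (u : 'cV[K]_n) : \sum_i u i 0 = n%:R -> 0 < fnorm u.
Proof.
move=> su; rewrite lt_neqAle fnorm_ge0 andbT eq_sym; apply/eqP => /fnorm_eq0 u0.
move: su; rewrite u0 big1 => [/eqP|i _]; last by rewrite mxE.
by rewrite eq_sym pnatr_eq0 -leqn0 leqNgt n_gt0.
Qed.

Lemma weighted_step_le (uR uC : 'cV[K]_n) (lam : 'rV[K]_n) (l : K) :
  0 <= l -> (forall i, 0 <= lam 0 i <= l) ->
  (uR^T *m diag_mx lam *m uC) 0 0 <= l * fnorm uR * fnorm uC.
Proof.
move=> l0 hl; apply: le_trans (ler_norm _) _.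
have -> : l * fnorm uR * fnorm uC = fnorm uR * (l * fnorm uC) by ring.
rewrite -(@ler_pXn2r _ 2)// ?nnegrE ?mulr_ge0 ?fnorm_ge0//.
rewrite real_normK ?num_real//; apply: le_trans (sqn_entry _ _ _) _.
rewrite !exprMn !sqr_fnorm -mulmxA; apply: le_trans (sqn_mulmx _ _) _.
by rewrite sqn_tr ler_wpM2l ?sqn_ge0// sqn_diag.
Qed.

Lemma smooth_of_lipschitz p (g : 'rV[K]_p -> K) (L L' : K) : 0 <= L' -> L <= L' ->
  (forall x, differentiable g x) ->
  (forall x y, fnorm (grad g x - grad g y) <= L * fnorm (x - y)) -> smooth L' g.
Proof.
move=> L0 LL dg lip; split => // x y.
rewrite -!sqr_fnorm -exprMn; apply: ler_sqr_ge0; first exact: fnorm_ge0.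
by apply: le_trans (lip x y) _; rewrite ler_wpM2r ?fnorm_ge0.
Qed.

End NetworkBounds.

Theorem theorem1 (K : realType) (n p : nat) (hn : (2 <= n)%N)
  (* network *)
  (R C : 'M[K]_n) (hN : network_assumption R C)
  (uR uC : 'cV[K]_n) (huR : left_eigvec R uR) (huC : right_eigvec C uC)
  (Rt Ct : 'M[K]_n) (thR thC dR2 dC2 : K)
  (hnormR : adapted_norm (Pi_R uR) R Rt thR dR2)
  (hnormC : adapted_norm (Pi_C uC) C Ct thC dC2)
  (* objective *)
  (f : 'I_n -> 'rV[K]_p -> K) (xs : 'rV[K]_p) (mu : K) (Ls : 'I_n -> K)
  (hF : function_assumption f xs mu Ls)
  (* compression *)
  (d d' : measure_display) (Omega : measurableType d) (P : probability Omega K)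
  (Z : measurableType d') (nu : probability Z K)
  (comp : Z -> 'rV[K]_p -> 'rV[K]_p) (Cs sigma2 r delta sigmar2 : K)
  (hQ : compression_assumption nu comp Cs sigma2 r delta sigmar2)
  (zeta : nat -> 'I_n -> Omega -> Z) (hzeta : fresh_seeds P nu zeta)
  (* parameters of the algorithm *)
  (lam : 'rV[K]_n) (hlam : forall i, 0 <= lam 0 i)
  (alx aly gx gy : K) (s : nat -> K) (X0 : 'M[K]_(n, p))
  (halx0 : 0 < alx) (halx : alx <= r^-1)
  (haly0 : 0 < aly) (haly : aly <= r^-1)
  (hgx0 : 0 < gx) (hgy0 : 0 < gy)
  (M : K) (hM : 0 < M) (c c0 : K) :
  let L := \big[Num.max/0]_i Ls i in
  let Lam := diag_mx lam in
  let lbar := n%:R^-1 * (uR^T *m Lam *m uC) 0 0 in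
  let lhat := \big[Num.max/0]_i lam 0 i in
  let nIR := opnorm Rt (1%:M - R) in
  let nRg := opnorm Rt (relaxed R gx) in
  let nIC := opnorm Ct (1%:M - C) in
  let c2 := 2 * dR2 ^+ 2 in
  let c24 := 2 * dR2 ^+ 2 * nIR ^+ 2 in
  let c3 := 3 * nRg ^+ 2 in
  let c32 := 3 * nIR ^+ 2 in
  let c34 := 3 * nIR ^+ 2 in
  let c35 := 4 * dC2 ^+ 2 * nIC ^+ 2 in
  let d1 := 2 * dC2 ^+ 2 in
  let d2 := 4 * dC2 ^+ 2 * nIC ^+ 2 in
  let e1 := d1 + d2 * Cs in
  let c4 := 36 * nRg ^+ 2 in
  let d42 := 36 * nIR ^+ 2 in
  let d44 := 36 * nIR ^+ 2 in
  let c43 := 18 * nIC ^+ 2 in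
  let c45 := 36 * nIC ^+ 2 in
  let c5 := 3 * nRg ^+ 2 in
  let d3 := 12 * nIC ^+ 2 in
  let d53 := 12 * nIC ^+ 2 in
  let d55 := 12 * nIC ^+ 2 in
  let d4 := 4 in
  let e2 := d3 * (Cs + 1) + d4 in
  let d52 := 3 * nIR ^+ 2 in
  let d54 := 3 * nIR ^+ 2 in
  let E := fnorm uR * fnorm uC / (n%:R ^+ 2 * M) in
  let m1 := minlist [::
    (bfrac 1 (2 * Num.sqrt c2) * bfrac thR (1 - thR * gx))%E;
    bfrac (Num.sqrt c32) (Num.sqrt c3);
    bfrac (Num.sqrt d42) (Num.sqrt c4);
    bfrac (Num.sqrt d52) (Num.sqrt c5)] in
  let m2 := minlist [::
    (bfrac 1 (2 * Num.sqrt (c2 * c32)) * bfrac thR (1 - thR * gx))%E;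
    bfrac 1 (Num.sqrt c3);
    bfrac (Num.sqrt d42) (Num.sqrt (c4 * c32));
    bfrac (Num.sqrt d52) (Num.sqrt (c5 * c32))] in
  let rho : K := Num.max (1 - 2^-1 * M * lhat * mu)
            (Num.max (1 - thR * gx / 16)
            (Num.max (1 - thC * gy / 8)
            (Num.max (1 - alx * r * delta / 4)
                     (1 - aly * r * delta / 16)))) in
  let st k w := rcpp f R C Lam alx aly gx gy s X0 comp
                  (fun t i => zeta t i w) k in
  let X k w := st_X (st k w) in
  let Xbar k w : 'rV[K]_p := n%:R^-1 *: (uR^T *m X k w) in
  0 < lhat ->
  M * lhat <= lbar ->
  (lhat%:E <= minlist [::
    bfrac 1 (6 * L);
    bfrac 1 (6 * Num.sqrt Cs * L);
    bfrac 1 (M * L);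
    bfrac (Num.sqrt d42) (2 * Num.sqrt (e1 * c32 * c43)) * bfrac thC L;
    m1 * (bfrac 1 (Num.sqrt (96 * E) * fnorm uC) * bfrac gx L);
    m2 * bfrac (thC * gy) (Num.sqrt (48 * e1) * L)])%E ->
  (gx%:E <= minlist [::
    1%:E;
    bfrac (thR * alx * r * delta) (8 * Num.sqrt (Cs * d42 * c24));
    bfrac (Num.sqrt c32 * alx * r * delta) (4 * Num.sqrt (Cs * d42 * c34));
    bfrac (alx * r * delta) (4 * Num.sqrt (Cs * d44));
    bfrac (Num.sqrt d52 * alx * r * delta) (4 * Num.sqrt (Cs * d42 * d54));
    bfrac (Num.sqrt (M * fnorm uC)) (2 * Num.sqrt (fnorm uR * e1 * c32))
      * (thC * gy)%:E])%E ->
  (gy%:E <= minlist [::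
    1%:E;
    bfrac (thC * e2 * d52) (4 * e1 * c32 * d53);
    bfrac (thC * (aly * r * delta) ^+ 2 * e1 * c32)
          (16 * Cs * e2 * d52 * c35);
    bfrac (thC * (aly * r * delta) ^+ 2 * d42) (16 * Cs * e2 * d52 * c45);
    bfrac (aly * r * delta) (4 * Num.sqrt (Cs * d55))])%E ->
  rho < c -> c < 1 -> 0 < c0 ->
  (forall k, 0 < s k /\ s k ^+ 2 = c0 * c ^+ k) ->
  linear_rate c (fun k => 'E_P[fun w => (favg f (Xbar k w) - favg f xs)%R])%E /\
  linear_rate c
    (fun k => 'E_P[fun w => (fnorm (Rt *m (Pi_R uR *m X k w)) ^+ 2)%R])%E.
Proof.
move=> L Lam lbar lhat nIR nRg nIC c2 c24 c3 c32 c34 c35 d1 d2 e1 c4 d42 d44 c43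
  c45 c5 d3 d53 d55 d4 e2 d52 d54 E m1 m2 rho st X Xbar lhat0 hlb hl hgx hgy
  rho_c c_lt1 c00 hs.
have n_gt0 : (0 < n)%N by exact: leq_trans hn.
have nK : 0 < n%:R :> K by rewrite ltr0n.
have R1 := net_R_row hN; have C1 := net_C_col hN.
have RR := PiR_idem n_gt0 huR; have RT := PiR_IR huR.
have CC := PiC_idem n_gt0 huC; have CT := PiC_IC (uC := uC) C1.
have thR0 := an_theta_gt0 hnormR; have thC0 := an_theta_gt0 hnormC.
have thR1 := an_theta_le1 hnormR; have thC1 := an_theta_le1 hnormC.
have thRN : thR <= nIR := an_theta_le_N hnormR n_gt0 RR RT.
have thCS : thC <= nIC := an_theta_le_N hnormC n_gt0 CC CT.
have S2 : nIC <= 2 := an_N_le2 hnormC n_gt0 CT.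
have D1 := an_d2_ge1 hnormR n_gt0; have F1 := an_d2_ge1 hnormC n_gt0.
have uR0 : 0 < fnorm uR by have [_ _ h] := huR; exact: fnorm_gt0_sum.
have uC0 : 0 < fnorm uC by have [_ _ h] := huC; exact: fnorm_gt0_sum.
have uRD : fnorm uR ^+ 2 <= 2 * dR2 ^+ 2 * n%:R.
  by rewrite sqr_fnorm; exact: (sqn_uR_le n_gt0 huR hnormR).
have uCF : fnorm uC ^+ 2 <= 2 * dC2 ^+ 2 * n%:R.
  by rewrite sqr_fnorm; exact: (sqn_uC_le n_gt0 huC hnormC).
have lam_l i : 0 <= lam 0 i <= lhat.
  by rewrite hlam/=; exact: (le_bigmax _ (fun i => lam 0 i)).
have lbn : lbar * n%:R <= lhat * fnorm uR * fnorm uC.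
  rewrite /lbar mulrC mulrA mulfV ?gt_eqF// mul1r.
  exact: weighted_step_le (ltW lhat0) lam_l.
(* Cancels [lhat] in [M lhat n <= lbar n <= lhat ||uR|| ||uC||]. *)
have Mn : M * n%:R <= fnorm uR * fnorm uC.
  rewrite -(ler_pM2l lhat0); apply: (@le_trans _ _ (lbar * n%:R)).
    by rewrite mulrCA mulrA ler_pM2r.
  by rewrite mulrA.
have r0 := cmp_r_gt0 hQ; have delta0 := cmp_delta_gt0 hQ.
have delta1 := cmp_delta_le1 hQ; have Cs0 := cmp_C_ge0 hQ.
have alr0 : 0 < alx * r by rewrite mulr_gt0.
have blr0 : 0 < aly * r by rewrite mulr_gt0.
have alr1 : alx * r <= 1 by rewrite -ler_pdivlMr// div1r.
have blr1 : aly * r <= 1 by rewrite -ler_pdivlMr// div1r.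
move: hgx; rewrite /minlist !big_cons !le_min !lee_fin.
move=> /andP[gx1 /andP[gx2 /andP[_ /andP[_ /andP[_ /andP[gx6 _]]]]]].
move: hgy; rewrite /minlist !big_cons !le_min !lee_fin.
move=> /andP[gy1 /andP[gy2 /andP[_ /andP[gy4 _]]]].
have N0 : 0 < nIR by exact: lt_le_trans thRN.
have S0 : 0 < nIC by exact: lt_le_trans thCS.
have D0 : 0 < dR2 by exact: lt_le_trans D1.
have F0 : 0 < dC2 by exact: lt_le_trans F1.
have c32_gt0 : 0 < c32 by rewrite mulr_gt0 ?exprn_gt0.
have e1_gt0 : 0 < e1.
  by apply: ltr_pwDl; [rewrite mulr_gt0 ?exprn_gt0|rewrite /d2; nonneg].
have b0 : 0 < thC * gy by exact: mulr_gt0.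
have gx_b : gx * (2 * Num.sqrt (fnorm uR * e1 * c32)) <=
    Num.sqrt (M * fnorm uC) * (thC * gy).
  have s_gt0 : 0 < 2 * Num.sqrt (fnorm uR * e1 * c32).
    by rewrite mulr_gt0 ?sqrtr_gt0 ?mulr_gt0.
  move: gx6; rewrite bfrac_fin ?gt_eqF// -EFinM lee_fin.
  by rewrite mulrAC ler_pdivlMr.
have gx_ax : gx * (8 * Num.sqrt (Cs * d42 * c24)) <= thR * (alx * r * delta).
  have -> : thR * (alx * r * delta) = thR * alx * r * delta by ring.
  apply: le_bfrac gx2; first by nonneg.
  by rewrite mulr_ge0 ?sqrtr_ge0.
have gy_e2 : gy * (4 * e1 * c32 * d53) <= thC * e2 * d52.
  by apply: le_bfrac gy2; rewrite /e2 /d52 /d53 /d3 /d4; nonneg.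
have gy_ay : gy * (16 * Cs * e2 * d52 * c45) <=
    thC * (aly * r * delta) ^+ 2 * d42.
  by apply: le_bfrac gy4; rewrite /e2 /d52 /c45 /d42 /d3 /d4; nonneg.
move: hl; rewrite {1}/minlist !big_cons !le_min.
move=> /andP[l1 /andP[l2 /andP[_ /andP[_ /andP[l5 _]]]]].
have L0 : 0 <= L by exact: bigmax_ge_id.
have Ls_le i : Ls i <= L by exact: (le_bigmax _ Ls).
pose a := thR * gx.
have [a_le _] := a_bound nK uR0 uC0 (N := nIR) (S := nIC) hM thR0 thC0 hgx0 hgy0
  F1 Cs0 gy1 thC1 thRN thCS uCF Mn gx_b.
have a0 : 0 < a by exact: mulr_gt0.
(* Any positive upper bound of the Lipschitz constants satisfying these inequalities will do: [L]
   itself when positive, otherwise a small surrogate. *)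
have [Lp [Lp0 LLp lL lLC k1]] : exists Lp, [/\ 0 < Lp, L <= Lp,
    lhat ^+ 2 * Lp ^+ 2 <= 1 / 36, lhat ^+ 2 * Lp ^+ 2 * Cs <= 1 / 36 &
    384 * (lhat ^+ 2 * Lp ^+ 2 * fnorm uR * fnorm uC ^+ 3 * dR2 ^+ 2) <=
      n%:R ^+ 2 * M * a ^+ 2].
  have [L_le0|L_gt0] := leP L 0; last first.
    exists L; split => //.
    - have h : lhat * (6 * L) <= 1 by apply: le_bfrac l1 => //; nonneg.
      have h0 : 0 <= lhat * (6 * L) by nonneg.
      have := ler_sqr_ge0 h0 h; lra.
    - have h : lhat * L * (6 * Num.sqrt Cs) <= 1.
        rewrite (_ : _ * _ = lhat * (6 * Num.sqrt Cs * L)); last by ring.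
        by apply: le_bfrac l2 => //; rewrite mulr_ge0// mulr_ge0 ?sqrtr_ge0.
      have lL0 : 0 <= lhat * L by nonneg.
      by have := le_mul_sqrt lL0 (ler0n K 6) Cs0 h; lra.
    - apply: (lhat_k1 nK uR0 uC0 lhat0 hM thR0 thC0 hgx0 hgy0 D1 F1 Cs0 gy1 thC1
        thRN thCS uCF Mn gx_b L_gt0).
      have m1_le : (m1 <= bfrac 1 (2 * Num.sqrt c2) * bfrac thR (1 - thR * gx))%E.
        by rewrite /m1 /minlist big_cons ge_min lexx.
      have E0 : 0 < E.
        by rewrite /E divr_gt0 ?mulr_gt0 ?exprn_gt0.
      have sE0 : 0 < Num.sqrt (96 * E) by rewrite sqrtr_gt0 mulr_gt0.
      have sD0 : 0 < Num.sqrt c2 by rewrite sqrtr_gt0 mulr_gt0 ?exprn_gt0.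
      have a1 : 0 < 1 - thR * gx by lra.
      rewrite -lee_fin EFinM -!EFinM.
      apply: le_trans l5 _; rewrite !bfrac_fin ?gt_eqF ?mulr_gt0// in m1_le *.
      rewrite -!EFinM in m1_le *.
      by rewrite [leRHS]EFinM; apply: lee_wpmul2r => //; rewrite lee_fin; nonneg.
  have L_eq0 : L = 0 by apply/eqP; rewrite eq_le L_le0 L0.
  have q0 : 0 < n%:R ^+ 2 * M * a ^+ 2 by rewrite !mulr_gt0 ?exprn_gt0.
  have [t t0 [t1 t2 t3]] := small_lipschitz lhat dR2 Cs0 (ltW uR0) (ltW uC0) q0.
  by exists t; split => //; rewrite L_eq0 ltW.
have sf i : smooth Lp (f i).
  apply: (smooth_of_lipschitz (ltW Lp0) (le_trans (Ls_le i) LLp)).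
    exact: fun_diff hF i.
  exact: fun_lip hF i.
have sc := stepsize_conditionsP nK uR0 uC0 lhat0 hM thR0 thC0 hgx0 hgy0 D1 F1 Cs0
  alr0 blr0 delta0 alr1 blr1 delta1 gx1 gy1 thR1 thC1 thRN thCS S2 uCF Mn hlb lbn
  gx_b gx_ax gy_e2 gy_ay Lp0 lL lLC k1.
have lbL := lb_L_le1 nK uR0 uC0 lhat0 hM thR0 thC0 hgx0 hgy0 D1 F1 Cs0 gy1 thC1
  thRN thCS uRD uCF Mn hlb lbn gx_b Lp0 k1.
have hPL x : 2 * mu * (favg f x - favg f xs) <= sqn (grad (favg f) x).
  by rewrite -sqr_fnorm; exact: fun_PL hF x.
have mu0 := fun_mu_gt0 hF.
have [rho_o rho_a rho_b rho_x rho_y] : [/\ 1 - 2^-1 * lbar * mu <= rho,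
    1 - thR * gx / 16 <= rho, 1 - thC * gy / 8 <= rho,
    1 - alx * r * delta / 4 <= rho & 1 - aly * r * delta / 16 <= rho].
  split; rewrite /rho !le_max ?lexx ?orbT//.
  apply/orP; left; have h := ler_wpM2r (ltW mu0) hlb.
  by move: h; rewrite -/lbar -/lhat; lra.
(* Strictness matters for both rates: the Young ratio in [sqn_contract_step] divides by one minus
   the rate. *)
have a_lt1 : thR * gx < 1 by lra.
have b_lt1 : thC * gy < 1.
  have h := sc_gyS sc.
  have h1 : thC * gy <= gy * nIC * dC2.
    rewrite mulrC -mulrA ler_pM2l//; apply: le_trans thCS _.
    by rewrite ler_peMr// ltW.
  by apply: le_lt_trans h1 _; lra.
have s0 k : 0 < s k by have [] := hs k.
have sE k : s k ^+ 2 = c0 * c ^+ k by have [] := hs k.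
have c_ge0 : 0 <= c.
  by apply: ltW; apply: lt_trans rho_c; apply: lt_le_trans rho_a; lra.
split; apply: linear_rateP => //.
- move=> k; rewrite unlock; apply: Ex_ge0 => w.
  by rewrite subr_ge0; exact: fun_min hF _.
- have [B hB] := objective_rate n_gt0 huR huC R1 C1 hnormR hnormC (fun_min hF) hPL
    (ltW Lp0) sf hQ hzeta lam_l erefl lbL halx0 haly0 a_lt1 b_lt1 s0 sc rho_o rho_a
    rho_b rho_x rho_y rho_c c00 sE (X0 := X0).
  by exists B => k; rewrite unlock; exact: hB k.
- by move=> k; rewrite unlock; apply: Ex_ge0 => w; rewrite sqr_ge0.
- have [B hB] := consensus_rate n_gt0 huR huC R1 C1 hnormR hnormC (fun_min hF) hPL
    (ltW Lp0) sf hQ hzeta lam_l erefl lbL halx0 haly0 a_lt1 b_lt1 s0 sc rho_o rho_a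
    rho_b rho_x rho_y rho_c c00 sE (X0 := X0).
  exists B => k; rewrite unlock; apply: le_trans (hB k).
  rewrite le_eqVlt; apply/orP; left; apply/eqP; apply: eq_integral => w _.
  by rewrite sqr_fnorm.
Qed.
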